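(* Let $\{\mu_t\}_{t\in[0,1]}$ be a displacement interpolation in $\mathcal{P}_{2,ac}(\mathbb{R}^n)$, driven by a smooth velocity field, such that each $\mu_t$ is even and satisfies the odd Poincaré inequality with constant $1$, that is, $\int f^2\,d\mu_t\le\int|\nabla f|^2\,d\mu_t$ for every odd test function $f$. Then, with $\gamma$ the standard Gaussian measure on $\mathbb{R}^n$, $$\frac{d^2}{dt^2}D(\mu_t\Vert\gamma)\ \ge\ 2\,\mathscr{W}_2^2(\mu_0,\mu_1)+\frac1n\left(\frac{d}{dt}D(\mu_t\Vert\gamma)\right)^2$$ in the distributional sense in $t$.
   Context: $\mathcal{P}_{2,ac}(\mathbb{R}^n)$ is the set of Borel probability measures on $\mathbb{R}^n$ with finite second moment that are absolutely continuous with respect to Lebesgue measure. $\gamma$ has density $(2\pi)^{-n/2}e^{-|x|^2/2}$. A measure $\mu$ is even if $\mu(E)=\mu(-E)$ for all measurable $E$; $f$ is odd if $f(-x)=-f(x)$. A test function is a smooth compactly supported function on $\mathbb{R}^n$. $D(\mu\Vert\gamma)=\int\frac{d\mu}{d\gamma}\log\frac{d\mu}{d\gamma}\,d\gamma$ if $\mu\ll\gamma$, $+\infty$ otherwise. $\mathscr{W}_2(\mu_0,\mu_1)=\big(\inf_\pi\int|x-y|^2\,d\pi(x,y)\big)^{1/2}$, the infimum being over all couplings $\pi$ of $\mu_0,\mu_1$. Displacement interpolation: with $T=\nabla\phi$ ($\phi$ convex) the Brenier map pushing $\mu_0$ to $\mu_1$ and $T_t=(1-t)I+tT$, one sets $\mu_t=(T_t)_{\#}\mu_0$.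 Its velocity field $v_t$ is determined $\mu_t$-a.e. by $v_t(T_t(x))=\frac{d}{dt}T_t(x)$; it is of gradient form $v_t=\nabla\theta_t$, satisfies the continuity equation $\frac{d}{dt}\int\varphi\,d\mu_t=\int\langle\nabla\varphi,\nabla\theta_t\rangle\,d\mu_t$ for test functions $\varphi$, and $\partial_t\theta_t+\frac12|\nabla\theta_t|^2=0$. ''Driven by a smooth velocity field'' means that $\theta_t(x)$ can be chosen (sufficiently) smooth in $(t,x)$. *)

(* Defs.v *)
From HB Require Import structures.
From mathcomp Require Import all_boot all_order all_algebra.
From mathcomp Require Import all_classical all_reals all_analysis.
From mathcomp Require Import measurable_realfun lra.

Set Implicit Arguments.
Unset Strict Implicit.
Unset Printing Implicit Defensive.
Import Order.TTheory GRing.Theory Num.Theory.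
Import numFieldNormedType.Exports.
Local Open Scope classical_set_scope.
Local Open Scope ring_scope.

(* 'M[R]_(m, n), hence R^n = 'rV[R]_n, carries the Borel sigma-algebra. *)
Definition mx_borel_display : measure_display.
Proof. exact: default_measure_display. Qed.

Section mx_borel.
Context {R : realType} {m n : nat}.

Definition mx_borel : set (set 'M[R]_(m, n)) := <<s open >>.

HB.instance Definition _ := @isMeasurable.Build mx_borel_display
  'M[R]_(m, n) mx_borel (@sigma_algebra0 _ setT open)
  (@sigma_algebraC _ open) (@sigma_algebra_bigcup _ setT open).

Lemma mx_open_measurable (U : set 'M[R]_(m, n)) : open U -> measurable U.
Proof. by move=> oU; exact: sub_sigma_algebra. Qed.

Lemma mx_continuous_measurable (f : 'M[R]_(m, n) -> R) :
  continuous f -> measurable_fun setT f.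
Proof.
move=> cf; apply: (@measurability _ _ _ R setT f _ (RGenOpens.measurableE R)).
move=> _ [_ [a [b ->] <-]].
rewrite setTI; apply: mx_open_measurable.
by apply: open_comp => [x _|]; [exact: cf|exact: interval_open].
Qed.

End mx_borel.

Section rV_coordinates.
Context {R : realType} {n : nat}.

Let box (ab : 'rV[rat]_n * 'rV[rat]_n) : set 'rV[R]_n :=
  [set x | forall i, ratr (ab.1 0 i) < x 0 i < ratr (ab.2 0 i)].

Let open_box (U : set 'rV[R]_n) : open U ->
  U = \bigcup_ab (if `[< box ab `<=` U >] then box ab else set0).
Proof.
move=> oU; apply/seteqP; split => [x Ux|x [ab _]]; last first.
  by case: asboolP => // abU; exact: abU.
have /nbhs_ballP[e /= e0 eU] : nbhs x U by exact: open_nbhs_nbhs.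
have /choice[a aP] (i : 'I_n) : exists q : rat, x 0 i - e < ratr q < x 0 i.
  have /rat_in_itvoo[q] : x 0 i - e < x 0 i by rewrite ltrBlDr ltrDl.
  by rewrite in_itv/= => ?; exists q.
have /choice[b bP] (i : 'I_n) : exists q : rat, x 0 i < ratr q < x 0 i + e.
  have /rat_in_itvoo[q] : x 0 i < x 0 i + e by rewrite ltrDl.
  by rewrite in_itv/= => ?; exists q.
exists (\row_i a i, \row_i b i) => //.
case: asboolP => [_ i /=|].
  by rewrite !mxE; have /andP[_ ->] := aP i; have /andP[-> _] := bP i.
case => y yab; apply: eU; split => // i j; rewrite ord1 /ball/=.
have := yab j; rewrite /= !mxE => /andP[ay yb].
have /andP[xa ax] := aP j; have /andP[xb bx] := bP j.
by rewrite ltr_norml; apply/andP; split; lra.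
Qed.

Lemma measurable_fun_rVP d (T : measurableType d) (f : T -> 'rV[R]_n) :
  measurable_fun setT f <-> forall i, measurable_fun setT (fun x => f x 0 i).
Proof.
split=> [mf i|mf].
  apply: (@measurableT_comp _ _ _ _ _ _ (fun v : 'rV[R]_n => v 0 i) _ f) => //.
  by apply: mx_continuous_measurable; exact: coord_continuous.
apply: (@measurability _ _ T 'rV[R]_n setT f open) => // _ [U oU <-].
rewrite setTI (open_box oU) preimage_bigcup.
apply: countable_bigcupT_measurable => // ab.
case: asboolP => _; last by rewrite preimage_set0.
rewrite (_ : _ @^-1` _ = \bigcap_(i in [set: 'I_n])
    ((fun x => f x 0 i) @^-1` `]ratr (ab.1 0 i), ratr (ab.2 0 i)[%classic)).
  apply: fin_bigcap_measurable => // i _; rewrite -[X in measurable X]setTI.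
  by apply: mf => //; exact: measurable_itv.
apply/seteqP; split => [x /= abx i _|x /= abx i]; first by rewrite /= in_itv/= abx.
by have := abx i I; rewrite /= in_itv.
Qed.


End rV_coordinates.

Section lebesgue_rV.
Context {R : realType}.

Definition row_cons n (p : R * 'rV[R]_n) : 'rV[R]_n.+1 :=
  \row_i (if unlift ord0 i is Some j then p.2 0 j else p.1).

Lemma measurable_row_cons n : measurable_fun setT (@row_cons n).
Proof.
apply/measurable_fun_rVP => i; rewrite /row_cons.
under eq_fun do rewrite mxE.
case: unliftP => [j _|_]; last exact: measurable_fst.
apply: (@measurableT_comp _ _ _ _ _ _ (fun v : 'rV[R]_n => v 0 j) _ snd) => //.
by apply: mx_continuous_measurable; exact: coord_continuous.
Qed.

Section succ.
Local Open Scope ereal_scope.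
Context (n : nat) (m : {sigma_finite_measure set 'rV[R]_n -> \bar R}).

Definition lebesgue_rVS : set 'rV[R]_n.+1 -> \bar R :=
  pushforward (@lebesgue_measure R \x m) (@row_cons n).

Let pushforward_measure : {measure set 'rV[R]_n.+1 -> \bar R} :=
  measure_function_pushforward__canonical__measure_function_Measure
    (@lebesgue_measure R \x m) (@measurable_row_cons n).

HB.instance Definition _ := isMeasure.Build _ _ _ lebesgue_rVS
  (measure0 pushforward_measure) (measure_ge0 pushforward_measure)
  (@measure_semi_sigma_additive _ _ _ pushforward_measure).

Let lebesgue_rVS_sigma_finite : sigma_finite setT lebesgue_rVS.
Proof.
have [F TF Foo] : sigma_finite setT (@lebesgue_measure R \x m).
  have /sigma_finiteP[F [TF ndF Foo]] := sigma_finiteT (@lebesgue_measure R).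
  have /sigma_finiteP[G [TG ndG Goo]] := sigma_finiteT m.
  exists (fun k => F k `*` G k).
    rewrite -setXTT TF TG; apply/seteqP; split=> -[x y] /=; last first.
      by move=> [k _ []/= ? ?]; split; exists k.
    move=> [[i _ Fix] [j _ Gjy]]; exists (maxn i j) => //; split => /=.
    - by move: x Fix; exact/subsetPset/ndF/leq_maxl.
    - by move: y Gjy; exact/subsetPset/ndG/leq_maxr.
  move=> k; have [mF Fk] := Foo k; have [mG Gk] := Goo k.
  split; first exact: measurableX.
  by rewrite product_measure1E// lte_mul_pinfty// ge0_fin_numE.
pose uncons (x : 'rV[R]_n.+1) :=
  (x ord0 ord0, (\row_j x ord0 (lift ord0 j))%R : 'rV[R]_n).
have consK : cancel (@row_cons n) uncons.
  move=> [r x]; congr pair; rewrite /row_cons/= ?mxE ?unlift_none//.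
  by apply/rowP => j; rewrite !mxE liftK.
have unconsK : cancel uncons (@row_cons n).
  move=> x; apply/rowP => i; rewrite !mxE/=.
  by case: unliftP => [j ->|->]; rewrite ?mxE.
have muncons : measurable_fun setT uncons.
  apply/measurable_fun_pairP; split.
    by apply: mx_continuous_measurable; exact: coord_continuous.
  apply/measurable_fun_rVP => j; rewrite /comp/=; under eq_fun do rewrite mxE.
  by apply: mx_continuous_measurable; exact: coord_continuous.
exists (fun k => uncons @^-1` F k); first by rewrite -preimage_bigcup -TF preimage_setT.
move=> k; have [mF Fk] := Foo k; split.
  by rewrite -[X in measurable X]setTI; exact: muncons.
rewrite /lebesgue_rVS /pushforward -comp_preimage.
by rewrite (_ : uncons \o _ = id) ?preimage_id//; apply/funext.
Qed.

HB.instance Definition _ := Measure_isSigmaFinite.Build _ _ _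
  lebesgue_rVS lebesgue_rVS_sigma_finite.

End succ.

Fixpoint lebesgue_rV (n : nat) : {sigma_finite_measure set 'rV[R]_n -> \bar R} :=
  match n with
  | 0 => [the {sigma_finite_measure set 'rV[R]_0 -> \bar R} of
           dirac (0 : 'rV[R]_0)]
  | k.+1 => [the {sigma_finite_measure set 'rV[R]_k.+1 -> \bar R} of
              lebesgue_rVS (lebesgue_rV k)]
  end.

End lebesgue_rV.

(* lebesgue_rV is the usual Lebesgue measure: the volume of a box. *)
Lemma lebesgue_rV_box (R : realType) n (A : 'I_n -> set R) :
  (forall i, measurable (A i)) ->
  lebesgue_rV n [set x : 'rV[R]_n | forall i, A i (x 0 i)] =
  (\prod_(i < n) lebesgue_measure (A i))%E.
Proof.
elim: n A => [|n IH] A mA.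
  by rewrite big_ord0 /= diracE mem_set//= => -[].
have mB : measurable [set x : 'rV[R]_n | forall j, A (lift ord0 j) (x 0 j)].
  rewrite (_ : mkset _ = \bigcap_(j in [set: 'I_n])
      ((fun x : 'rV[R]_n => x 0 j) @^-1` A (lift ord0 j))).
    apply: fin_bigcap_measurable => // j _; rewrite -[X in measurable X]setTI.
    by apply: mx_continuous_measurable => //; exact: coord_continuous.
  by apply/seteqP; split => x /= xA i; [move=> _|]; exact: xA.
rewrite big_ord_recl/= /lebesgue_rVS /pushforward -IH//.
rewrite -product_measure1E//; last exact: mA.
congr (_ _).
apply/seteqP; split => [[r x] /= xA|[r x] [/= rA xA] i].
  split => [|j]; first by have := xA ord0; rewrite mxE unlift_none.
  by have := xA (lift ord0 j); rewrite mxE liftK.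
by rewrite mxE; case: unliftP => [j ->|->].
Qed.

Section euclidean.
Context {R : realType} {n : nat}.
Implicit Types (x y : 'rV[R]_n) (f : 'rV[R]_n -> R).

Definition dot x y : R := \sum_(i < n) x 0 i * y 0 i.

(* The library norm `|x| is the sup norm, hence the separate |x|^2. *)
Definition sqnorm x : R := dot x x.

Definition grad f x : 'rV[R]_n := \row_i 'D_(delta_mx 0 i) f x.

Lemma sqnorm_ge0 x : 0 <= sqnorm x.
Proof. by apply: sumr_ge0 => i _; rewrite -expr2 sqr_ge0. Qed.

Lemma measurable_sqnorm : measurable_fun setT sqnorm.
Proof.
rewrite /sqnorm /dot; apply: measurable_sum => i.
by apply: measurable_funM; apply: mx_continuous_measurable;
  exact: coord_continuous.
Qed.

End euclidean.

Section gaussian.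
Context {R : realType} (n : nat).
Local Notation leb := (@lebesgue_rV R n).

Definition gauss_density (x : 'rV[R]_n) : R :=
  (2 * pi) `^ (- (n%:R / 2)) * expR (- (sqnorm x / 2)).

Lemma gauss_density_ge0 x : 0 <= gauss_density x.
Proof. by rewrite mulr_ge0 ?powR_ge0 ?expR_ge0. Qed.

Lemma measurable_gauss_density : measurable_fun setT gauss_density.
Proof.
apply: measurable_funM => //; apply: measurableT_comp => //.
apply: measurableT_comp => //; apply: measurable_funM => //.
exact: measurable_sqnorm.
Qed.

Local Open Scope ereal_scope.

Definition gauss_measure : set 'rV[R]_n -> \bar R :=
  fun A => \int[leb]_(x in A) (gauss_density x)%:E.

Let gauss0 : gauss_measure set0 = 0.
Proof. by rewrite /gauss_measure integral_set0. Qed.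

Let gauss_ge0 A : 0 <= gauss_measure A.
Proof. by apply: integral_ge0 => x _; rewrite lee_fin gauss_density_ge0. Qed.

Let mgauss A : measurable_fun A (EFin \o gauss_density).
Proof.
by apply/measurable_EFinP; apply: measurable_funTS; exact: measurable_gauss_density.
Qed.

Let gauss_sigma_additive : semi_sigma_additive gauss_measure.
Proof.
move=> F mF tF mUF; rewrite /gauss_measure ge0_integral_bigcup//; last first.
  by move=> x _; rewrite lee_fin gauss_density_ge0.
apply: is_cvg_ereal_nneg_natsum_cond => k _ _.
by apply: integral_ge0 => x _; rewrite lee_fin gauss_density_ge0.
Qed.

HB.instance Definition _ := isMeasure.Build _ _ _ gauss_measure
  gauss0 gauss_ge0 gauss_sigma_additive.

Let gauss_sigma_finite : sigma_finite setT gauss_measure.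
Proof.
have [F TF Foo] := sigma_finiteT leb.
exists F => // k; have [mF Fk] := Foo k; split => //.
pose c : R := ((2 * pi) `^ (- (n%:R / 2)))%R.
apply: (@le_lt_trans _ _ (\int[leb]_(x in F k) c%:E)).
  apply: ge0_le_integral => //= x _; rewrite lee_fin ?gauss_density_ge0//.
  rewrite ler_piMr ?powR_ge0// -expR0 ler_expR oppr_le0.
  by rewrite divr_ge0// sqnorm_ge0.
by rewrite integral_cst// lte_mul_pinfty// lee_fin powR_ge0.
Qed.

HB.instance Definition _ := Measure_isSigmaFinite.Build _ _ _
  gauss_measure gauss_sigma_finite.

End gaussian.
Arguments gauss_density {R} n x.
Arguments gauss_measure {R} n A.

Section smoothness.
Context {R : realType}.

(* Ck_on U k f means f is C^k on the open set U: all iterated directional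
   derivatives of order at most k exist and are continuous on U. *)
Fixpoint Ck_on (V : normedModType R) (U : set V) (k : nat) (f : V -> R^o)
    : Prop :=
  if k is k'.+1 then
    {in U, continuous f} /\
    forall v, (forall x, U x -> derivable f x v) /\ Ck_on U k' ('D_v f)
  else {in U, continuous f}.

Definition smooth_on (V : normedModType R) (U : set V) (f : V -> R^o) : Prop :=
  forall k, Ck_on U k f.

Definition test_function (V : normedModType R) (U : set V) (f : V -> R^o)
    : Prop :=
  let supp := closure [set x | f x != 0] in
  [/\ smooth_on setT f, compact supp & supp `<=` U].

End smoothness.

Section optimal_transport.
Context {R : realType} {n : nat}.
Local Notation Rn := 'rV[R]_n.
Implicit Types (mu nu : probability Rn R) (T : Rn -> Rn).

Definition P2ac mu : Prop :=
  (\int[mu]_x (sqnorm x)%:E < +oo)%E /\ mu `<< @lebesgue_rV R n.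

Definition even_measure mu : Prop :=
  forall A, measurable A -> mu A = mu [set x : Rn | A (- x)].

Definition odd_poincare1 mu : Prop :=
  forall f : Rn -> R^o, test_function setT f -> (forall x, f (- x) = - f x) ->
  (\int[mu]_x (f x ^+ 2)%:E <= \int[mu]_x (sqnorm (grad f x))%:E)%E.

Definition relative_entropy mu (ga : {sigma_finite_measure set Rn -> \bar R})
    : \bar R :=
  if `[< mu `<< ga >] then
    (\int[ga]_x
       (let r := fine (Radon_Nikodym (charge_of_finite_measure mu) ga x) in
        (r * ln r)%R%:E))%E
  else +oo%E.

Definition coupling mu nu (pi : probability (Rn * Rn)%type R) : Prop :=
  forall A, measurable A ->
    pi (A `*` setT) = mu A /\ pi (setT `*` A) = nu A.

Definition W2 mu nu : \bar R :=
  (ereal_inf [set \int[pi]_z (sqnorm (z.1 - z.2))%:E | pi in coupling mu nu]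
    `^ 2^-1)%E.

(* A convex function Rn -> ]-oo, +oo] is given by its domain D and its finite
   values phi on D; it is differentiable only at interior points of D. *)
Definition brenier_map mu nu T : Prop :=
  [/\ measurable_fun setT T,
      forall A, measurable A -> nu A = pushforward mu T A
    & exists (D : set Rn) (phi : Rn -> R^o),
      [/\ convex_set D, convex_function D phi
        & \forall x \ae mu,
            [/\ interior D x, differentiable phi x & grad phi x = T x]]].

Definition interp T (t : R) (x : Rn) : Rn := (1 - t) *: x + t *: T x.

Definition displacement_interpolation (mu : R -> probability Rn R) T : Prop :=
  brenier_map (mu 0) (mu 1) T /\
  forall t, 0 <= t <= 1 -> forall A, measurable A ->
    mu t A = pushforward (mu 0) (interp T t) A.

(* theta t is a potential of the velocity field: v_t = grad (theta t) is
   determined by v_t (T_t x) = d/dt T_t x, up to null sets. *)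
Definition driven_by_smooth_velocity (mu : R -> probability Rn R) T : Prop :=
  exists theta : R -> Rn -> R^o,
  [/\ smooth_on [set z : R^o * Rn | 0 < z.1 < 1] (fun z => theta z.1 z.2),
      forall t, 0 < t < 1 -> \forall x \ae mu 0,
        grad (theta t) (interp T t x) = (fun s => interp T s x)^`()%classic t,
      forall t (phi : Rn -> R^o), 0 < t < 1 -> test_function setT phi ->
        is_derive (t : R^o) 1 (fun s => \int[mu s]_x phi x : R^o)
          (\int[mu t]_x dot (grad phi x) (grad (theta t) x))
    & forall t, 0 < t < 1 -> \forall x \ae mu t,
        (fun s => theta s x)^`()%classic t + 2^-1 * sqnorm (grad (theta t) x) = 0].

End optimal_transport.

Section distributions.
Context {R : realType}.
Local Notation leb := (@lebesgue_measure R).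
Implicit Types (U : set R) (f g h eta : R -> R).

Definition distr_derivative U f g : Prop :=
  [/\ locally_integrable U f, locally_integrable U g
    & forall eta, test_function (U : set R^o) eta ->
      \int[leb]_(t in U) (f t * eta^`()%classic t) =
      - \int[leb]_(t in U) (g t * eta t)].

Definition distr_derivative2_ge U f h : Prop :=
  [/\ locally_integrable U f, locally_integrable U h
    & forall eta, test_function (U : set R^o) eta -> (forall t, 0 <= eta t) ->
      \int[leb]_(t in U) (h t * eta t) <=
      \int[leb]_(t in U) (f t * eta^`(2)%classic t)].

End distributions.

(* Main.v *)
Require Import Defs.
From HB Require Import structures.
From mathcomp Require Import all_boot all_order all_algebra fingroup perm.
From mathcomp Require Import all_classical all_reals all_analysis.
From mathcomp Require Import measurable_realfun ring lra.
Import Order.TTheory GRing.Theory Num.Theory.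
Import numFieldNormedType.Exports.
Set Implicit Arguments.
Unset Strict Implicit.
Unset Printing Implicit Defensive.
Local Open Scope classical_set_scope.
Local Open Scope ring_scope.

(* Let v_s = grad theta_s and H_s = Dv_s. For tau = t - s the map
   F y = y + tau v_s y pushes mu_s to mu_t and satisfies v_t (F y) = v_s y for
   mu_s-almost every y. Since almost every point of a measurable set is an
   accumulation point of the set in each coordinate direction, such almost
   everywhere identities may be differentiated: (1 + tau H_s) (H_t o F) = H_s
   a.e., and monotonicity of the Brenier map bounds H_s a.e., locally uniformly
   in s. The area inequality for F together with log z <= z - 1 then gives
   D(mu_s) <= D(mu_t) - tau a(s) + C tau^2 for s, t in a compact subset of
   ]0, 1[, where a = int <x, v> - tr H; exchanging s and t yields D' = a, and
   the identity for H_t yields a' = int |H|^2 + |v|^2.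
   Testing the continuity equation with atan(theta_o) times a cutoff, theta_o
   the odd part of theta, shows that v_s is odd mu_s-a.e. The odd Poincare
   inequality for the components of v - c x therefore gives
   int |H - c I|^2 >= int |v - c x|^2, and c = - a / n yields
   a' >= 2 int |v|^2 + a^2 / n, where int |v|^2 >= W2^2. *)

(** * Linear changes of variables *)

(** The obstacle is that nothing is controlled outside the mass of mu_t: it may be carried by a set
    without interior, off which theta is arbitrary, and theta is smooth only for t in ]0, 1[. So
    there is no flow of diffeomorphisms to work with. Every identity or bound is obtained on a
    measurable set of full measure and differentiated at its accumulation points, and the change of
    variables is an inequality on a set X where F o S = id. An inequality suffices because it is
    used in both time directions. The arctangent makes the test function bounded although theta is
    not known to be integrable; the weight 1 / (1 + theta_o^2) that it produces is positive, which
    is enough to conclude. The value of c is the optimal one: the Poincare inequality reads int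
    |H|^2 >= int |v|^2 - 2 c a - n c^2 + c^2 int |x|^2; the last term is dropped and c = - a / n
    maximises the rest. Finite entropy is available at one time only, possibly 0 or 1. A Lipschitz
    form of the area inequality first carries it to all interior times. *)

Section affine_line.
Context {R : realType}.
Local Notation leb := (@lebesgue_measure R).

Lemma measurable_affine (a b : R) : measurable_fun setT (fun r : R => r * a + b).
Proof. by apply: measurable_funD => //; apply: measurable_funM. Qed.

(** The rescaled push-forward agrees with Lebesgue measure on half-open intervals, which determine
    it. *)
Lemma lebesgue_measure_affine (a b : R) (A : set R) : a != 0 -> measurable A ->
  ((`|a|%R)%:E * leb [set r : R | A (r * a + b)%R] = leb A)%E.
Proof.
move=> a0 mA.
pose k : {nonneg R} := NngNum (normr_ge0 a).
pose f (r : R) : measurableTypeR R := r * a + b.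
have mf : measurable_fun setT f by exact: measurable_affine.
pose pf : {measure set (measurableTypeR R) -> \bar R} :=
  measure_function_pushforward__canonical__measure_function_Measure leb mf.
pose m : {measure set (measurableTypeR R) -> \bar R} := mscale k pf.
rewrite [RHS](_ : _ = m A) // -(@lebesgue_measure_unique R m)//.
move=> _ [[x y] _ <-] /=.
rewrite lebesgue_measure_itv/= /mscale/= /pushforward/=.
have [xy|yx] := ltP x y; last first.
  rewrite lte_fin ltNge yx/=.
  rewrite (_ : _ @^-1` _ = set0) ?measure0 ?mule0//.
  rewrite -subset0 => r/=; rewrite in_itv/= => /andP[xr ry].
  by have := lt_le_trans xr ry; rewrite ltNge yx.
rewrite lte_fin xy.
have [ap|an] := ltP 0 a.
  rewrite (_ : _ @^-1` _ = `](x - b) / a, (y - b) / a]%classic); last first.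
    apply/seteqP; split => r/=; rewrite !in_itv/=.
    - by rewrite ltr_pdivrMr// ler_pdivlMr// ltrBlDr lerBrDr.
    - by rewrite ltr_pdivrMr// ler_pdivlMr// ltrBlDr lerBrDr.
  rewrite lebesgue_measure_itv/= lte_fin ltr_pM2r ?invr_gt0// ltrD2r xy.
  by rewrite gtr0_norm// -!EFinB -EFinM; congr EFin; field.
(* A decreasing map exchanges the open and the closed end of the interval; the length is
   unaffected. *)
have {}an : a < 0 by rewrite lt_neqAle a0.
rewrite (_ : _ @^-1` _ = `[(y - b) / a, (x - b) / a[%classic); last first.
  apply/seteqP; split => r/=; rewrite !in_itv/=.
  - by rewrite ltr_ndivlMr// ler_ndivrMr// ltrBlDr lerBrDr andbC.
  - by rewrite ltr_ndivlMr// ler_ndivrMr// ltrBlDr lerBrDr andbC.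
rewrite lebesgue_measure_itv/= lte_fin ltr_nM2r ?invr_lt0// ltrD2r xy.
by rewrite ltr0_norm// -!EFinB -EFinM; congr EFin; field.
Qed.

Lemma ge0_integral_affine (a b : R) (f : R -> \bar R) : a != 0 ->
  measurable_fun setT f -> (forall r, 0 <= f r)%E ->
  ((`|a|%R)%:E * \int[leb]_r f (r * a + b)%R = \int[leb]_r f r)%E.
Proof.
move=> a0 mf f0.
pose k : {nonneg R} := NngNum (normr_ge0 a).
pose g (r : R) : measurableTypeR R := r * a + b.
have mg : measurable_fun setT g by exact: measurable_affine.
pose pf : {measure set (measurableTypeR R) -> \bar R} :=
  measure_function_pushforward__canonical__measure_function_Measure leb mg.
pose m : {measure set (measurableTypeR R) -> \bar R} := mscale k pf.
rewrite [RHS](eq_measure_integral m); last first.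
  by move=> A mA _; rewrite /m/= /mscale/= /pushforward/= lebesgue_measure_affine.
rewrite ge0_integral_mscale// /pf/= ge0_integral_pushforward//.
Qed.

End affine_line.

Section row_cons_theory.
Context {R : realType}.
Local Notation leb := (@lebesgue_measure R).

Lemma row_consE n (r : R) (x : 'rV[R]_n) :
  row_cons (r, x) = row_mx (r%:M : 'M[R]_1) x :> 'rV[R]_(1 + n).
Proof.
apply/rowP => i; rewrite [in RHS]mxE [in LHS]mxE.
case: unliftP => [j ->|->] /=.
  case: splitP => [k|k]; first by rewrite ord1.
  by rewrite /= /bump/= add1n => -[?]; congr (x 0 _); exact: val_inj.
case: splitP => [k _|k //]; by rewrite ord1 mxE eqxx.
Qed.

Lemma measurable_rV_lin n p (M : 'M[R]_(n, p)) (b : 'rV[R]_p) :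
  measurable_fun setT (fun x : 'rV[R]_n => x *m M + b).
Proof.
apply/measurable_fun_rVP => i; under eq_fun do rewrite mxE mxE.
apply: measurable_funD => //; apply: measurable_sum => j.
apply: measurable_funM => //; apply: mx_continuous_measurable.
exact: coord_continuous.
Qed.

Lemma measurable_preimage d1 d2 (T1 : measurableType d1) (T2 : measurableType d2)
  (f : T1 -> T2) (B : set T2) : measurable_fun setT f -> measurable B ->
  measurable (f @^-1` B).
Proof. by move=> mf mB; rewrite -[X in measurable X]setTI; exact: mf. Qed.

Lemma measurable_row_consl n (x : 'rV[R]_n) :
  measurable_fun setT (fun r : R => row_cons (r, x)).
Proof.
apply: (measurableT_comp (@measurable_row_cons R n)).
exact: measurable_pair2.
Qed.

Lemma measurable_row_consr n (r : R) :
  measurable_fun setT (fun x : 'rV[R]_n => row_cons (r, x)).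
Proof.
apply: (measurableT_comp (@measurable_row_cons R n)).
exact: measurable_pair1.
Qed.

Lemma lebesgue_rVS_xsection n (B : set 'rV[R]_n.+1) :
  lebesgue_rV n.+1 B = (\int[leb]_r lebesgue_rV n [set x | B (row_cons (r, x))])%E.
Proof.
rewrite /= /lebesgue_rVS /pushforward /= /product_measure1.
by apply: eq_integral => r _ /=; rewrite xsectionE.
Qed.

(** By uniqueness of the product measure the slices may also run along the first coordinate, in
    which the shear of [lin_vol_shear] is a translation. *)
Lemma lebesgue_rVS_ysection n (B : set 'rV[R]_n.+1) : measurable B ->
  lebesgue_rV n.+1 B = (\int[lebesgue_rV n]_x leb [set r : R | B (row_cons (r, x))])%E.
Proof.
move=> mB; rewrite /= /lebesgue_rVS /pushforward /=.
rewrite (@product_measure_unique _ _ _ _ _ leb (lebesgue_rV n) (leb \x^ lebesgue_rV n)%E).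
- by rewrite /product_measure2; apply: eq_integral => r _ /=; rewrite ysectionE.
- move=> X Y mX mY; have := @product_measure2E _ _ _ _ R leb (lebesgue_rV n) X Y mX mY.
  by move=> <-.
- by apply: measurable_preimage => //; exact: measurable_row_cons.
Qed.

Lemma measurable_fun_row_xsection n (B : set 'rV[R]_n.+1) : measurable B ->
  measurable_fun setT (fun r : R => lebesgue_rV n [set x | B (row_cons (r, x))]).
Proof.
move=> mB.
have mrB : measurable (row_cons (n:=n) @^-1` B).
  by apply: measurable_preimage => //; exact: measurable_row_cons.
have := measurable_fun_xsection (lebesgue_rV n) mrB.
by under [X in measurable_fun _ X -> _]eq_fun do rewrite /= xsectionE.
Qed.

End row_cons_theory.

Section linear_change.
Context {R : realType}.
Local Notation leb := (@lebesgue_measure R).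

Definition lin_vol n (M : 'M[R]_n) : Prop := forall B, measurable B ->
  ((`|\det M|)%:E * lebesgue_rV n [set x | B (x *m M)] = lebesgue_rV n B)%E.

(** The translation is part of the statement because a block triangular linear map acts on each
    slice as an affine map. *)
Definition aff_vol n (M : 'M[R]_n) : Prop := forall (b : 'rV[R]_n) B, measurable B ->
  ((`|\det M|)%:E * lebesgue_rV n [set x | B (x *m M + b)%R] = lebesgue_rV n B)%E.

Lemma lin_aff_vol n (M N : 'M[R]_n) : lin_vol M -> aff_vol N -> aff_vol (M *m N).
Proof.
move=> vM vN b B mB; rewrite det_mulmx normrM mulrC EFinM -muleA.
pose C := [set y : 'rV[R]_n | B (y *m N + b)].
have mC : measurable C.
  by apply: (@measurable_preimage _ _ _ _ (fun y => y *m N + b)) => //; exact: measurable_rV_lin.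
by rewrite -[RHS](vN b)// -(vM C)//; under eq_set do rewrite mulmxA.
Qed.

Lemma aff_vol_block n (a : R) (c : 'rV[R]_n) (D : 'M[R]_n) :
  a != 0 -> aff_vol D -> aff_vol (block_mx a%:M c 0 D : 'M[R]_(1 + n)).
Proof.
move=> a0 vD b B mB; rewrite det_ublock det_scalar1 normrM EFinM.
rewrite !lebesgue_rVS_xsection.
pose b0 := b ord0 ord0; pose b1 : 'rV[R]_n := @rsubmx _ 1 1 n b.
have bE : b = row_cons (b0, b1).
  rewrite row_consE -[LHS](@hsubmxK _ 1 1 n) ; congr row_mx.
  by apply/rowP => i; rewrite !ord1 !mxE eqxx mulr1n; congr (b _ _); apply: val_inj.
pose phi r := lebesgue_rV n [set x | B (row_cons (r, x))].
have mphi : measurable_fun setT phi by exact: measurable_fun_row_xsection.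
transitivity (`|a|%:E * \int[leb]_r phi (r * a + b0)%R)%E; last first.
  by rewrite ge0_integral_affine// => r; exact: measure_ge0.
rewrite -muleA; congr (_ * _)%E.
rewrite -ge0_integralZl//; last first.
  apply: (@measurable_fun_row_xsection _ n (fun x => B (x *m block_mx a%:M c 0 D + b))).
  apply: (@measurable_preimage _ _ _ _ (fun x => x *m _ + b)) => //.
  exact: measurable_rV_lin.
apply: eq_integral => r _; rewrite /phi.
rewrite -[RHS](vD (r *: c + b1)); last first.
  by apply: measurable_preimage => //; exact: measurable_row_consr.
congr (_ * _)%E; congr (lebesgue_rV n _); apply/seteqP; split => x /=.
- rewrite bE !row_consE (@mul_row_block _ 1 1 n 1 n) mulmx0 addr0 add_row_mx.
  by rewrite -scalar_mxM -[(r * a)%:M + _]raddfD /= mul_scalar_mx addrA (addrC (x *m D)).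
- rewrite bE !row_consE (@mul_row_block _ 1 1 n 1 n) mulmx0 addr0 add_row_mx.
  by rewrite -scalar_mxM -[(r * a)%:M + _]raddfD /= mul_scalar_mx addrA (addrC (x *m D)).
Qed.

Lemma lin_vol_shear n (c : 'cV[R]_n) : lin_vol (block_mx 1%:M 0 c 1%:M : 'M[R]_(1 + n)).
Proof.
move=> B mB; rewrite det_lblock !det1 mulr1 normr1 mul1e.
have mB' : measurable [set x : 'rV[R]_n.+1 | B (x *m (block_mx 1%:M 0 c 1%:M : 'M[R]_(1 + n)))].
  apply: (@measurable_preimage _ _ _ _ (fun y : 'rV[R]_n.+1 => y *m _)) => //.
  have := @measurable_rV_lin R n.+1 n.+1 (block_mx 1%:M 0 c 1%:M : 'M[R]_(1 + n)) 0.
  by under [X in measurable_fun _ X -> _]eq_fun do rewrite addr0.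
rewrite !lebesgue_rVS_ysection//.
apply: eq_integral => x _.
rewrite -[RHS](@lebesgue_measure_affine _ 1 ((x *m c) 0 0)) ?oner_eq0//; last first.
  by apply: measurable_preimage => //; exact: measurable_row_consl.
rewrite normr1 mul1e; congr (leb _).
apply/seteqP; split => r /=.
- rewrite !row_consE (@mul_row_block _ 1 1 n 1 n) mulmx0 add0r !mulmx1 mulr1.
  by rewrite raddfD/= -mx11_scalar.
- rewrite !row_consE (@mul_row_block _ 1 1 n 1 n) mulmx0 add0r !mulmx1 mulr1.
  by rewrite raddfD/= -mx11_scalar.
Qed.

(** Induction on the size by elimination: with a nonzero corner [a], the matrix is a shear times a
    block upper triangular matrix whose lower right block is the Schur complement, invertible
    because determinants multiply. *)
Lemma aff_vol_unitmx n (M : 'M[R]_n) : M \in unitmx -> aff_vol M.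
Proof.
elim: n M => [|n IH] M uM.
  move=> b B mB; rewrite det_mx00 normr1 mul1e; congr (lebesgue_rV 0 _).
  by apply/seteqP; split => x; rewrite /= (_ : x *m M + b = x)//; apply/rowP => -[].
have IH1 : aff_vol (1%:M : 'M[R]_n) by apply: IH; exact: unitmx1.
have step (N : 'M[R]_(1 + n)) : N \in unitmx -> N 0 0 != 0 -> aff_vol N.
  move=> uN N0; pose a := N 0 0.
  pose u := @ursubmx _ 1 n 1 n N; pose l := @dlsubmx _ 1 n 1 n N; pose D := @drsubmx _ 1 n 1 n N.
  have NE : N = block_mx a%:M u l D.
    rewrite -[LHS]submxK; congr block_mx.
    by rewrite [LHS]mx11_scalar; congr (_%:M); rewrite !mxE; congr (N _ _); apply: val_inj.
  have NE2 : N = (block_mx 1%:M 0 (a^-1 *: l) 1%:M : 'M[R]_(1 + n)) *m block_mx a%:M u 0 (D - (a^-1 *: l) *m u).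
    rewrite mulmx_block !mul1mx !mul0mx !addr0 mul_mx_scalar scalerA divff// scale1r.
    by rewrite addrC subrK.
  rewrite NE2; apply: lin_aff_vol; first exact: lin_vol_shear.
  apply: aff_vol_block => //; apply: IH.
  move: uN; rewrite NE2 unitmxE det_mulmx det_lblock !det1 !mul1r det_ublock det_scalar1.
  by rewrite unitrM => /andP[_]; rewrite unitmxE.
have [M0|M0] := eqVneq (M 0 0) 0; last exact: step.
have [j Mj] : exists j : 'I_n, M (lift 0 j) 0 != 0.
  apply/existsP; apply: contraTT uM => /existsPn Mj.
  rewrite unitmxE (expand_det_col M 0) big1 ?unitr0// => i _.
  by case: (unliftP 0 i) => [k ->|->]; [have := Mj k; rewrite negbK => /eqP ->|rewrite M0]; rewrite mul0r.
(* If the corner vanishes, [E 1] on the left adds to the first row a row with nonzero first entry,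
   and [E (-1)] undoes this. *)
pose e : 'rV[R]_n := delta_mx 0 j.
pose E (c : R) : 'M[R]_(1 + n) := block_mx 1%:M (c *: e) 0 1%:M.
have vE c : aff_vol (E c) by apply: aff_vol_block => //; exact: oner_neq0.
have EE : E (-1) *m E 1 = 1%:M.
  rewrite /E mulmx_block !mul1mx !mul0mx !mulmx0 !mulmx1 !addr0 add0r !scaleN1r scale1r.
  by rewrite addrN -scalar_mx_block.
have detE c : \det (E c) = 1 by rewrite det_ublock !det1 mulr1.
have uE c : E c \in unitmx by rewrite unitmxE detE unitr1.
rewrite (_ : M = E (-1) *m (E 1 *m M)); last by rewrite mulmxA EE mul1mx.
apply: lin_aff_vol.
  by move=> B mB; rewrite -[RHS](vE (-1) 0 B mB); under [in RHS]eq_set do rewrite addr0.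
apply: step; first by rewrite unitmx_mul uE.
have Ej k : E 1 0 (lift ord0 k) = (k == j)%:R.
  rewrite (_ : lift ord0 k = rshift 1 k); last exact: val_inj.
  transitivity (E 1 (lshift n ord0) (rshift 1 k)); first by congr (E 1 _ _); exact: val_inj.
  by rewrite block_mxEur mxE mul1r mxE eqxx.
rewrite mxE big_ord_recl M0 mulr0 add0r (bigD1 j)//= big1 ?addr0.
  by rewrite Ej eqxx mul1r.
by move=> i ij; rewrite Ej (negbTE ij) mul0r.
Qed.

End linear_change.

(** * Translations, accumulation points and inner regularity *)

Section rV_norm.
Context {R : realType} {n : nat}.
Implicit Types x y : 'rV[R]_n.

Lemma rV_norm_ltP x (r : R) : 0 < r -> reflect (forall i, `|x 0 i| < r) (`|x| < r).
Proof.
move=> r0; apply: (iffP idP) => [xr i|xr].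
- have : ball_ (fun u : 'rV[R]_n => `|u|) (0 : 'rV[R]_n) r x by rewrite /ball_/= sub0r normrN.
  by rewrite -mx_norm_ball => -[_ /(_ 0 i)]; rewrite /ball/= mxE sub0r normrN.
- suff : ball_ (fun u : 'rV[R]_n => `|u|) (0 : 'rV[R]_n) r x by rewrite /ball_/= sub0r normrN.
  rewrite -mx_norm_ball; split=> // i j.
  by rewrite ord1 /ball/= mxE sub0r normrN.
Qed.

Lemma coord_le_norm x i : `|x 0 i| <= `|x|.
Proof.
rewrite leNgt; apply/negP => xi.
have r0 : 0 < `|x 0 i| by rewrite (le_lt_trans _ xi).
by have /(_ i) := elimT (rV_norm_ltP x r0) xi; rewrite ltxx.
Qed.

Lemma rV_norm_leP x (r : R) : 0 <= r -> reflect (forall i, `|x 0 i| <= r) (`|x| <= r).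
Proof.
move=> r0; apply: (iffP idP) => [xr i|xr].
  exact: (le_trans (coord_le_norm _ _)).
apply/ler_addgt0Pr => e e0; apply/ltW/rV_norm_ltP; first by rewrite ltr_wpDl.
by move=> i; rewrite (le_lt_trans (xr i))// ltrDl.
Qed.

End rV_norm.

Section lebesgue_rV_translation.
Context {R : realType} {n : nat}.

Lemma measurable_rV_shift (b : 'rV[R]_n) : measurable_fun setT (fun x : 'rV[R]_n => x + b).
Proof.
by have := measurable_rV_lin (1%:M : 'M[R]_n) b; under eq_fun do rewrite mulmx1.
Qed.

Lemma lebesgue_rV_shift (b : 'rV[R]_n) B : measurable B ->
  lebesgue_rV n [set x | B (x + b)] = lebesgue_rV n B.
Proof.
move=> mB; rewrite -[RHS](@aff_vol_unitmx _ _ 1%:M _ b)//; last exact: unitmx1.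
by rewrite det1 normr1 mul1e; under [in RHS]eq_set do rewrite mulmx1.
Qed.

Lemma lebesgue_rV_le_norm (r : R) : 0 <= r ->
  lebesgue_rV n [set x | `|x| <= r] = ((2 * r) ^+ n)%:E.
Proof.
move=> r0.
rewrite (_ : [set x | _] = [set x : 'rV[R]_n | forall i, `[- r, r]%classic (x 0 i)]); last first.
  apply/seteqP; split => x /=.
    by move=> /(rV_norm_leP x r0) xr i; rewrite /= in_itv/= -ler_norml.
  by move=> xr; apply/rV_norm_leP => // i; have := xr i; rewrite /= in_itv/= -ler_norml.
rewrite (lebesgue_rV_box (A := fun=> `[- r, r]%classic))//.
rewrite lebesgue_measure_itv/= lte_fin.
have [r1|r1] := ltP (- r) r.
  rewrite opprK -EFinD -mulr2n prodEFin.
  by rewrite prodr_const card_ord mulr_natl.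
have -> : r = 0 by lra.
rewrite mulr0 expr0n; case: (n) => [|k]; first by rewrite big_ord0.
by rewrite big_ord_recl mul0e.
Qed.

Lemma closed_norm_le (r : R) : closed [set x : 'rV[R]_n | `|x| <= r].
Proof.
by apply: (@closed_comp _ _ (fun x : 'rV[R]_n => `|x|) [set y | y <= r]) => [x _|]; [exact: norm_continuous|exact: closed_le].
Qed.

Lemma rV_closed_measurable (K : set 'rV[R]_n) : closed K -> measurable K.
Proof.
by move=> cK; rewrite -(setCK K); apply: measurableC; apply: mx_open_measurable; rewrite openC.
Qed.

Lemma measurable_norm_le (r : R) : measurable [set x : 'rV[R]_n | `|x| <= r].
Proof. by apply: rV_closed_measurable; exact: closed_norm_le. Qed.

End lebesgue_rV_translation.

Lemma measure_bigcup_null d (T : measurableType d) (R : realType)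
    (mu : {measure set T -> \bar R}) (F : nat -> set T) :
  (forall k, measurable (F k)) -> (forall k, mu (F k) = 0%E) -> mu (\bigcup_k F k) = 0%E.
Proof.
move=> mF F0; apply/eqP; rewrite eq_le measure_ge0 andbT.
apply: (le_trans (@measure_sigma_subadditive _ _ _ mu _ F _ _ _)) => //.
  exact: bigcup_measurable.
by rewrite eseries0.
Qed.

Section accumulation.
Context {R : realType} {n : nat}.
Local Notation leb := (@lebesgue_rV R n).
Implicit Types (N E : set 'rV[R]_n) (e : 'rV[R]_n).

(** Infinitely many disjoint translates of N, all of the same measure, fit in one ball. *)
Lemma lebesgue_rV_disjoint_translates N e (M : R) (h : nat -> R) :
  measurable N -> (forall x, N x -> `|x| <= M) -> 0 <= M ->
  (forall k, `|h k| <= 1) ->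
  (forall k l x, k != l -> N (x + h k *: e) -> ~ N (x + h l *: e)) ->
  leb N = 0%E.
Proof.
move=> mN NM M0 h1 disj.
pose F k := [set x | N (x + h k *: e)].
have mF k : measurable (F k).
  by apply: (@measurable_preimage _ _ _ _ (fun x : 'rV[R]_n => x + h k *: e)) => //; exact: measurable_rV_shift.
have tF : trivIset setT F.
  apply/trivIsetP => k l _ _ kl; rewrite -subset0 => x [/= Fk Fl].
  exact: (disj k l x kl).
pose r := M + `|e|.
have r0 : 0 <= r by rewrite addr_ge0.
have Fr k : F k `<=` [set x | `|x| <= r].
  move=> x /= /NM xM; rewrite -(addrK (h k *: e) x) (le_trans (ler_normB _ _))//.
  by rewrite lerD// normrZ ler_piMl.
have key k : (k%:R%:E * leb N <= ((2 * r) ^+ n)%:E)%E.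
  rewrite -lebesgue_rV_le_norm//.
  apply: (@le_trans _ _ (leb (\big[setU/set0]_(i < k) F i))).
    rewrite measure_bigsetU//=.
    rewrite (eq_bigr (fun=> leb N)); last by move=> i _; exact: lebesgue_rV_shift.
    elim: k => [|k IH]; first by rewrite big_ord0 mul0e.
    by rewrite big_ord_recr/= -natr1 EFinD ge0_muleDl ?lee_fin ?ler0n// mul1e leeD2r.
  apply: le_measure; rewrite ?inE.
  - exact: bigsetU_measurable.
  - exact: measurable_norm_le.
  - by rewrite -bigcup_mkord; apply: bigcup_sub => i _; exact: Fr.
apply/eqP; rewrite eq_le measure_ge0 andbT leNgt; apply/negP => N0.
have Nfin : leb N \is a fin_num.
  rewrite ge0_fin_numE// (le_lt_trans _ (ltry ((2 * r) ^+ n)))//.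
  by have := key 1%N; rewrite mul1e.
rewrite -(fineK Nfin) in key N0.
rewrite lte_fin in N0.
have /archi_boundP := (ltW (divr_gt0 (ltr_wpDl (exprn_ge0 n (mulr_ge0 (ler0n R 2) r0)) ltr01) N0)).
set k := Num.bound _ => kP.
have := key k; rewrite -EFinM lee_fin leNgt => /negP; apply.
by rewrite (lt_trans _ (_ : (2 * r) ^+ n + 1 < _)) ?ltrDl// -ltr_pdivrMr.
Qed.

(* The points of E isolated in direction e have pairwise disjoint translates
   along e, so their bounded pieces are null. *)
Lemma ae_directional_accumulation E e : measurable E ->
  exists N, [/\ measurable N, leb N = 0%E &
    forall x, E x -> ~ N x -> forall d : R, 0 < d ->
      exists h : R, [/\ 0 < `|h|, `|h| < d & E (x + h *: e)]].
Proof.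
move=> mE.
pose S m := [set q : rat | 0 < `|ratr q : R| < m.+1%:R^-1].
(* Restricting to rational steps keeps this union countable, hence measurable. *)
pose V m := \bigcup_(q in S m) [set x | E (x + ratr q *: e)].
have mV m : measurable (V m).
  rewrite /V bigcup_mkcond; apply: countable_bigcupT_measurable => // q.
  case: ifP => // _.
  by apply: (@measurable_preimage _ _ _ _ (fun x : 'rV[R]_n => x + ratr q *: e)) => //; exact: measurable_rV_shift.
pose B (k : nat) := [set x : 'rV[R]_n | `|x| <= k%:R].
pose N m := E `\` V m.
have mN m : measurable (N m) by exact: measurableD.
have mNB m k : measurable (N m `&` B k) by apply: measurableI => //; exact: measurable_norm_le.
have NB0 m k : leb (N m `&` B k) = 0%E.
  (* Differences of these steps are nonzero rationals below 1/(m+1), so two translates that meet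
     would put a point of [N m] into [V m]. *)
  pose q i : rat := (m + i).+2%:R^-1.
  have rq i : ratr (q i) = (m + i).+2%:R^-1 :> R by rewrite fmorphV/= ratr_nat.
  apply: (@lebesgue_rV_disjoint_translates _ e k%:R (fun i => ratr (q i))) => //.
  - by move=> x [].
  - move=> i; rewrite rq ger0_norm// invf_le1// ler1n//.
  move=> i j x ij [[Ei nVi] _] [[Ej nVj] _].
  apply: nVi; exists (q j - q i); last by rewrite /= rmorphB/= -addrA -scalerDl [_ + (_ - _)]addrC subrK.
  rewrite /S/= rmorphB/= normr_gt0 subr_eq0 !rq; apply/andP; split.
    by rewrite (inj_eq invr_inj) eqr_nat !eqSS eqn_add2l eq_sym.
  have P (l : nat) : ((0 : R) < (m + l).+2%:R^-1) && ((m + l).+2%:R^-1 < m.+1%:R^-1 :> R).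
    by rewrite invr_gt0 ltr0n/= ltf_pV2 ?posrE ?ltr0n// ltr_nat !ltnS leq_addr.
  move: (P i) (P j); move: (_ + i).+2%:R^-1 (_ + j).+2%:R^-1 (m.+1%:R^-1) => a b c.
  by move=> /andP[? ?] /andP[? ?]; rewrite ltr_norml; apply/andP; split; lra.
exists (\bigcup_m \bigcup_k (N m `&` B k)); split.
- by apply: bigcup_measurable => m _; apply: bigcup_measurable.
- apply: measure_bigcup_null => m; first by apply: bigcup_measurable => k _; exact: mNB.
  by apply: measure_bigcup_null => k; [exact: mNB|exact: NB0].
- move=> x Ex nNx d d0.
  have /archi_boundP := ltW (divr_gt0 ltr01 d0).
  set m := Num.bound _ => mP.
  have Vx : V m x.
    apply: contrapT => nV; apply: nNx; exists m => //.
    exists (Num.bound `|x|) => //; split => //=.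
    by apply/ltW/archi_boundP.
  case: Vx => q /andP[q0 qm] Eq; exists (ratr q); split => //.
  rewrite (lt_trans qm)// invf_plt ?posrE ?ltr0n// -div1r (lt_trans mP)//.
  by rewrite ltr_nat.
Qed.

End accumulation.

Section regularity.
Context {R : realType} {n : nat} (m : {finite_measure set 'rV[R]_n -> \bar R}).
Implicit Types B K : set 'rV[R]_n.

Lemma finite_measure_decr_small (F : nat -> set 'rV[R]_n) (e : R) :
  (forall k, measurable (F k)) -> nonincreasing_seq F -> \bigcap_k F k = set0 ->
  0 < e -> exists k, (m (F k) <= e%:E)%E.
Proof.
move=> mF nF F0 e0.
have Ffin : (m (F 0%N) < +oo)%E by rewrite -ge0_fin_numE// fin_num_measure.
have := @nonincreasing_cvg_mu _ _ _ m F Ffin mF (bigcapT_measurable mF) nF.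
rewrite F0 measure0 => /fine_cvg /cvgr_lt /(_ e e0)[N _ NF]; exists N.
by rewrite -(fineK (fin_num_measure m _ (mF N))) lee_fin ltW//; exact: (NF N (leqnn N)).
Qed.

Let inner B := forall e : R, 0 < e -> exists K, [/\ closed K, K `<=` B & (m (B `\` K) <= e%:E)%E].

(** The complements of shrinking neighbourhoods of ~U are closed and exhaust U. *)
Let inner_open (U : set 'rV[R]_n) : open U -> inner U.
Proof.
move=> oU e e0.
pose V j := \bigcup_(y in ~` U) ball y (j.+1%:R^-1 : R).
have oV j : open (V j) by apply: bigcup_open => y _; exact: ball_open.
have nV : nonincreasing_seq (fun j => U `&` V j).
  move=> i j ij; apply/subsetPset => x [Ux [y Uy xy]]; split => //; exists y => //.
  by apply: le_ball xy; rewrite lef_pV2 ?posrE ?ltr0n// ler_nat.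
have cV : \bigcap_j (U `&` V j) = set0.
  rewrite -subset0 => x xV.
  have [Ux _] := xV 0%N I.
  have /nbhs_ballP[d /= d0 dU] : nbhs x U by exact: open_nbhs_nbhs.
  have /archi_boundP := ltW (divr_gt0 ltr01 d0).
  set j := Num.bound _ => jP.
  have [_ [y Uy xy]] := xV j I; apply: Uy; apply: dU.
  apply: ball_sym; apply: le_ball xy.
  rewrite invf_ple ?posrE ?ltr0n// -div1r (le_trans (ltW jP))//.
  by rewrite ler_nat.
have [j mj] := @finite_measure_decr_small _ e (fun j => measurableI _ _ (mx_open_measurable oU) (mx_open_measurable (oV j))) nV cV e0.
exists (~` V j); split.
- by rewrite closedC.
- by move=> x Vx; apply: contrapT => Ux; apply: Vx; exists x => //; apply: ballxx; rewrite invr_gt0 ltr0n.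
- by rewrite setDE setCK.
Qed.

Let half_gt0 (e : R) k : 0 < e -> 0 < e / (2 ^ k.+1)%:R.
Proof. by move=> e0; rewrite divr_gt0// ltr0n expn_gt0. Qed.

Let inner_bigcup (A : (set 'rV[R]_n)^nat) : (forall k, measurable (A k)) ->
  (forall k, inner (A k)) -> inner (\bigcup_k A k).
Proof.
move=> mA iA e e0.
have e20 : 0 < e / 2 by rewrite divr_gt0.
have /choice[K KP] k := iA k _ (half_gt0 k e20).
have mK k : measurable (K k) by have [? _ _] := KP k; exact: rV_closed_measurable.
pose V N := \big[setU/set0]_(i < N) K i.
have cV N : closed (V N) by apply: closed_bigsetU => i _; have [] := KP i.
have mV N : measurable (V N) by exact: rV_closed_measurable.
have VK N : V N `<=` \bigcup_k K k.
  by rewrite /V -bigcup_mkord => x [i _ Ki]; exists i.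
have mUK : measurable (\bigcup_k K k) by exact: bigcup_measurable.
have [N mN] : exists N, (m ((\bigcup_k K k) `\` V N) <= (e / 2)%:E)%E.
  apply: finite_measure_decr_small => //.
  - by move=> k; exact: measurableD.
  - move=> i j ij; apply/subsetPset => x [Kx nVx]; split => //.
    by apply: contra_not nVx; rewrite /V -!bigcup_mkord => -[k /= ki Kk]; exists k => //=; exact: leq_trans ij.
  - rewrite -subset0 => x xV; have [[k _ Kk] _] := xV 0%N I.
    by have [_] := xV k.+1 I; apply; rewrite /V -bigcup_mkord; exists k => /=.
exists (V N); split => //.
  by apply: (subset_trans (VK N)) => x [k _ Kx]; exists k => //; have [_ + _] := KP k; exact.
have mUA : measurable (\bigcup_k A k) by exact: bigcup_measurable.
have mAK : measurable (\bigcup_k (A k `\` K k)).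
  by apply: bigcup_measurable => k _; exact: measurableD.
apply: (@le_trans _ _ (m ((\bigcup_k K k `\` V N) `|` \bigcup_k (A k `\` K k)))).
  apply: le_measure; rewrite ?inE; [exact: measurableD| |].
    by apply: measurableU => //; exact: measurableD.
  move=> x [[k _ Ax] nV]; have [Kx|nKx] := pselect ((\bigcup_k K k) x); first by left.
  by right; exists k => //; split => // Kk; apply: nKx; exists k.
apply: (le_trans (measureU2 _ _ _)) => //; first exact: measurableD.
rewrite (splitr e) EFinD leeD//.
apply: (le_trans (@measure_sigma_subadditive _ _ _ m _ (fun k => A k `\` K k) _ _ _)) => //.
  by move=> k; exact: measurableD.
apply: le_trans (epsilon_trick0 xpredT (ltW e20)).
by apply: lee_nneseries => // k _; have [] := KP k.
Qed.

Let inner_bigcap (A : (set 'rV[R]_n)^nat) : (forall k, measurable (A k)) ->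
  (forall k, inner (A k)) -> inner (\bigcap_k A k).
Proof.
move=> mA iA e e0.
have /choice[K KP] k := iA k _ (half_gt0 k e0).
have mK k : measurable (K k) by have [? _ _] := KP k; exact: rV_closed_measurable.
exists (\bigcap_k K k); split.
- by apply: closed_bigI => k _; have [] := KP k.
- by move=> x xK k _; have [_ + _] := KP k; apply; exact: xK.
- have mAK k : measurable (A k `\` K k) by exact: measurableD.
  apply: (@le_trans _ _ (m (\bigcup_k (A k `\` K k)))).
    apply: le_measure; rewrite ?inE.
    + by apply: measurableD; exact: bigcapT_measurable.
    + exact: bigcup_measurable.
    + move=> x [xA nK]; apply: contrapT => nU; apply: nK => k _; apply: contrapT => nKx.
      by apply: nU; exists k => //; split => //; exact: xA.
  apply: (le_trans (@measure_sigma_subadditive _ _ _ m _ (fun k => A k `\` K k) _ _ _)) => //.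
    exact: bigcup_measurable.
  apply: le_trans (epsilon_trick0 xpredT (ltW e0)).
  by apply: lee_nneseries => // k _; have [] := KP k.
Qed.

Lemma closed_inner_regular B (e : R) : measurable B -> 0 < e ->
  exists K, [/\ closed K, K `<=` B & (m (B `\` K) <= e%:E)%E].
Proof.
move=> mB e0.
(* Approximation from inside alone is not stable under complement, so it is required of B and of its
   complement together. *)
pose C := [set B : set 'rV[R]_n | [/\ measurable B, inner B & inner (~` B)]].
suff CB : C B by have [_ + _] := CB; exact.
apply: (@smallest_sub _ (sigma_algebra setT) open C) => //; last first.
  move=> U oU; split; [exact: mx_open_measurable|exact: inner_open|].
  by move=> d d0; exists (~` U); split; rewrite ?setDv ?measure0 ?lee_fin ?ltW//; rewrite closedC.
split.
- split => // d d0; first by exists set0; split; rewrite ?setDv ?measure0 ?lee_fin ?ltW//; exact: closed0.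
  by exists (~` set0); split; rewrite ?setDv ?measure0 ?lee_fin ?ltW// setC0; exact: closedT.
- move=> A [mA iA iCA]; rewrite setTD; split => //; first exact: measurableC.
  by rewrite setCK.
- move=> A CA; split.
  + by apply: bigcup_measurable => k _; have [] := CA k.
  + by apply: inner_bigcup => k; have [] := CA k.
  + rewrite setC_bigcup; apply: inner_bigcap => k; last by have [] := CA k.
    by apply: measurableC; have [] := CA k.
Qed.

Lemma compact_inner_regular B (e : R) : measurable B -> 0 < e ->
  exists K, [/\ compact K, K `<=` B & (m (B `\` K) <= e%:E)%E].
Proof.
move=> mB e0; have e20 : 0 < e / 2 by rewrite divr_gt0.
have [K [cK KB mK]] := closed_inner_regular mB e20.
pose V (N : nat) := [set x : 'rV[R]_n | `|x| <= N%:R].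
have cV N : closed (V N) by exact: closed_norm_le.
have [N mN] : exists N, (m (~` V N) <= (e / 2)%:E)%E.
  apply: finite_measure_decr_small => //.
  - by move=> k; apply: measurableC; exact: rV_closed_measurable.
  - move=> i j ij; apply/subsetPset => x; apply: contra_not => xi.
    by rewrite /V/= (le_trans (xi : `|x| <= i%:R))// ler_nat.
  - rewrite -subset0 => x xV; apply: (xV (Num.bound `|x|) I) => /=.
    exact/ltW/archi_boundP.
exists (K `&` V N); split.
- apply: bounded_closed_compact; last exact: closedI.
  by exists N%:R; split; rewrite ?num_real// => M NM x [_ /= xN]; rewrite (le_trans xN)// ltW.
- by move=> x [/KB].
- have mKc : measurable K by exact: rV_closed_measurable.
  have mVN : measurable (V N) by exact: rV_closed_measurable.
  apply: (@le_trans _ _ (m ((B `\` K) `|` ~` V N))).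
    apply: le_measure; rewrite ?inE.
    + by apply: measurableD => //; exact: measurableI.
    + by apply: measurableU; [exact: measurableD|exact: measurableC].
    + by move=> x [Bx nKV]; have [Kx|nKx] := pselect (K x); [right => Vx; exact: nKV|left].
  rewrite (splitr e) EFinD (le_trans (measureU2 _ _ _))//; [exact: measurableD|exact: measurableC|].
  exact: leeD.
Qed.

End regularity.

(** * Domination of measures tested on dyadic cubes *)

Section density.
Context d (T : measurableType d) (R : realType) (m : {measure set T -> \bar R}).
Variables (f : T -> R) (f0 : forall x, 0 <= f x) (mf : measurable_fun setT f).
Local Open Scope ereal_scope.

(** The two proofs are arguments so that the measure structure declared below can be inferred from
    the term. *)
Definition dens of (forall x, 0 <= f x)%R & measurable_fun setT f : set T -> \bar R :=
  fun A => \int[m]_(x in A) (f x)%:E.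
Local Notation nu := (dens f0 mf).

Let dens0 : nu set0 = 0. Proof. by rewrite /dens integral_set0. Qed.

Let dens_ge0 A : 0 <= nu A.
Proof. by apply: integral_ge0 => x _; rewrite lee_fin. Qed.

Let dens_sigma_additive : semi_sigma_additive nu.
Proof.
move=> F mF tF mUF; rewrite /dens ge0_integral_bigcup//; last 2 first.
- by apply/measurable_EFinP; exact: measurable_funTS.
- by move=> x _; rewrite lee_fin.
apply: is_cvg_ereal_nneg_natsum_cond => k _ _.
by apply: integral_ge0 => x _; rewrite lee_fin.
Qed.

HB.instance Definition _ := isMeasure.Build _ _ _ nu
  dens0 dens_ge0 dens_sigma_additive.

Import HBNNSimple.

Lemma ge0_integral_dens (h : T -> \bar R) : measurable_fun setT h ->
  (forall x, 0 <= h x) -> \int[nu]_x h x = \int[m]_x (h x * (f x)%:E).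
Proof.
move=> mh h0; pose h_ := nnsfun_approx measurableT mh.
have ndh x a b : (a <= b)%N -> (h_ a x <= h_ b x)%R.
  by move=> ab; exact/lefP/nd_nnsfun_approx.
transitivity (lim (\int[nu]_x (EFin \o h_ n) x @[n --> \oo])).
  rewrite -monotone_convergence//.
  - by apply: eq_integral => x _; apply/esym/cvg_lim => //; exact: cvg_nnsfun_approx.
  - by move=> n; exact/measurable_EFinP.
  - by move=> n x _; rewrite lee_fin.
  - by move=> x _ a b ab; rewrite lee_fin ndh.
transitivity (lim (\int[m]_x ((EFin \o h_ n) x * (f x)%:E) @[n --> \oo])); last first.
  rewrite -monotone_convergence//.
  - apply: eq_integral => x _; apply/cvg_lim => //.
    by apply: cvgeZr => //; exact: cvg_nnsfun_approx.
  - by move=> n; apply: emeasurable_funM; exact/measurable_EFinP.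
  - by move=> n x _; rewrite mule_ge0 ?lee_fin.
  - by move=> x _ a b ab; rewrite lee_wpmul2r ?lee_fin ?ndh.
congr (lim _); congr (_ @ \oo); apply/funext => n.
have key r A : (0 <= r)%R -> measurable A ->
    \int[nu]_x (r * \1_A x)%:E = \int[m]_x ((r * \1_A x)%:E * (f x)%:E).
  move=> r0 mA; under [LHS]eq_integral do rewrite EFinM.
  rewrite [LHS]ge0_integralZl//; try by apply/measurable_EFinP.
  rewrite integral_indic// setIT /dens.
  have mfA : measurable_fun A (EFin \o f) by apply/measurable_EFinP; exact: measurable_funTS.
  transitivity (\int[m]_(x in A) (r%:E * (f x)%:E)).
    by rewrite ge0_integralZl// => x _; rewrite lee_fin.
  rewrite [LHS]integral_mkcond.
  apply: eq_integral => x _; rewrite EFinM -muleA patchE indicE.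
  by case: ifPn => _; rewrite ?mul1e ?mul0e ?mule0.
transitivity (\int[nu]_x (\sum_(y \in range (h_ n)) (y * \1_(h_ n @^-1` [set y]) x)%:E)).
  by apply: eq_integral => t tE; rewrite /= fimfunE -fsumEFin.
have indich r : measurable_fun setT (fun x => (r * \1_(h_ n @^-1` [set r]) x)%:E).
  by apply/measurable_EFinP; exact: measurable_funM.
rewrite ge0_integral_fsum//; last by move=> y x _; exact: nnfun_muleindic_ge0.
transitivity (\int[m]_x (\sum_(y \in range (h_ n))
    (y * \1_(h_ n @^-1` [set y]) x)%:E * (f x)%:E)); last first.
  apply: eq_integral => x _; rewrite -ge0_mule_fsuml; last first.
    by move=> y; exact: nnfun_muleindic_ge0.
  by rewrite fsumEFin// -(fimfunE _ x).
rewrite ge0_integral_fsum//; last 2 first.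
- by move=> y; apply: emeasurable_funM => //; exact/measurable_EFinP.
- by move=> y x _; rewrite mule_ge0 ?lee_fin// -lee_fin nnfun_muleindic_ge0.
apply: eq_fsbigr => r /[!inE] -[x _ <-]; exact: key.
Qed.

End density.

Section domination.
Context d (T : measurableType d) (R : realType).
Variables (nu la : {measure set T -> \bar R}) (c : R).
Hypothesis c0 : 0 <= c.
Local Open Scope ereal_scope.

Definition dominated_on (E : set T) : Prop :=
  forall B, measurable B -> B `<=` E -> nu B <= c%:E * la B.

Lemma dominated_trivIset (F : (set T)^nat) : (forall k, measurable (F k)) ->
  trivIset setT F -> (forall k, nu (F k) <= c%:E * la (F k)) ->
  nu (\bigcup_k F k) <= c%:E * la (\bigcup_k F k).
Proof.
move=> mF tF nF; rewrite !measure_bigcup//.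
by rewrite -nneseriesZl//; apply: lee_nneseries.
Qed.

Lemma dominated_on_bigcup (E : (set T)^nat) : (forall k, measurable (E k)) ->
  (forall k, dominated_on (E k)) -> dominated_on (\bigcup_k E k).
Proof.
move=> mE dE B mB BE.
have -> : B = \bigcup_k (B `&` seqDU E k).
  by rewrite -setI_bigcupr -seqDU_bigcup_eq; apply/seteqP; split => [x Bx|x []//]; split => //; exact: BE.
have mI k : measurable (B `&` seqDU E k).
  by apply: measurableI => //; apply: measurableD => //; exact: bigsetU_measurable.
apply: dominated_trivIset => //.
- by apply: trivIset_setIl; exact: trivIset_seqDU.
- by move=> k; apply: (dE k _ (mI k)) => x [_] [].
Qed.

End domination.

Section dyadic_cubes.
Context {R : realType} {n : nat}.
Local Notation leb := (@lebesgue_rV R n).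

Definition dcube (k : nat) (z : 'rV[int]_n) : set 'rV[R]_n :=
  [set x | forall i, (z 0 i)%:~R <= x 0 i * 2 ^+ k < (z 0 i + 1)%:~R].

Definition dindex (k : nat) (x : 'rV[R]_n) : 'rV[int]_n :=
  \row_i Num.floor (x 0 i * 2 ^+ k).

Lemma dcube_dindex k x : dcube k (dindex k x) x.
Proof. by move=> i; rewrite mxE; exact: floor_itv. Qed.

Lemma dcubeP k z x : dcube k z x -> z = dindex k x.
Proof.
by move=> zx; apply/rowP => i; rewrite mxE; apply/esym/eqP; rewrite floor_eq//; exact: zx.
Qed.

Let p2_gt0 k : 0 < 2 ^+ k :> R. Proof. exact: exprn_gt0. Qed.

Lemma dcube_box k z : dcube k z =
  [set x | forall i, `[(z 0 i)%:~R / 2 ^+ k, (z 0 i + 1)%:~R / 2 ^+ k[%classic (x 0 i)].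
Proof.
apply/seteqP; split => x xz i; have := xz i; rewrite /= in_itv/=.
- by rewrite ler_pdivrMr// ltr_pdivlMr.
- by rewrite ler_pdivrMr// ltr_pdivlMr.
Qed.

Lemma measurable_rV_box (A : 'I_n -> set R) : (forall i, measurable (A i)) ->
  measurable [set x : 'rV[R]_n | forall i, A i (x 0 i)].
Proof.
move=> mA; rewrite (_ : mkset _ = \bigcap_(i in [set: 'I_n])
   ((fun x : 'rV[R]_n => x 0 i) @^-1` A i)).
  apply: fin_bigcap_measurable => // j _; rewrite -[X in measurable X]setTI.
  by apply: mx_continuous_measurable => //; exact: coord_continuous.
by apply/seteqP; split => x /= xA i; [move=> _|]; exact: xA.
Qed.

Lemma measurable_dcube k z : measurable (dcube k z).
Proof.
by rewrite dcube_box; apply: (@measurable_rV_box (fun i => `[(z 0 i)%:~R / 2 ^+ k, (z 0 i + 1)%:~R / 2 ^+ k[%classic)).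
Qed.

Lemma lebesgue_dcube k z : leb (dcube k z) = (((2 ^+ k)^-1) ^+ n)%:E.
Proof.
rewrite dcube_box (lebesgue_rV_box (A := fun i => `[(z 0 i)%:~R / 2 ^+ k, (z 0 i + 1)%:~R / 2 ^+ k[%classic))//.
rewrite (eq_bigr (fun=> ((2 ^+ k)^-1)%:E)).
  by rewrite prodEFin prodr_const card_ord.
move=> i _; rewrite lebesgue_measure_itv/= lte_fin ltr_pM2r ?invr_gt0// ltr_int ltrDl ltr01.
by rewrite -EFinB -mulrBl -intrB addrAC subrr add0r mul1r.
Qed.

Lemma dcube_dist k z x y : dcube k z x -> dcube k z y -> `|x - y| <= (2 ^+ k)^-1.
Proof.
move=> xz yz; apply/rV_norm_leP; first by rewrite invr_ge0 ltW.
move=> i; have /andP[x1 x2] := xz i; have /andP[y1 y2] := yz i.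
rewrite !mxE -(ler_pM2r (p2_gt0 k)) mulVf ?gt_eqF// -[X in _ * X]gtr0_norm// -normrM mulrBl.
move: x1 x2 y1 y2; rewrite intrD; move: (x 0 i * _) (y 0 i * _) => a b x1 x2 y1 y2.
by rewrite ler_norml; apply/andP; split; lra.
Qed.

(** Countable additivity is stated for sequences, hence the enumeration through [pickle_inv], with
    empty sets as filler. *)
Definition dfamily (k : nat) (Z : set 'rV[int]_n) (j : nat) : set 'rV[R]_n :=
  if pickle_inv j is Some z then if `[< Z z >] then dcube k z else set0 else set0.

Lemma dfamily_bigcup k Z : \bigcup_j dfamily k Z j = [set x | Z (dindex k x)].
Proof.
apply/seteqP; split => x.
- move=> [j _]; rewrite /dfamily; case: pickle_inv => // z; case: asboolP => // Zz /dcubeP xz.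
  by rewrite /= -xz.
- move=> /= Zx; exists (pickle (dindex k x)) => //; rewrite /dfamily pickleK_inv.
  by case: asboolP => // _; exact: dcube_dindex.
Qed.

Lemma dfamily_trivIset k Z : trivIset setT (dfamily k Z).
Proof.
apply/trivIsetP => i j _ _ /eqP ij; rewrite -subset0 => x [].
rewrite /dfamily.
have := @pickle_invK 'rV[int]_n i; case: (pickle_inv i) => [z /= zi|//].
case: asboolP => // _ /dcubeP zx.
have := @pickle_invK 'rV[int]_n j; case: (pickle_inv j) => [z' /= zj|//].
case: asboolP => // _ /dcubeP zx'.
by apply: ij; rewrite -zi -zj zx zx'.
Qed.

Lemma measurable_dfamily k Z j : measurable (dfamily k Z j).
Proof.
rewrite /dfamily; case: pickle_inv => // z; case: asboolP => // _; exact: measurable_dcube.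
Qed.

Variables (nu : {measure set 'rV[R]_n -> \bar R}) (c : R) (k0 : nat) (E : set 'rV[R]_n).
Hypothesis c0 : 0 <= c.
Hypothesis mE : measurable E.
Hypothesis nu_cube : forall k z, (k0 <= k)%N -> (exists x, dcube k z x /\ E x) ->
  (nu (dcube k z) <= c%:E * leb (dcube k z))%E.

(** The cubes of generation k that meet K are disjoint, cover K and lie in the neighbourhood [U k],
    and these neighbourhoods decrease to K. *)
Let compact_dominated K : compact K -> K `<=` E -> (nu K <= c%:E * leb K)%E.
Proof.
move=> cK KE.
have clK : closed K by exact: compact_closed.
pose Z k : set 'rV[int]_n := [set z | exists x, dcube k z x /\ K x].
pose W k := \bigcup_j dfamily k (Z k) j.
(* The factor 2 makes the bound 2^-k <= 1/(k+1) on distances inside a cube strict. *)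
pose U k := \bigcup_(y in K) ball y (2 * (k.+1%:R)^-1 : R).
have oU k : open (U k) by apply: bigcup_open => y _; exact: ball_open.
have mU k : measurable (U k) by exact: mx_open_measurable.
have WU k : W k `<=` U k.
  rewrite /W dfamily_bigcup => x /= [y [yx Ky]]; exists y => //.
  rewrite mx_norm_ball /ball_/= (le_lt_trans (dcube_dist yx (dcube_dindex k x)))//.
  apply: (@le_lt_trans _ _ (k.+1%:R^-1)).
    by rewrite lef_pV2 ?posrE ?ltr0n// -natrX ler_nat ltn_expl.
  by rewrite ltr_pMl ?invr_gt0 ?ltr0n// ltr1n.
have KW k : K `<=` W k.
  by move=> x Kx; rewrite /W dfamily_bigcup; exists x; split => //; exact: dcube_dindex.
have mK : measurable K by exact: rV_closed_measurable.
have nuKU k : (k0 <= k)%N -> (nu K <= c%:E * leb (U k))%E.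
  move=> kk; apply: (@le_trans _ _ (nu (W k))).
    by apply: le_measure; rewrite ?inE//; apply: bigcup_measurable => j _; exact: measurable_dfamily.
  apply: (@le_trans _ _ (c%:E * leb (W k))%E).
    apply: dominated_trivIset => //.
    - by move=> j; exact: measurable_dfamily.
    - exact: dfamily_trivIset.
    - move=> j; rewrite /dfamily; case: pickle_inv => [z|]; last by rewrite !measure0 mule0.
      case: asboolP => [[x [xz Kx]]|_]; last by rewrite !measure0 mule0.
      by apply: nu_cube => //; exists x; split => //; exact: KE.
  apply: lee_wpmul2l; first by rewrite lee_fin.
  by apply: le_measure; rewrite ?inE//; apply: bigcup_measurable => j _; exact: measurable_dfamily.
have nU : nonincreasing_seq U.
  move=> i j ij; apply/subsetPset => x [y Ky xy]; exists y => //.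
  by apply: le_ball xy; rewrite ler_pM2l// lef_pV2 ?posrE ?ltr0n// ler_nat.
have [M M0 KM] : exists2 M : R, 0 <= M & forall x, K x -> `|x| <= M.
  have /compact_bounded[M [_ MK]] := cK.
  exists (`|M| + 1) => // x Kx; apply: MK => //.
  by rewrite (le_lt_trans (ler_norm _))// ltrDl.
have U0fin : (leb (U 0%N) < +oo)%E.
  apply: (@le_lt_trans _ _ (leb [set x | `|x| <= M + 2])).
    apply: le_measure; rewrite ?inE//; first exact: measurable_norm_le.
    move=> x [y Ky]; rewrite invr1 mulr1 mx_norm_ball /ball_/= => xy.
    rewrite -(subrK y x) (le_trans (ler_normD _ _))// addrC lerD ?KM// distrC.
    exact: ltW.
  by rewrite lebesgue_rV_le_norm ?ltry// addr_ge0.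
have UK : \bigcap_k U k = K.
  apply/seteqP; split => [x xU|x Kx k _]; last first.
    by exists x => //; apply: ballxx; rewrite mulr_gt0// invr_gt0 ltr0n.
  rewrite ((closure_id K).1 clK) => B /nbhs_ballP[d /= d0 dB].
  have /archi_boundP := ltW (divr_gt0 (ltr0n R 2) d0).
  set k := Num.bound _ => kP.
  have [y Ky xy] := xU k I; exists y; split => //; apply: dB; apply: ball_sym.
  apply: le_ball xy; rewrite ler_pdivrMr ?ltr0n// mulrC -ler_pdivrMr//.
  by rewrite (le_trans (ltW kP))// ler_nat.
have mUK : measurable (\bigcap_k U k) by rewrite UK.
have := @nonincreasing_cvg_mu _ _ _ leb U U0fin mU mUK nU.
rewrite UK => lU.
have : (c%:E * leb (U k) @[k --> \oo] --> c%:E * leb K)%E by exact: cvgeZl.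
move=> /(cvge_to_ge); apply.
by exists k0 => // k /= kk; exact: nuKU.
Qed.

(** Inside one cube nu is finite, so B can be approximated from inside by compact sets. *)
Let cube_dominated z : dominated_on nu leb c (E `&` dcube k0 z).
Proof.
move=> B mB BE.
(* The empty set is treated apart because the bound on the cube is available only if the cube meets
   E. *)
have [B0|/set0P[x Bx]] := eqVneq B set0.
  by rewrite B0 !measure0 mule0.
have [Ex zx] := BE _ Bx.
have Qfin : (nu (dcube k0 z) < +oo)%E.
  apply: (@le_lt_trans _ _ (c%:E * leb (dcube k0 z))%E); first by apply: nu_cube => //; exists x.
  by rewrite lebesgue_dcube -EFinM ltry.
pose m := mfrestr (measurable_dcube k0 z) Qfin.
apply/lee_addgt0Pr => e e0.
have [K [cK KB mK]] := @compact_inner_regular _ _ m B e mB e0.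
have mKc : measurable K by apply: rV_closed_measurable; exact: compact_closed.
have -> : B = K `|` (B `\` K) by apply/seteqP; split => y; [have [Ky|nKy] := pselect (K y); [left|right]|case => [/KB//|[]//]].
apply: (le_trans (measureU2 _ _ _)) => //; first exact: measurableD.
apply: leeD.
  apply: (le_trans (compact_dominated cK _)).
    by move=> y /KB /BE[].
  apply: lee_wpmul2l; rewrite ?lee_fin//; apply: le_measure; rewrite ?inE//.
  by apply: measurableU => //; exact: measurableD.
apply: (@le_trans _ _ (nu ((B `\` K) `&` dcube k0 z))); last exact: mK.
have mBK : measurable (B `\` K) by exact: measurableD.
apply: le_measure; rewrite ?inE//.
  by apply: measurableI => //; exact: measurable_dcube.
by move=> y [By nKy]; split => //; have [] := BE _ By.
Qed.

Lemma cubes_dominated : dominated_on nu leb c E.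
Proof.
have -> : E = \bigcup_j (E `&` dfamily k0 setT j).
  rewrite -setI_bigcupr dfamily_bigcup; apply/seteqP; split => [x Ex|x []//]; split => //.
apply: dominated_on_bigcup => // j.
  by apply: measurableI => //; exact: measurable_dfamily.
rewrite /dfamily; case: pickle_inv => [z|].
  by rewrite asboolT//; exact: cube_dominated.
by move=> B mB; rewrite setI0 subset0 => ->; rewrite !measure0 mule0.
Qed.

End dyadic_cubes.

(** * Smooth functions *)

Section directional.
Context {R : realType} {V : normedModType R}.
Implicit Types (f g : V -> R^o) (x v : V).

Lemma is_derive_line f x v (s : R) : derivable f (x + s *: v) v ->
  is_derive (s : R^o) 1 (fun t : R^o => f (x + t *: v) : R^o) ('D_v f (x + s *: v)).
Proof.
move=> df.
have E : (fun h : R => h^-1 *: (((fun t : R => f (x + t *: v)) \o shift s) (h *: (1 : R^o)) - f (x + s *: v)))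
       = (fun h : R => h^-1 *: ((f \o shift (x + s *: v)) (h *: v) - f (x + s *: v))).
  apply/funext => h /=; congr (_ *: (f _ - _)).
  by rewrite [h *: 1]mulr1 scalerDl addrCA.
by apply: DeriveDef; [rewrite /derivable E|rewrite /derive E].
Qed.

Lemma MVT_line f x v (a : R) : (forall s, derivable f (x + s *: v) v) ->
  exists2 s, `|s| <= `|a| & f (x + a *: v) - f x = a * 'D_v f (x + s *: v).
Proof.
move=> df.
pose h (t : R) : R := f (x + t *: v).
have dh (t : R) : is_derive (t : R) 1 (h : R -> R) ('D_v f (x + t *: v)) by exact: is_derive_line.
have ch : continuous (h : R -> R).
  move=> t; apply: differentiable_continuous; apply/derivable1_diffP; exact: ex_derive.
have h0 : h 0 = f x by rewrite /h scale0r addr0.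
have [a0|a0] := leP 0 a.
  have [s /andP[s0 sa] hs] := @MVT_segment R h (fun t => 'D_v f (x + t *: v)) 0 a a0 (fun t _ => dh t) (continuous_subspaceT ch).
  exists s; first by rewrite !ger0_norm.
  by rewrite -h0 -/(h a) hs subr0 mulrC.
have [s /andP[/= s0 sa] hs] := @MVT_segment R h (fun t => 'D_v f (x + t *: v)) a 0 (ltW a0) (fun t _ => dh t) (continuous_subspaceT ch).
rewrite !bnd_simp in s0 sa.
exists s; first by rewrite !ler0_norm ?lerN2// ltW.
by rewrite -h0 -/(h a) -opprB hs sub0r mulrN opprK mulrC.
Qed.

Lemma Ck_onS (U : set V) k f : Ck_on U k.+1 f -> Ck_on U k f.
Proof.
elim: k f => [|k IH] f; first by case.
move=> [cf df]; split => // v; have [d1 d2] := df v; split => //; exact: IH.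
Qed.

Lemma Ck_on_continuous k f : Ck_on setT k f -> continuous f.
Proof. by case: k => [|k] => [cf x|[cf _] x]; apply: cf; rewrite inE. Qed.

Lemma Ck_on_derivable k f x v : Ck_on setT k.+1 f -> derivable f x v.
Proof. by move=> [_ /(_ v)[+ _]]; exact. Qed.

Lemma Ck_on_derive k f v : Ck_on setT k.+1 f -> Ck_on setT k ('D_v f).
Proof. by move=> [_ /(_ v)[_]]. Qed.

Lemma Ck_on_cst k (c : R) : Ck_on setT k (cst c : V -> R^o).
Proof.
elim: k c => [|k IH] c /=; first by move=> x _; exact: cst_continuous.
split; first by move=> x _; exact: cst_continuous.
move=> v; split => //.
rewrite (_ : 'D_v _ = cst 0); first exact: IH.
by apply/funext => x; rewrite derive_cst.
Qed.

Lemma Ck_onD k f g : Ck_on setT k f -> Ck_on setT k g -> Ck_on setT k (f + g).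
Proof.
elim: k f g => [|k IH] f g.
  by move=> cf cg x xU; apply: continuousD; [exact: cf|exact: cg].
move=> [cf df] [cg dg]; split; first by move=> x xU; apply: continuousD; [exact: cf|exact: cg].
move=> v; have [df1 df2] := df v; have [dg1 dg2] := dg v; split.
  by move=> x _; apply: derivableD; [exact: df1|exact: dg1].
rewrite (_ : 'D_v _ = 'D_v f + 'D_v g); first exact: IH.
by apply/funext => x; rewrite deriveD//; [exact: df1|exact: dg1].
Qed.

Lemma Ck_onM k f g : Ck_on setT k f -> Ck_on setT k g -> Ck_on setT k (f * g).
Proof.
elim: k f g => [|k IH] f g.
  by move=> cf cg x xU; apply: continuousM; [exact: cf|exact: cg].
move=> Cf Cg; have [cf df] := Cf; have [cg dg] := Cg.
split; first by move=> x xU; apply: continuousM; [exact: cf|exact: cg].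
move=> v; have [df1 df2] := df v; have [dg1 dg2] := dg v; split.
  by move=> x _; apply: derivableM; [exact: df1|exact: dg1].
rewrite (_ : 'D_v _ = f * 'D_v g + g * 'D_v f).
  by apply: Ck_onD; apply: IH => //; exact: Ck_onS.
by apply/funext => x; rewrite deriveM//; [exact: df1|exact: dg1].
Qed.

Lemma Ck_on_sum k I (r : seq I) (F : I -> V -> R^o) :
  (forall i, Ck_on setT k (F i)) -> Ck_on setT k (fun x => \sum_(i <- r) F i x).
Proof.
move=> CF; elim: r => [|i r IH].
  by under eq_fun do rewrite big_nil; exact: Ck_on_cst.
by under eq_fun do rewrite big_cons; exact: (Ck_onD (CF i) IH).
Qed.

Lemma Ck_onZ k (c : R) f : Ck_on setT k f -> Ck_on setT k (fun x => c * f x).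
Proof. by move=> Cf; apply: (Ck_onM (Ck_on_cst k c) Cf). Qed.

(** Only a directional derivative of f is assumed, so the chain rule is applied to f restricted to
    the line through x. *)
Lemma is_derive_comp_dir (phi : R -> R^o) f x v : derivable phi (f x) 1 ->
  derivable f x v -> is_derive x v (fun y => phi (f y) : R^o) ('D_1 phi (f x) * 'D_v f x).
Proof.
move=> dphi df.
pose h (t : R) : R^o := f (x + t *: v).
have E (g : V -> R^o) : (fun k : R => k^-1 *: (((fun t : R => g (x + t *: v)) \o shift 0) (k *: (1 : R)) - g (x + 0 *: v)))
   = (fun k : R => k^-1 *: ((g \o shift x) (k *: v) - g x)).
  by apply/funext => k /=; rewrite scale0r !addr0 [k *: 1]mulr1 (addrC x).
have dh : derivable h 0 1 by rewrite /derivable E.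
have hE : 'D_1 h 0 = 'D_v f x by rewrite /derive E.
have h0 : h 0 = f x by rewrite /h scale0r addr0.
have dfh : differentiable h 0 by exact/derivable1_diffP.
have dphi0 : derivable phi (h 0) 1 by rewrite h0.
have dfp : differentiable phi (h 0) := (derivable1_diffP _ _).1 dphi0.
have dc : differentiable (phi \o h) 0 by exact: differentiable_comp.
have dcE : 'D_1 (phi \o h) 0 = 'D_1 phi (f x) * 'D_v f x.
  rewrite deriveE// diff_comp//= -hE (deriveE _ dfh) -h0 (deriveE _ dfp).
  rewrite [in RHS]mulrC -[RHS]/('d h 0 1 *: 'd phi (h 0) 1) -linearZ; congr ('d phi _ _); exact/esym/mulr1.
have dc1 : derivable (phi \o h) 0 1 by exact/derivable1_diffP.
have Ec := E (fun y => phi (f y)).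
by apply: DeriveDef; [move: dc1; rewrite /derivable Ec|rewrite -dcE /derive -Ec].
Qed.

Lemma Ck_on_comp k (phi : R -> R^o) f : Ck_on setT k phi -> Ck_on setT k f ->
  Ck_on setT k (fun x => phi (f x) : R^o).
Proof.
elim: k phi f => [|k IH] phi f.
  move=> cp cf x xU; apply: (@continuous_comp _ _ _ f phi); first exact: cf.
  by apply: cp; rewrite inE.
move=> Cp Cf; have [cf df] := Cf; have [cp dp] := Cp.
split; first by move=> x xU; apply: (@continuous_comp _ _ _ f phi); [exact: cf|apply: cp; rewrite inE].
move=> v; have [df1 df2] := df v; have [dp1 dp2] := dp 1.
have dc x := is_derive_comp_dir (dp1 (f x) I) (df1 x I).
split; first by move=> x _; exact: ex_derive.
rewrite (_ : 'D_v _ = (fun y => 'D_1 phi (f y)) * 'D_v f).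
  exact: (Ck_onM (IH _ _ dp2 (Ck_onS Cf)) df2).
by apply/funext => x; have [_ ->] := dc x.
Qed.

(** The difference quotient of f(-y) with step h is minus that of f with step -h. *)
Lemma derive_opp_arg f x v : derivable f (- x) v ->
  is_derive x v (fun y => f (- y)) (- 'D_v f (- x)).
Proof.
move=> df.
have E : (fun h : R => h^-1 *: (((fun y => f (- y)) \o shift x) (h *: v) - f (- x))) =
  (fun h : R => - ((- h)^-1 *: ((f \o shift (- x)) ((- h) *: v) - f (- x)))).
  by apply/funext => h /=; rewrite invrN scaleNr opprK opprD scaleNr.
have cN : (fun h : R => - h) @ 0^' --> (0^' : set_system R).
  move=> A; rewrite /dnbhs /= => -[d /= d0 dA]; exists d => // h /= hd h0.
  by apply: dA; rewrite ?oppr_eq0//= ; move: hd; rewrite !sub0r !normrN.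
have c1 : (fun h : R => - ((- h)^-1 *: ((f \o shift (- x)) ((- h) *: v) - f (- x)))) @ 0^' --> - 'D_v f (- x).
  apply: cvgN.
  apply: (cvg_comp _ _ cN df).
apply: DeriveDef; first by rewrite /derivable E; apply/cvg_ex; exists (- 'D_v f (- x)).
by rewrite /derive E; apply/cvg_lim.
Qed.

Lemma Ck_on_opp_arg k f : Ck_on setT k f -> Ck_on setT k (fun x => f (- x)).
Proof.
elim: k f => [|k IH] f.
  move=> cf x xU; apply: (@continuous_comp _ _ _ (fun x => - x) f); first exact: opp_continuous.
  by apply: cf; rewrite inE.
move=> [cf df]; split.
  move=> x xU; apply: (@continuous_comp _ _ _ (fun x => - x) f); first exact: opp_continuous.
  by apply: cf; rewrite inE.
move=> v; have [df1 df2] := df v; split.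
  by move=> x _; case: (derive_opp_arg (df1 (- x) I)).
rewrite (_ : 'D_v _ = (fun x => (-1) * 'D_v f (- x))); first exact: (Ck_onZ (-1) (IH _ df2)).
by apply/funext => x; have [_ ->] := derive_opp_arg (df1 (- x) I); rewrite mulN1r.
Qed.

End directional.

Lemma dist_le_half (R : realFieldType) (a b c e : R) :
  `|a - c| <= e / 2 -> `|b - c| <= e / 2 -> `|a - b| <= e.
Proof.
move=> ac bc; rewrite (splitr e) -(subrKA c) (le_trans (ler_normD _ _))// lerD//.
by rewrite distrC.
Qed.

(** * Differentiability from continuous partial derivatives, and derivatives along accumulating
    points *)

Section C1_functions.
Context {R : realType} {n : nat}.
Implicit Types (f : 'rV[R]_n -> R^o) (x v h : 'rV[R]_n).
Local Notation "''e' i" := (delta_mx 0 i : 'rV[R]_n) (at level 8, i at level 2).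
Local Notation "''d_' i f" := ('D_(delta_mx 0 i) f) (at level 10, i at level 2, f at level 9).

Definition lin_row (c : 'I_n -> R) : 'rV[R]_n -> R^o := fun h => \sum_i h 0 i * c i.

Lemma lin_row_is_linear c : linear (lin_row c).
Proof.
move=> a u v; rewrite /lin_row scaler_sumr -big_split; apply: eq_bigr => i _.
by rewrite !mxE mulrDl -mulrA.
Qed.

HB.instance Definition _ c := GRing.isLinear.Build R 'rV[R]_n R^o _ (lin_row c) (lin_row_is_linear c).

Lemma continuous_lin_row c : continuous (lin_row c).
Proof.
have := @Ck_on_sum R 'rV[R]_n 0 _ (index_enum 'I_n) (fun i h => h 0 i * c i).
move=> /(_ _) cs x; apply: cs; last by rewrite inE.
move=> i y _; apply: (@continuousM _ _ (fun h : 'rV[R]_n => h 0 i) (cst (c i))); first exact: coord_continuous.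
exact: cst_continuous.
Qed.

Lemma C1_expand f x (e : R) : Ck_on setT 1 f -> 0 < e ->
  exists2 d : R, 0 < d & forall h, `|h| < d ->
    `|f (x + h) - f x - lin_row (fun i => 'd_i f x) h| <= e * `|h|.
Proof.
move=> Cf e0.
have cd i : continuous ('d_i f) by exact/(@Ck_on_continuous _ _ 0)/Ck_on_derive.
(* Dividing by n+1 rather than n keeps the constant positive when n = 0. *)
have e1 : 0 < e / n.+1%:R by rewrite divr_gt0.
have near_i (i : 'I_n) : \forall y \near x, `|'d_i f x - 'd_i f y| <= e / n.+1%:R.
  by have /cvgrPdist_le/(_ _ e1) := cd i x; exact.
have near_d : nbhs x [set y | forall i : 'I_n, `|'d_i f x - 'd_i f y| <= e / n.+1%:R] := @filter_forall _ _ _ (nbhs x) (nbhs_filter x) near_i.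
have /nbhs_ballP[d /= d0 dP] := near_d.
exists d => // h hd.
(* Corners of a path from x to x + h that moves one coordinate at a time; the mean value theorem
   applies on each edge. *)
pose p (k : nat) : 'rV[R]_n := \row_j (x 0 j + (if (j < k)%N then h 0 j else 0)).
have p0 : p 0%N = x by apply/rowP => j; rewrite !mxE addr0.
have pn : p n = x + h by apply/rowP => j; rewrite !mxE ltn_ord.
have pS (k : 'I_n) : p k.+1 = p k + h 0 k *: 'e k.
  apply/rowP => j; rewrite !mxE eqxx/= ltnS leq_eqVlt -addrA; congr (_ + _).
  have [->|jk] := eqVneq j k; first by rewrite eqxx ltnn mulr1 add0r.
  by rewrite (_ : (j == k :> nat) = false) ?mulr0 ?addr0//; apply/negbTE.
have -> : f (x + h) - f x = \sum_(k < n) (f (p k.+1) - f (p k)).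
  rewrite -(big_mkord xpredT (fun k => f (p k.+1) - f (p k))).
  by rewrite (telescope_sumr (fun k => f (p k)))// pn p0.
have fS (k : 'I_n) : `|f (p k.+1) - f (p k) - h 0 k * 'd_k f x| <= e / n.+1%:R * `|h|.
  rewrite pS; have [s sh ->] := MVT_line (f := f) (x := p k) (v := 'e k) (h 0 k) (fun s => Ck_on_derivable Cf).
  rewrite -mulrBr normrM mulrC ler_pM//; last exact: coord_le_norm.
  rewrite distrC; apply: dP; rewrite mx_norm_ball /ball_/= (le_lt_trans _ hd)//.
  apply/rV_norm_leP => // j; rewrite !mxE eqxx/=.
  have [->|jk] := eqVneq j k.
    rewrite ltnn mulr1 addr0 opprD addrA subrr add0r normrN.
    by rewrite (le_trans sh)// coord_le_norm.
  rewrite mulr0 addr0 opprD addrA subrr add0r normrN.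
  by case: ifP => _; [exact: coord_le_norm|rewrite normr0].
rewrite /lin_row -sumrB (le_trans (ler_norm_sum _ _ _))//.
apply: (@le_trans _ _ (\sum_(i < n) e / n.+1%:R * `|h|)); first by apply: ler_sum => i _; exact: fS.
rewrite sumr_const card_ord -[_ *+ n]mulr_natl mulrA ler_wpM2r// mulrCA ler_piMr//; first exact: ltW.
by rewrite ler_pdivrMr ?ltr0n// mul1r ler_nat.
Qed.

Lemma C1_differentiable f x : Ck_on setT 1 f -> differentiable f x /\
  'd f x = lin_row (fun i => 'd_i f x) :> (_ -> _).
Proof.
move=> Cf.
have lo : f \o shift x = cst (f x) + (lin_row (fun i => 'd_i f x) : _ -> _) +o_ (0 : 'rV[R]_n) id.
  apply/eqaddoP => e e0; have [d d0 dP] := C1_expand x Cf e0.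
  apply/nbhs_ballP; exists d => //= h; rewrite mx_norm_ball /ball_/= sub0r normrN => hd.
  by have := dP h hd; rewrite !fctE/= opprD addrA (addrC h).
have dE := diff_unique (@continuous_lin_row _) lo.
split => //; apply/diff_locallyP; rewrite dE; split => //.
exact: continuous_lin_row.
Qed.

Lemma C1_chain f (G : R -> 'rV[R]_n) (g : 'I_n -> R) (t : R) : Ck_on setT 1 f ->
  (forall i, is_derive t 1 (fun s => G s 0 i : R) (g i)) ->
  is_derive t 1 (fun s => f (G s) : R) (\sum_i g i * 'd_i f (G t)).
Proof.
move=> /(C1_differentiable (G t))[df dE] dG.
have derG : derivable (G : R^o -> _) t 1.
  by apply/derivable_mxP => i j; rewrite ord1; exact: ex_derive.
have dG' : differentiable (G : R^o -> _) t by exact/derivable1_diffP.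
have dc : differentiable (f \o G : R^o -> R^o) t by exact: differentiable_comp.
apply: DeriveDef; first exact/derivable1_diffP.
rewrite (_ : (fun s => f (G s)) = f \o G)// deriveE// diff_comp//=.
have -> : 'd G t 1 = 'D_1 (G : R^o -> _) t by rewrite deriveE.
rewrite dE.
apply: eq_bigr => i _; rewrite derive_mx// mxE; congr (_ * _).
by have [_ <-] := dG i.
Qed.

Lemma is_derive_shift_arg f x a v : derivable f (x + a) v ->
  is_derive x v (fun y => f (y + a) : R^o) ('D_v f (x + a)).
Proof.
move=> df.
have E : (fun h : R => h^-1 *: (((fun y => f (y + a)) \o shift x) (h *: v) - f (x + a)))
       = (fun h : R => h^-1 *: ((f \o shift (x + a)) (h *: v) - f (x + a))).
  by apply/funext => h /=; rewrite addrA.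
by apply: DeriveDef; [rewrite /derivable E|rewrite /derive E].
Qed.

(* Symmetry of second derivatives: the mixed second difference
   f(x+se_i+te_j)-f(x+se_i)-f(x+te_j)+f(x) equals st times either mixed
   derivative at a nearby point. *)
Lemma C2_symmetric f x i j : Ck_on setT 2 f -> 'd_i ('d_j f) x = 'd_j ('d_i f) x.
Proof.
move=> C2.
have Cd k : Ck_on setT 1 ('d_k f) by exact: Ck_on_derive.
have C1 : Ck_on setT 1 f by exact: Ck_onS.
have key (k l : 'I_n) (s : R) : 0 < s -> exists2 z : 'rV[R]_n, `|z| <= 2 * s &
  f (x + s *: 'e k + s *: 'e l) - f (x + s *: 'e k) - f (x + s *: 'e l) + f x
    = s * s * 'd_l ('d_k f) (x + z).
  move=> s0.
  pose g := (fun y => f (y + s *: 'e l)) - f.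
  have dsh y : 'd_k (fun y => f (y + s *: 'e l)) y = 'd_k f (y + s *: 'e l).
    have dk : derivable f (y + s *: 'e l) ('e k) by exact: Ck_on_derivable C1.
    by have [_] := is_derive_shift_arg dk.
  have dshd y : derivable (fun y => f (y + s *: 'e l)) y ('e k).
    have dk : derivable f (y + s *: 'e l) ('e k) by exact: Ck_on_derivable C1.
    by case: (is_derive_shift_arg dk).
  have dg y : derivable (g : _ -> R^o) y ('e k).
    by apply: derivableB => //; exact: Ck_on_derivable C1.
  have [a as_ ga] := MVT_line (x := x) s (fun a => dg (x + a *: 'e k)).
  have [b bs gb] := MVT_line (f := 'd_k f) (x := x + a *: 'e k) (v := 'e l) s (fun b => Ck_on_derivable (Cd k)).
  exists (a *: 'e k + b *: 'e l).
    have en m : `|'e m| <= 1.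
      by apply/rV_norm_leP => // p; rewrite mxE; case: (_ && _); rewrite ?normr1 ?normr0.
    rewrite (le_trans (ler_normD _ _))// !normrZ mulr_natl mulr2n.
    by rewrite lerD// (le_trans (ler_piMr _ (en _)))// ?(le_trans as_) ?(le_trans bs)// gtr0_norm.
  rewrite addrA -mulrA -gb.
  have -> : 'd_k f (x + a *: 'e k + s *: 'e l) - 'd_k f (x + a *: 'e k) = 'd_k g (x + a *: 'e k).
    by rewrite deriveB ?dsh//; exact: Ck_on_derivable C1.
  rewrite -ga /g !fctE; ring.
have cd k l : continuous ('d_l ('d_k f)) by exact/(@Ck_on_continuous _ _ 0)/Ck_on_derive.
apply/eqP; rewrite -subr_eq0 -normr_le0; apply/ler_addgt0Pr => e e0; rewrite add0r.
have e20 : 0 < e / 2 by rewrite divr_gt0.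
have /cvgrPdist_le/(_ _ e20)/nbhs_ballP[d1 /= d10 dP1] := cd i j x.
have /cvgrPdist_le/(_ _ e20)/nbhs_ballP[d2 /= d20 dP2] := cd j i x.
pose s := Num.min d1 d2 / 4.
have m0 : 0 < Num.min d1 d2 by rewrite lt_min d10.
have m1 : Num.min d1 d2 <= d1 by rewrite ge_min lexx.
have m2 : Num.min d1 d2 <= d2 by rewrite ge_min lexx orbT.
have s0 : 0 < s by rewrite divr_gt0.
have [z1 z1s E1] := key i j s s0.
have [z2 z2s E2] := key j i s s0.
have E : 'd_j ('d_i f) (x + z1) = 'd_i ('d_j f) (x + z2).
  apply: (@mulfI _ (s * s)); first by rewrite mulf_neq0// gt_eqF.
  apply: (etrans (esym E1)); apply: (etrans _ E2).
  by rewrite (addrAC x); congr (_ + _); rewrite [LHS]addrAC.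
have ss : 2 * s < Num.min d1 d2.
  by rewrite /s; clear -m0; move: (Num.min d1 d2) m0 => m m0; lra.
apply: (@dist_le_half _ _ _ ('d_i ('d_j f) (x + z2))).
- apply: dP2; rewrite mx_norm_ball /ball_/= opprD addrA subrr add0r normrN.
  exact: (le_lt_trans z2s (lt_le_trans ss m2)).
- rewrite -E; apply: dP1; rewrite mx_norm_ball /ball_/= opprD addrA subrr add0r normrN.
  exact: (le_lt_trans z1s (lt_le_trans ss m1)).
Qed.

(** The derivative is known to exist, so it can be read off along any steps tending to 0, here those
    supplied by [ae_directional_accumulation]. *)
Lemma derive0_of_accumulating_zeros (q : R -> R) (l : R) :
  is_derive (0 : R) 1 q l -> q 0 = 0 ->
  (forall d : R, 0 < d -> exists h : R, [/\ 0 < `|h|, `|h| < d & q h = 0]) -> l = 0.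
Proof.
move=> [dq ql] q0 acc; apply/eqP; rewrite -normr_le0; apply/ler_addgt0Pr => e e0; rewrite add0r.
have : (fun h : R => h^-1 *: ((q \o shift (0 : R)) (h *: (1 : R)) - q 0)) @ 0^' --> l by rewrite -ql.
move=> /cvgrPdist_le/(_ _ e0)[d /= d0 dP].
have [h [h0 hd qh]] := acc d d0.
have := dP h; rewrite /ball_/= sub0r normrN => /(_ hd).
rewrite normr_gt0 in h0; move=> /(_ h0).
by rewrite addr0 [h%:A]mulr1 qh q0 subr0 scaler0 subr0.
Qed.

Lemma derive_le_of_accumulation (q : R -> R) (l L : R) : 0 <= L ->
  is_derive (0 : R) 1 q l -> 
  (forall d : R, 0 < d -> exists h : R, [/\ 0 < `|h|, `|h| < d & `|q h - q 0| <= L * `|h| ]) ->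
  `|l| <= L.
Proof.
move=> L0 [dq ql] acc; apply/ler_addgt0Pr => e e0.
have : (fun h : R => h^-1 *: ((q \o shift (0 : R)) (h *: (1 : R)) - q 0)) @ 0^' --> l by rewrite -ql.
move=> /cvgrPdist_le/(_ _ e0)[d /= d0 dP].
have [h [h0 hd qh]] := acc d d0.
have := dP h; rewrite /ball_/= sub0r normrN => /(_ hd).
have h0' := h0; rewrite normr_gt0 in h0; move=> /(_ h0).
rewrite addr0 [h%:A]mulr1 => le.
rewrite -(subrK (h^-1 *: (q h - q 0)) l) (le_trans (ler_normD _ _))// addrC lerD//.
by rewrite normrZ normfV mulrC ler_pdivrMr.
Qed.

End C1_functions.

(** * Smooth cutoffs *)

Section one_dim.
Context {R : realType}.
Implicit Types f : R -> R^o.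

Lemma derive_scale1 f (x v : R) : derivable f x 1 ->
  derivable f x v /\ 'D_v f x = v * 'D_1 f x.
Proof.
move=> /derivable1_diffP df; split; first exact: diff_derivable.
by rewrite !deriveE// -[v in LHS]mulr1 linearZ.
Qed.

Lemma is_derive_continuous f (t l : R) : is_derive t 1 f l -> {for t, continuous f}.
Proof.
by move=> d; apply: differentiable_continuous; apply/derivable1_diffP; exact: ex_derive.
Qed.

(** [Ck_on] quantifies over all directions; on the line they are multiples of 1. *)
Lemma Ck_on1S k f f' : (forall x : R, is_derive x 1 f (f' x)) ->
  Ck_on setT k f' -> Ck_on setT k.+1 f.
Proof.
move=> df Cf'; split.
  move=> x _; apply: differentiable_continuous; apply/derivable1_diffP; exact: ex_derive.
move=> v; split => [x _|]; first by have [] := @derive_scale1 f x v (@ex_derive _ _ _ _ _ _ _ (df x)).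
rewrite (_ : 'D_v f = (fun x => v * f' x)); first exact: Ck_onZ.
apply/funext => x; have [_ ->] := @derive_scale1 f x v (@ex_derive _ _ _ _ _ _ _ (df x)).
by have [_ ->] := df x.
Qed.

Lemma Ck_on_id k : Ck_on setT k (id : R -> R^o).
Proof.
case: k => [|k]; first by move=> x _; exact: cvg_id.
apply: (@Ck_on1S _ _ (cst 1)); exact: Ck_on_cst.
Qed.

Lemma is_derive_horner (p : {poly R}) (x : R) : is_derive x 1 (horner p) (p^`()).[x].
Proof. by apply: DeriveDef; [exact: derivable_horner|rewrite -derive1E derivE]. Qed.

Lemma smooth_atan : smooth_on setT (atan : R -> R^o).
Proof.
pose r (x : R) : R^o := (1 + x ^+ 2)^-1.
have r0 (x : R) : 1 + x ^+ 2 != 0 by rewrite gt_eqF// ltr_pwDl// sqr_ge0.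
have dr (x : R) : is_derive x 1 r (- 2 * (x * (r x * r x))).
  have pE (y : R) : (1 + 'X^2 : {poly R}).[y] = 1 + y ^+ 2 by rewrite !hornerE.
  have p0 : (1 + 'X^2 : {poly R}).[x] != 0 by rewrite pE.
  have d2 := is_deriveV p0 (is_derive_horner _ x).
  rewrite (_ : r = (fun y => (1 + 'X^2 : {poly R}).[y]^-1)); last by apply/funext => y; rewrite pE.
  refine (is_derive_eq d2 _).
  rewrite -[_ *: _]/(_ * _) /= pE derivD derivC derivXn add0r !hornerE /=; field; exact: r0.
have Cr k : Ck_on setT k r.
  elim: k => [|k IH].
    move=> x _; apply: differentiable_continuous; apply/derivable1_diffP; exact: ex_derive.
  apply: (Ck_on1S dr); apply: Ck_onZ; apply: (Ck_onM (Ck_on_id k)).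
  exact: Ck_onM.
move=> [|k]; first by move=> x _; exact: continuous_atan.
by apply: (@Ck_on1S _ _ r) => // x; exact: is_derive1_atan.
Qed.

(** The derivative of p(1/u) exp(-1/u) has the same form with X^2 (p - p') in place of p. The family
    is thus stable under differentiation, and smoothness follows by induction. *)
Definition flat (p : {poly R}) (u : R) : R^o := if 0 < u then p.[u^-1] * expR (- u^-1) else 0.

Lemma horner_le (p : {poly R}) : exists2 C : R, 0 <= C & forall y, 1 <= y -> `|p.[y]| <= C * y ^+ (size p).
Proof.
exists (\sum_(i < size p) `|p`_i|); first by apply: sumr_ge0.
move=> y y1; rewrite horner_coef (le_trans (ler_norm_sum _ _ _))// mulr_suml ler_sum// => i _.
rewrite normrM ler_wpM2l// normrX ger0_norm ?(le_trans ler01)//.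
by rewrite ler_weXn2l// ltnW.
Qed.

(** With y = 1/u and m the size of p, exp y dominates y^(m+2) / (m+2)!. The two spare powers of y
    give the u^2 that makes the derivative at 0 vanish. *)
Lemma flat_le (p : {poly R}) : exists2 C : R, 0 <= C & forall u, u <= 1 -> `|flat p u| <= C * u ^+ 2.
Proof.
have [C C0 Cp] := horner_le p; pose m := size p.
exists (C * (m.+2)`!%:R); first by rewrite mulr_ge0.
move=> u u1; rewrite /flat; case: ifPn => [u0|_]; last first.
  by rewrite normr0; apply: mulr_ge0; [exact: mulr_ge0|exact: sqr_ge0].
have y1 : 1 <= u^-1 by rewrite invf_ge1.
have y0 : 0 < u^-1 by rewrite invr_gt0.
rewrite normrM (ger0_norm (expR_ge0 _)) expRN ler_pdivrMr ?expR_gt0//.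
rewrite (le_trans (Cp _ y1))// -/m.
have E : (u^-1) ^+ m = u ^+ 2 * (u^-1) ^+ m.+2.
  rewrite (exprS _ m.+1) (exprS _ m); move: (_ ^+ m) => z; field.
  by rewrite gt_eqF.
have K : (u^-1) ^+ m.+2 <= (m.+2)`!%:R * expR u^-1.
  rewrite mulrC -ler_pdivrMr ?ltr0n ?fact_gt0//.
  by rewrite (le_trans _ (expR_ge1Dxn m.+1 (ltW y0)))// lerDr.
rewrite E; move: (sqr_ge0 u) K; move: (u ^+ 2) (_ ^+ m.+2) (_`!%:R) (expR _) => a b c d a0 bcd.
rewrite (_ : C * c * a * d = C * (a * (c * d))); last by ring.
by apply: ler_wpM2l => //; exact: ler_wpM2l.
Qed.

Lemma is_derive_flat (p : {poly R}) (u : R) :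
  is_derive u 1 (flat p) (flat ('X^2 * p - 'X^2 * p^`()) u).
Proof.
have [u0|u0|->] := ltgtP u 0.
- have E : \forall y \near u, cst 0 y = flat p y.
    near=> y; rewrite /flat ifF//; apply/negbTE; rewrite -leNgt ltW//.
    by near: y; exact: lt_nbhsl.
  have -> : flat ('X^2 * p - 'X^2 * p^`()) u = 0 by rewrite /flat ifF//; apply/negbTE; rewrite -leNgt ltW.
  exact: (near_eq_is_derive E (is_derive_cst _ _ _)).
- have E : \forall y \near u, p.[y^-1] * expR (- y^-1) = flat p y.
    near=> y; rewrite /flat ifT//.
    by near: y; exact: lt_nbhsr.
  have un0 : u != 0 by rewrite gt_eqF.
  have dV : is_derive u 1 (fun y : R => y^-1 : R) (- u ^- 2).
    by refine (is_derive_eq (is_deriveV un0 (is_derive_id u (1 : R))) _); rewrite [_ *: _]mulr1.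
  have dp := is_derive_horner p u^-1.
  have d1 : is_derive u 1 (fun y : R => p.[y^-1] : R) ((p^`()).[u^-1] * - u ^- 2).
    by have := is_derive1_comp dp dV.
  have d2 : is_derive u 1 (fun y : R => expR (- y^-1) : R) (expR (- u^-1) * u ^- 2).
    have dN : is_derive u 1 (fun y : R => - y^-1 : R) (u ^- 2).
      by refine (is_derive_eq (is_deriveN dV) _); rewrite opprK.
    by have := is_derive1_comp (is_derive_expR _) dN.
  have -> : flat ('X^2 * p - 'X^2 * p^`()) u = p.[u^-1] * (expR (- u^-1) * u ^- 2) + expR (- u^-1) * ((p^`()).[u^-1] * - u ^- 2).
    rewrite /flat ifT// !hornerE /=.
    move: (expR _) (p.[_]) (p^`().[_]) => a b c; field; exact: un0.
  exact: (near_eq_is_derive E (is_deriveM d1 d2)).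
have -> : flat ('X^2 * p - 'X^2 * p^`()) 0 = 0 by rewrite /flat ltxx.
have [C C0 Cp] := flat_le p.
have c0 : (fun h : R => h^-1 *: ((flat p \o shift 0) (h *: (1 : R)) - flat p 0)) @ 0^' --> (0 : R^o).
  apply/cvgrPdist_le => e e0; exists (Num.min 1 (e / (C + 1))).
    by rewrite /= lt_min ltr01 divr_gt0// ltr_wpDl.
  move=> h; rewrite /ball_/= sub0r normrN lt_min => /andP[h1 he] h0.
  rewrite sub0r normrN addr0 [h%:A]mulr1 {2}/flat ltxx subr0 normrZ normfV.
  rewrite ler_pdivrMl ?normr_gt0// (le_trans (Cp h _))//; first by rewrite (le_trans (ler_norm _))// ltW.
  rewrite -real_normK ?num_real// expr2 mulrA mulrC ler_wpM2l//.
  rewrite (le_trans (_ : _ <= (C + 1) * `|h|))//; first by rewrite ler_wpM2r// lerDl.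
  by rewrite -ler_pdivlMl ?ltr_wpDl// mulrC ltW.
by apply: DeriveDef; [apply/cvg_ex; exists 0|apply/cvg_lim].
Unshelve. all: by end_near. Qed.

Lemma smooth_flat p : smooth_on setT (flat p).
Proof.
move=> k; elim: k p => [|k IH] p.
  move=> x _; apply: differentiable_continuous; apply/derivable1_diffP.
  by case: (is_derive_flat p x).
by apply: Ck_on1S => [x|]; [exact: is_derive_flat|exact: IH].
Qed.

End one_dim.

Lemma is_derive_1BZ (R : realType) (V : normedModType R) (g : V -> R^o) (c : R) x v :
  derivable g x v -> is_derive x v (fun y => 1 - c * g y : R^o) (- c * 'D_v g x).
Proof.
move=> dg.
have E : (fun h : R => h^-1 *: (((fun y => 1 - c * g y : R^o) \o shift x) (h *: v) - (1 - c * g x)))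
   = (fun h : R => (- c) *: (h^-1 *: ((g \o shift x) (h *: v) - g x))).
  apply/funext => h /=; rewrite -[LHS]/(_ * _) -[RHS]/(_ * (_ * _)); ring.
have cE : (fun h : R => (- c) *: (h^-1 *: ((g \o shift x) (h *: v) - g x))) @ 0^' --> ((- c) *: 'D_v g x : R^o).
  by apply: cvgZr.
by apply: DeriveDef; [rewrite /derivable E; apply/cvg_ex; exists ((- c) *: 'D_v g x)|rewrite /derive E; apply/cvg_lim].
Qed.

Section cutoff.
Context {R : realType} {n : nat}.
Implicit Types (x v : 'rV[R]_n) (f g : 'rV[R]_n -> R^o).
Local Notation "''e' i" := (delta_mx 0 i : 'rV[R]_n) (at level 8, i at level 2).
Local Notation "''d_' i f" := ('D_(delta_mx 0 i) f) (at level 10, i at level 2, f at level 9).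

Lemma is_derive_coord x v i : is_derive x v (fun y : 'rV[R]_n => y 0 i : R^o) (v 0 i).
Proof.
have E : (fun h : R => h^-1 *: (((fun y : 'rV[R]_n => y 0 i : R^o) \o shift x) (h *: v) - x 0 i)) =
   (fun h : R => h^-1 *: (h *: (v 0 i : R^o))).
  by apply/funext => h /=; rewrite !mxE addrK.
have c : (fun h : R => h^-1 *: (h *: (v 0 i : R^o))) @ 0^' --> (v 0 i : R^o).
  apply/cvgrPdist_le => e e0; exists 1 => //= h _ h0.
  by rewrite scalerA mulVf// scale1r subrr normr0 ltW.
by apply: DeriveDef; [rewrite /derivable E; apply/cvg_ex; exists (v 0 i)|rewrite /derive E; apply/cvg_lim].
Qed.

Lemma smooth_coord i : smooth_on setT (fun y : 'rV[R]_n => y 0 i : R^o).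
Proof.
move=> [|k]; first by move=> x _; exact: coord_continuous.
split; first by move=> x _; exact: coord_continuous.
move=> v; split => [x _|]; first by case: (is_derive_coord x v i).
rewrite (_ : 'D_v _ = cst (v 0 i)); first exact: Ck_on_cst.
by apply/funext => x; have [_ ->] := is_derive_coord x v i.
Qed.

Lemma smooth_sqnorm : smooth_on setT (@sqnorm R n : _ -> R^o).
Proof.
move=> k; apply: (@Ck_on_sum _ _ k _ _ (fun i (y : 'rV[R]_n) => y 0 i * y 0 i : R^o)) => i.
by apply: (Ck_onM (smooth_coord i k) (smooth_coord i k)).
Qed.

Lemma derive_sqnorm x i : 'd_i (@sqnorm R n : _ -> R^o) x = 2 * x 0 i.
Proof.
have dc j v : derivable (fun y : 'rV[R]_n => y 0 j : R^o) x v by case: (is_derive_coord x v j).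
have dcE j v : 'D_v (fun y : 'rV[R]_n => y 0 j : R^o) x = v 0 j by have [_] := is_derive_coord x v j.
have -> : (@sqnorm R n : _ -> R^o) = \sum_(j < n) ((fun y : 'rV[R]_n => y 0 j : R^o) * (fun y : 'rV[R]_n => y 0 j : R^o)).
  by apply/funext => y; rewrite fct_sumE.
rewrite derive_sum; last by move=> j; apply: derivableM.
rewrite (bigD1 i)//= big1 ?addr0.
  rewrite deriveM// !dcE mxE !eqxx/= -[_ *: _]/(_ * _); ring.
move=> j ji; rewrite deriveM// !dcE mxE (negbTE ji) andbF -[_ *: _]/(_ * _) mulr0 addr0//.
Qed.

Lemma coord_le_sqnorm x i : `|x 0 i| ^+ 2 <= sqnorm x.
Proof.
rewrite /sqnorm /dot (bigD1 i)//= real_normK ?num_real// expr2 lerDl sumr_ge0// => j _.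
by rewrite -expr2 sqr_ge0.
Qed.

Lemma sqnormN x : sqnorm (- x) = sqnorm x.
Proof. by rewrite /sqnorm /dot; apply: eq_bigr => i _; rewrite mxE mulrNN. Qed.

(** A function of |x|^2, hence smooth and even, so that multiplying by it preserves oddness. The
    factor e normalises the value at 0, and thereby the limit in k, to 1. *)
Definition cutoff (k : nat) x : R^o := expR 1 * flat 1 (1 - (k.+1%:R ^- 2) * sqnorm x).

Lemma smooth_cutoff k : smooth_on setT (cutoff k).
Proof.
move=> j; apply: Ck_onZ; apply: (@Ck_on_comp _ _ _ _ (fun x => 1 - (k.+1%:R ^- 2) * sqnorm x)).
  exact: smooth_flat.
rewrite (_ : (fun x => _) = (cst 1 : 'rV[R]_n -> R^o) + (fun x => (- k.+1%:R ^- 2) * sqnorm x)).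
  by apply: (Ck_onD (Ck_on_cst j 1)); apply: Ck_onZ; exact: smooth_sqnorm.
by apply/funext => x; rewrite !fctE mulNr.
Qed.

Let c2 (k : nat) : 0 < (k.+1%:R ^- 2 : R). Proof. by rewrite invr_gt0 exprn_gt0. Qed.

Let arg_le1 k x : 1 - (k.+1%:R ^- 2) * sqnorm x <= 1.
Proof. by rewrite lerBlDr lerDl mulr_ge0 ?sqnorm_ge0// ltW. Qed.

Lemma cutoffN k x : cutoff k (- x) = cutoff k x.
Proof. by rewrite /cutoff sqnormN. Qed.

Lemma cutoff_ge0 k x : 0 <= cutoff k x.
Proof.
rewrite /cutoff mulr_ge0 ?expR_ge0// /flat; case: ifP => // _.
by rewrite hornerC mul1r expR_ge0.
Qed.

Lemma cutoff_le1 k x : cutoff k x <= 1.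
Proof.
rewrite /cutoff /flat; case: ifPn => [u0|_]; last by rewrite mulr0.
rewrite hornerC mul1r -expRD expR_le1 subr_le0.
by rewrite invf_ge1.
Qed.

Let flat_arg_gt0 k x p : flat p (1 - (k.+1%:R ^- 2) * sqnorm x) != 0 ->
  forall i, `|x 0 i| <= k.+1%:R.
Proof.
rewrite /flat; case: ifPn => [|_]; last by rewrite eqxx.
rewrite subr_gt0 mulrC ltr_pdivrMr ?exprn_gt0// mul1r => xk _ i.
rewrite -(@ler_pXn2r _ 2)// ?nnegrE//.
by rewrite (le_trans (coord_le_sqnorm x i))// ltW.
Qed.

Lemma cutoff_support k x : cutoff k x != 0 -> `|x| <= k.+1%:R.
Proof.
move=> x0; apply/rV_norm_leP => //; apply: (@flat_arg_gt0 _ _ 1).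
by apply: contra x0 => /eqP f0; rewrite /cutoff f0 mulr0.
Qed.

(** The inner derivative is 2 |x_i| / (k+1)^2, and |x_i| <= k+1 wherever the outer one does not
    vanish. *)
Lemma derive_cutoff_le : exists2 C : R, 0 <= C & forall k x i,
  `|'d_i (cutoff k) x| <= C / k.+1%:R.
Proof.
pose q : {poly R} := 'X^2 * 1 - 'X^2 * (1 : {poly R})^`().
have [C C0 Cq] := flat_le q.
exists (2 * expR 1 * C); first by rewrite !mulr_ge0// expR_ge0.
move=> k x i; pose u : 'rV[R]_n -> R^o := fun x => 1 - (k.+1%:R ^- 2) * sqnorm x.
have ds : derivable (@sqnorm R n : _ -> R^o) x ('e i) by exact: (Ck_on_derivable (smooth_sqnorm 1)).
have [du duE'] := is_derive_1BZ (k.+1%:R ^- 2) ds.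
have duE : 'd_i u x = - (k.+1%:R ^- 2) * (2 * x 0 i) by rewrite duE' derive_sqnorm.
have df : derivable (flat 1 : R -> R^o) (u x) 1 by case: (is_derive_flat 1 (u x)).
have dc := is_derive_comp_dir df du.
have dcu : derivable (fun y => flat 1 (u y)) x ('e i) by case: dc.
have -> : 'd_i (cutoff k) x = expR 1 * (flat q (u x) * (- (k.+1%:R ^- 2) * (2 * x 0 i))).
  rewrite (_ : cutoff k = expR 1 *: (fun y => flat 1 (u y)))//.
  rewrite deriveZ//; have [_ ->] := dc; rewrite duE.
  by have [_ ->] := is_derive_flat 1 (u x).
have [f0|f0] := eqVneq (flat q (u x)) 0.
  by rewrite f0 mul0r mulr0 normr0 divr_ge0// !mulr_ge0// expR_ge0.
have xk := flat_arg_gt0 f0 i.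
have fC : `|flat q (u x)| <= C.
  rewrite (le_trans (Cq _ (arg_le1 k x)))// ler_piMr//.
  move: f0; rewrite /flat; case: ifPn => [u0 _|_]; last by rewrite eqxx.
  by rewrite expr_le1// ?ltW// arg_le1.
rewrite !normrM normrN (gtr0_norm (expR_gt0 _)) (gtr0_norm (c2 k)) (gtr0_norm (_ : 0 < 2))//.
rewrite (_ : _ * C / _ = expR 1 * (C * (k.+1%:R ^- 2 * (2 * k.+1%:R)))); last first.
  have : k.+1%:R != 0 :> R by rewrite pnatr_eq0.
  clear; move: (k.+1%:R : R) (expR _) => z w z0; field; exact: z0.
rewrite ler_wpM2l ?expR_ge0// ler_pM// ?mulr_ge0// ?(ltW (c2 k))//.
by rewrite ler_wpM2l// ?(ltW (c2 k))// ler_wpM2l.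
Qed.

Lemma cvg_cutoff x : cutoff k x @[k --> \oo] --> (1 : R).
Proof.
have c1 : (1 - (k.+1%:R ^- 2) * sqnorm x : R) @[k --> \oo] --> (1 : R).
  rewrite -[X in _ --> X]subr0 -[X in _ - X](mul0r (sqnorm x)).
  apply: cvgB; first exact: cvg_cst.
  apply: cvgMl; rewrite -[X in _ --> X](mul0r 0).
  under eq_fun do rewrite -exprVn expr2.
  by apply: cvgM; exact: cvg_harmonic.
have cf : {for (1 : R), continuous (flat 1 : R -> R)}.
  by apply: (@Ck_on_continuous _ _ 0 _ (smooth_flat 1 0%N)).
rewrite (_ : (1 : R) = expR 1 * flat 1 1); last first.
  by rewrite /flat ltr01 hornerC mul1r invr1 expRN divff// gt_eqF// expR_gt0.
apply: cvgMr; exact: (continuous_cvg _ cf c1).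
Qed.

Lemma smooth_test_cutoff f k : smooth_on setT f -> test_function setT (fun x => f x * cutoff k x).
Proof.
move=> Sf; split => //.
- by move=> j; apply: (Ck_onM (Sf j) (smooth_cutoff k j)).
- apply: bounded_closed_compact; last exact: closed_closure.
  exists k.+1%:R; split; first exact: num_real.
  move=> M kM x; have : closure [set y : 'rV[R]_n | `|y| <= k.+1%:R] x -> `|x| <= M.
    by rewrite -(closure_id _).1 => [/= xk|]; [rewrite (le_trans xk)// ltW|exact: closed_norm_le].
  move=> h cx; apply: h; apply: closure_subset cx => y /= y0.
  by apply: cutoff_support; apply: contra y0 => /eqP ->; rewrite mulr0.
Qed.

End cutoff.

(** * Integrals and image measures *)

Section integral_helpers.
Context d (T : measurableType d) (R : realType) (m : {measure set T -> \bar R}).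
Implicit Types f g : T -> R.

Local Notation integ f := (m.-integrable setT (EFin \o f)).

Lemma integ_measurable f : integ f -> measurable_fun setT f.
Proof. by move=> /measurable_int /measurable_EFinP. Qed.

Lemma integ_ae_le f g : measurable_fun setT f -> integ g ->
  (\forall x \ae m, `|f x| <= g x) -> integ f.
Proof.
move=> mf ig fg; apply/integrableP; split; first exact/measurable_EFinP.
have /integrableP[mg goo] := ig.
apply: le_lt_trans goo.
apply: ae_ge0_le_integral => //.
- by apply: measurableT_comp => //; exact/measurable_EFinP.
- exact: measurableT_comp.
- by apply: filterS fg => x fx _; rewrite /= lee_fin (le_trans fx)// ler_norm.
Qed.

Lemma integ_ae_eq f g : measurable_fun setT f -> integ g ->
  (\forall x \ae m, f x = g x) -> integ f.
Proof.
move=> mf ig fg; apply: (@integ_ae_le _ (fun x => `|g x|)) => //.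
  exact: integrable_norm.
by apply: filterS fg => x ->.
Qed.

Lemma Rintegral_ae_eq f g : integ f -> integ g ->
  (\forall x \ae m, f x = g x) -> \int[m]_x f x = \int[m]_x g x.
Proof.
move=> /integ_measurable mf /integ_measurable mg fg; congr fine.
apply: ae_eq_integral => //; [exact/measurable_EFinP|exact/measurable_EFinP|].
by apply: filterS fg => x + _ => /= ->.
Qed.

Lemma integD f g : integ f -> integ g -> integ (fun x => f x + g x).
Proof. by move=> i1 i2; have := integrableD measurableT i1 i2. Qed.

Lemma integB f g : integ f -> integ g -> integ (fun x => f x - g x).
Proof. by move=> i1 i2; have := integrableB measurableT i1 i2. Qed.

Lemma integZ (c : R) f : integ f -> integ (fun x => c * f x).
Proof. by move=> i1; have := integrableZl measurableT c i1. Qed.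

Lemma integ_sum I (r : seq I) (F : I -> T -> R) : (forall i, integ (F i)) ->
  integ (fun x => \sum_(i <- r) F i x).
Proof.
move=> iF; elim: r => [|i r IH].
  by under [X in integrable _ _ X]eq_fun do rewrite /= big_nil; exact: integrable0.
under [X in integrable _ _ X]eq_fun do rewrite /= big_cons.
exact: (integD (iF i) IH).
Qed.

Lemma Rintegral_sum I (r : seq I) (F : I -> T -> R) : (forall i, integ (F i)) ->
  \int[m]_x (\sum_(i <- r) F i x) = \sum_(i <- r) \int[m]_x F i x.
Proof.
move=> iF; elim: r => [|i r IH].
  by under eq_Rintegral do rewrite big_nil; rewrite big_nil /Rintegral integral0.
under eq_Rintegral do rewrite big_cons.
by rewrite RintegralD// ?IH ?big_cons//; exact: integ_sum.
Qed.

Lemma ae_le_Rintegral f g : integ f -> integ g ->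
  (\forall x \ae m, f x <= g x) -> \int[m]_x f x <= \int[m]_x g x.
Proof.
move=> i1 i2 fg.
rewrite -subr_ge0 -RintegralB//.
(* The positive part turns an inequality valid almost everywhere into one valid everywhere. *)
pose h x := Num.max 0 (g x - f x).
have mgf : measurable_fun setT (fun x => g x - f x) by apply: integ_measurable; exact: integB.
have mh : measurable_fun setT h by apply: measurable_maxr.
have hE : \forall x \ae m, h x = g x - f x.
  by apply: filterS fg => x fx; rewrite /h max_r// subr_ge0.
rewrite -(@Rintegral_ae_eq h) ?Rintegral_ge0//.
- by move=> x _; rewrite /h le_max lexx.
- by apply: integ_ae_eq hE => //; exact: integB.
- exact: integB.
Qed.

Lemma ae_of_null N (P : T -> Prop) : measurable N -> m N = 0%E ->
  (forall x, ~ N x -> P x) -> \forall x \ae m, P x.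
Proof.
by move=> mN N0 NP; exists N; split => // x /= nP; apply: contrapT => /NP.
Qed.

Lemma integ_ge0_fin f : measurable_fun setT f -> (forall x, 0 <= f x) ->
  (\int[m]_x (f x)%:E < +oo)%E -> integ f.
Proof.
move=> mf f0 foo; apply/integrableP; split; first exact/measurable_EFinP.
by under eq_integral do rewrite /= ger0_norm//.
Qed.

End integral_helpers.

Section image_measure.
Context d1 d2 (T1 : measurableType d1) (T2 : measurableType d2) (R : realType).
Variables (m1 : {measure set T1 -> \bar R}) (m2 : {measure set T2 -> \bar R}).
Variables (S : T1 -> T2).
Hypothesis mS : measurable_fun setT S.
Hypothesis m2E : forall A, measurable A -> m2 A = m1 (S @^-1` A).

Let pf : {measure set T2 -> \bar R} :=
  measure_function_pushforward__canonical__measure_function_Measure m1 mS.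

Lemma ge0_integral_image (f : T2 -> \bar R) : measurable_fun setT f ->
  (forall y, 0 <= f y)%E -> (\int[m2]_y f y = \int[m1]_x f (S x))%E.
Proof.
move=> mf f0; rewrite (eq_measure_integral pf); last by move=> A mA _; exact: m2E.
by rewrite ge0_integral_pushforward.
Qed.

Lemma integ_image (f : T2 -> R) : measurable_fun setT f ->
  m2.-integrable setT (EFin \o f) <-> m1.-integrable setT (EFin \o (f \o S)).
Proof.
move=> mf.
have E : (\int[m2]_y `|(EFin \o f) y| = \int[m1]_x `|(EFin \o (f \o S)) x|)%E.
  rewrite (ge0_integral_image (f := fun y => `|(f y)%:E|%E))//.
  by apply: measurableT_comp => //; exact/measurable_EFinP.
have mfS : measurable_fun setT (EFin \o (f \o S)).
  by apply/measurable_EFinP; exact: measurableT_comp.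
split => /integrableP[_ foo]; apply/integrableP; split => //.
- by rewrite -E.
- exact/measurable_EFinP.
- by rewrite E.
Qed.

Lemma Rintegral_image (f : T2 -> R) : m2.-integrable setT (EFin \o f) ->
  \int[m2]_y f y = \int[m1]_x f (S x).
Proof.
move=> i2; have mf := integ_measurable i2; have i1 := (integ_image mf).1 i2.
congr fine; rewrite (eq_measure_integral pf); last by move=> A mA _; exact: m2E.
by rewrite (integral_pushforward mS)//; exact/measurable_EFinP.
Qed.

Lemma ae_image (P : T2 -> Prop) : (\forall y \ae m2, P y) -> \forall x \ae m1, P (S x).
Proof.
move=> [N [mN N0 NP]]; exists (S @^-1` N); split.
- by rewrite -[X in measurable X]setTI; exact: mS.
- by rewrite -m2E.
- by move=> x /= nP; exact: NP.
Qed.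

End image_measure.

(** * Entropy of a push-forward *)

Lemma null_dominatesI d (T : measurableType d) (R : realType)
  (m1 m2 : {measure set T -> \bar R}) :
  (forall N, measurable N -> m2 N = 0%E -> m1 N = 0%E) -> m1 `<< m2.
Proof. by move=> m12 N m2N A mA AN; apply: m12 => //; exact: m2N. Qed.

Section gauss_finite.
Context {R : realType}.

Lemma integral_expR_sqr : (\int[@lebesgue_measure R]_x (expR (- (x ^+ 2 / 2)))%:E < +oo)%E.
Proof.
have i1 := @integrable_normal_pdf R 0 1.
have p0 : normal_peak 1 != 0 :> R.
  by rewrite gt_eqF// normal_peak_gt0// oner_eq0.
have := integrableZl measurableT (normal_peak 1)^-1 i1.
move=> /integrableP[_]; apply: le_lt_trans.
rewrite le_eqVlt; apply/orP; left; apply/eqP; apply: eq_integral => x _ /=.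
rewrite /normal_pdf oner_eq0 /normal_fun mulrA mulVf// mul1r subr0.
by rewrite expr1n mulr2n -[1 + 1]/2%:R mulNr ger0_norm// expR_ge0.
Qed.

Lemma measurable_expR_sqnorm n : measurable_fun setT (fun x : 'rV[R]_n => expR (- (sqnorm x / 2))).
Proof.
apply: measurableT_comp => //; apply: measurableT_comp => //; apply: measurable_funM => //.
exact: measurable_sqnorm.
Qed.

(** Tonelli along the recursive construction of [lebesgue_rV]: the integrand factors over the
    coordinates. *)
Lemma integral_expR_sqnorm n :
  (\int[@lebesgue_rV R n]_x (expR (- (sqnorm x / 2)))%:E < +oo)%E.
Proof.
have mf := measurable_expR_sqnorm.
elim: n => [|n IH].
  apply: (@le_lt_trans _ _ (\int[@lebesgue_rV R 0]_x (cst 1%:E) x)%E); last first.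
    by rewrite integral_cst// mul1e /= diracE mem_set// ltry.
  apply: ge0_le_integral => //; try by apply/measurable_EFinP; exact: mf.
  by move=> x _; rewrite lee_fin expR_le1 oppr_le0 divr_ge0// sqnorm_ge0.
have f0 (x : 'rV[R]_n.+1) : (0 <= (expR (- (sqnorm x / 2)))%:E)%E by rewrite lee_fin expR_ge0.
have mf1 : measurable_fun setT (fun x : 'rV[R]_n.+1 => (expR (- (sqnorm x / 2)))%:E).
  by apply/measurable_EFinP; exact: mf.
rewrite (@ge0_integral_image _ _ _ _ _ (@lebesgue_measure R \x lebesgue_rV n)%E (lebesgue_rV n.+1)
  (@row_cons R n) (@measurable_row_cons R n) (fun A _ => erefl) _ mf1 f0).
have E (r : R) (x : 'rV[R]_n) : expR (- (sqnorm (row_cons (r, x)) / 2)) =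
    expR (- (r ^+ 2 / 2)) * expR (- (sqnorm x / 2)).
  rewrite -expRD; congr expR; rewrite /sqnorm /dot big_ord_recl.
  rewrite mxE unlift_none /=; under eq_bigr do rewrite mxE liftK /=.
  by rewrite expr2 mulrDl opprD.
rewrite fubini_tonelli1//; last first.
  by apply/measurable_EFinP; apply: (measurableT_comp (mf n.+1)); exact: measurable_row_cons.
rewrite /fubini_F.
have inner (r : R) : (\int[lebesgue_rV n]_x (expR (- (sqnorm (row_cons (r, x)) / 2)))%:E =
    (expR (- (r ^+ 2 / 2)))%:E * \int[lebesgue_rV n]_x (expR (- (sqnorm x / 2)))%:E)%E.
  under eq_integral => x _ do rewrite E EFinM.
  have mfn : measurable_fun setT (fun x : 'rV[R]_n => (expR (- (sqnorm x / 2)))%:E).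
    by apply/measurable_EFinP; exact: mf.
  by rewrite ge0_integralZl// => x _; rewrite lee_fin expR_ge0.
under eq_integral do rewrite inner.
have mg : measurable_fun setT (fun x : R => expR (- (x ^+ 2 / 2))).
  apply: measurableT_comp => //; apply: measurableT_comp => //; apply: measurable_funM => //.
have mgE : measurable_fun setT (fun x : R => (expR (- (x ^+ 2 / 2)))%:E) by exact/measurable_EFinP.
rewrite ge0_integralZr//; last by apply: integral_ge0 => x _; rewrite lee_fin expR_ge0.
by apply: lte_mul_pinfty => //; [apply: integral_ge0 => x _; rewrite lee_fin expR_ge0|
  rewrite ge0_fin_numE; [exact: integral_expR_sqr|apply: integral_ge0 => x _; rewrite lee_fin expR_ge0]].
Qed.

Local Notation gauss := (@gauss_measure R).

Lemma gauss_density_gt0 n (x : 'rV[R]_n) : 0 < gauss_density n x.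
Proof. by rewrite mulr_gt0 ?expR_gt0// powR_gt0// mulr_gt0// pi_gt0. Qed.

Lemma ge0_integral_gauss n (f : 'rV[R]_n -> \bar R) : measurable_fun setT f ->
  (forall x, 0 <= f x)%E ->
  (\int[gauss n]_x f x = \int[lebesgue_rV n]_x (f x * (gauss_density n x)%:E))%E.
Proof.
move=> mf f0; rewrite -(ge0_integral_dens (lebesgue_rV n) (@gauss_density_ge0 R n) (@measurable_gauss_density R n))//.
Qed.

Lemma gauss_finite n : (gauss n setT < +oo)%E.
Proof.
rewrite /gauss_measure /gauss_density; under eq_integral do rewrite EFinM.
rewrite ge0_integralZl//; try by rewrite lee_fin powR_ge0.
  by apply: lte_mul_pinfty; rewrite ?lee_fin ?powR_ge0//; exact: integral_expR_sqnorm.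
by apply/measurable_EFinP; exact: measurable_expR_sqnorm.
Qed.

Lemma lebesgue_dominates_gauss n : @lebesgue_rV R n `<< gauss n.
Proof.
apply: null_dominatesI => N mN.
move=> N0.
have mg : measurable_fun N (EFin \o @gauss_density R n).
  by apply/measurable_EFinP; apply: measurable_funTS; exact: measurable_gauss_density.
have : (\int[lebesgue_rV n]_(x in N) `|(EFin \o @gauss_density R n) x| = 0)%E.
  rewrite -[RHS]N0 /= /gauss_measure; apply: eq_integral => x _ /=.
  by rewrite ger0_norm// gauss_density_ge0.
move=> /(ae_eq_integral_abs _ mN mg).1 h.
apply/(negligibleP _ mN); apply: negligibleS h => x Nx /= /(_ Nx) /eqP.
by rewrite eqe gt_eqF// gauss_density_gt0.
Qed.

End gauss_finite.

Section entropy.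
Context d (T : measurableType d) (R : realType).
Variables (mu : {finite_measure set T -> \bar R}) (ga : {sigma_finite_measure set T -> \bar R}).
Hypothesis muga : mu `<< ga.
Hypothesis gafin : (ga setT < +oo)%E.

(** This representative is finite and nonnegative at every point; [relative_entropy] is written with
    [Radon_Nikodym], which agrees with it almost everywhere (see [entE]). *)
Definition density (x : T) : R := fine (Radon_Nikodym_SigmaFinite.f mu ga x).
Local Notation p := density.

Lemma density_ge0 x : 0 <= p x.
Proof. by rewrite /density fine_ge0// Radon_Nikodym_SigmaFinite.f_ge0. Qed.

Lemma densityE x : (p x)%:E = Radon_Nikodym_SigmaFinite.f mu ga x.
Proof. by rewrite /density fineK// Radon_Nikodym_SigmaFinite.f_fin_num. Qed.

Lemma measurable_density : measurable_fun setT p.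
Proof.
apply/measurable_EFinP; rewrite (_ : EFin \o p = Radon_Nikodym_SigmaFinite.f mu ga).
  exact: measurable_int (Radon_Nikodym_SigmaFinite.f_integrable muga).
by apply/funext => x; rewrite /= densityE.
Qed.

Lemma integral_density (f : T -> \bar R) : measurable_fun setT f -> (forall x, 0 <= f x)%E ->
  (\int[ga]_x (f x * (p x)%:E) = \int[mu]_x f x)%E.
Proof.
move=> mf f0; rewrite -(Radon_Nikodym_SigmaFinite.change_of_variables muga)//.
by apply: eq_integral => x _; rewrite densityE.
Qed.

Lemma density_gt0_ae : \forall x \ae mu, 0 < p x.
Proof.
have mN : measurable [set x | p x = 0].
  by have := measurable_density measurableT (measurable_set1 (0 : R)); rewrite setTI.
apply: (ae_of_null mN).
  apply: (etrans (Radon_Nikodym_SigmaFinite.f_integral muga mN)).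
  by apply: integral0_eq => x /= px; rewrite -densityE px.
by move=> x px; rewrite lt_neqAle density_ge0 andbT eq_sym; apply/eqP.
Qed.

(** Apply ln z < z at z = 1/u. *)
Lemma ent_ge (u : R) : 0 <= u -> -1 <= u * ln u.
Proof.
rewrite le_eqVlt => /predU1P[<-|u0]; first by rewrite mul0r oppr_le0.
have := ln_sublinear (_ : 0 < u^-1); rewrite invr_gt0 => /(_ u0).
rewrite lnV ?posrE// => h; rewrite -lerN2 opprK -mulrN.
by rewrite -(divff (lt0r_neq0 u0)) ler_wpM2l// ltW.
Qed.

Definition ent : \bar R :=
  (\int[ga]_x (let r := fine (Radon_Nikodym (charge_of_finite_measure mu) ga x) in
    (r * ln r)%R%:E))%E.

Let mpl : measurable_fun setT (fun x => p x * ln (p x)).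
Proof.
apply: measurable_funM; first exact: measurable_density.
by apply: measurableT_comp; [exact: measurable_ln|exact: measurable_density].
Qed.

Let mlp : measurable_fun setT (fun x => ln (p x)).
Proof. by apply: measurableT_comp; [exact: measurable_ln|exact: measurable_density]. Qed.

Lemma entE : ent = (\int[ga]_x (p x * ln (p x))%:E)%E.
Proof.
have mr : measurable_fun setT (fun x => fine (Radon_Nikodym (charge_of_finite_measure mu) ga x)).
  apply: (measurableT_comp (fine_measurable measurableT)).
  by apply: measurable_int; apply: Radon_Nikodym_integrable.
rewrite /ent /=; apply: ae_eq_integral => //.
- apply/measurable_EFinP; apply: measurable_funM => //.
  by apply: measurableT_comp => //; exact: measurable_ln.
- exact/measurable_EFinP.
have := ae_eq_Radon_Nikodym_SigmaFinite muga measurableT.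
by apply: filterS => x /(_ I) h _; rewrite /density h.
Qed.

Let integrable_neg : ga.-integrable setT (fun x => (Num.max 0 (- (p x * ln (p x))))%:E).
Proof.
apply: (@integ_ae_le _ _ _ ga _ (cst 1)).
- by apply: measurable_maxr => //; exact: measurableT_comp.
- apply/integrableP; split; first exact/measurable_EFinP/measurable_cst.
  under eq_integral do rewrite /= normr1.
  by rewrite integral_cst// mul1e.
- apply: filterE => x; rewrite ger0_norm ?le_max ?lexx// ge_max ler01 /= lerNl.
  by rewrite ent_ge// density_ge0.
Qed.

(** As p ln p >= -1 and [ga] is finite, the negative part is integrable, and finite entropy then
    bounds the positive part. *)
Lemma ent_integrable : (ent < +oo)%E -> mu.-integrable setT (EFin \o (fun x => ln (p x))).
Proof.
rewrite entE => Doo.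
pose f x := p x * ln (p x).
have fneg : (\int[ga]_x ((EFin \o f)^\- x) < +oo)%E.
  have /integrableP[_] := integrable_neg; apply: le_lt_trans.
  rewrite le_eqVlt; apply/orP; left; apply/eqP; apply: eq_integral => x _.
  rewrite funenegE /= -EFin_max maxC ger0_norm// le_max lexx//.
have fpos : (\int[ga]_x ((EFin \o f)^\+ x) < +oo)%E.
  rewrite ltNge leye_eq; apply/negP => /eqP h; move: Doo.
  rewrite integralE h addye ?ltxx// eqe_oppLR /=.
  by apply/negP => /eqP n0; move: fneg; rewrite n0.
apply/integrableP; split; first exact/measurable_EFinP.
rewrite -integral_density//; last by apply: measurableT_comp => //; exact/measurable_EFinP.
have -> : (\int[ga]_x (`|(EFin \o (fun x => ln (p x))) x| * (p x)%:E) =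
   \int[ga]_x ((EFin \o f)^\+ x + (EFin \o f)^\- x))%E.
  apply: eq_integral => x _; rewrite -[RHS]/(((EFin \o f)^\+ \+ (EFin \o f)^\-)%E x) -fune_abse.
  by rewrite /= -EFinM -{2}[p x]ger0_norm ?density_ge0// -normrM mulrC.
rewrite ge0_integralD//.
- exact: lte_add_pinfty.
- by apply: measurable_funepos; exact/measurable_EFinP.
- by apply: measurable_funeneg; exact/measurable_EFinP.
Qed.

Lemma ent_Rintegral : mu.-integrable setT (EFin \o (fun x => ln (p x))) ->
  ent = (\int[mu]_x ln (p x))%:E.
Proof.
move=> il; rewrite /Rintegral fineK; last exact: integrable_fin_num.
rewrite entE -(Radon_Nikodym_change_of_variables muga measurableT il).
have ml : measurable_fun setT (fun x => (ln (p x))%:E) by exact/measurable_EFinP.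
apply: ae_eq_integral => //.
- exact/measurable_EFinP.
- exact: emeasurable_funM.
have := ae_eq_Radon_Nikodym_SigmaFinite muga measurableT.
by apply: filterS => x /(_ I) h _; rewrite /= -h -densityE -EFinM mulrC.
Qed.

(** The negative part of ln p is integrable whatever the entropy; this gives the lower bound for ln
    p' in [entropy_comparison]. *)
Lemma integ_lnN : mu.-integrable setT (EFin \o (fun x => Num.max 0 (- ln (p x)))).
Proof.
have mN : measurable_fun setT (fun x => Num.max 0 (- ln (p x))).
  by apply: measurable_maxr => //; exact: measurableT_comp.
apply: integ_ge0_fin => //; first by move=> x; rewrite le_max lexx.
rewrite -integral_density//; [|exact/measurable_EFinP|by move=> x; rewrite lee_fin le_max lexx].
have /integrableP[_] := integrable_neg; apply: le_lt_trans.
rewrite le_eqVlt; apply/orP; left; apply/eqP; apply: eq_integral => x _.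
rewrite -EFinM /= ger0_norm ?le_max ?lexx// mulrC maxr_pMr ?density_ge0// mulr0.
by rewrite mulrN.
Qed.

Lemma Rintegral_density1 : mu setT = 1%E -> (\int[ga]_x (p x)%:E = 1)%E.
Proof.
move=> m1; rewrite -m1 (Radon_Nikodym_SigmaFinite.f_integral muga measurableT).
by apply: eq_integral => x _; rewrite densityE.
Qed.

End entropy.

Lemma log_rearrange (R : realFieldType) (a b e z : R) :
  1 + (a - b - e) <= z -> a <= e + b + (z - 1).
Proof. lra. Qed.

Section entropy_comparison.
Context d (T : measurableType d) (R : realType).
Variables (mu mu' : probability T R) (ga : {sigma_finite_measure set T -> \bar R}).
Hypothesis muga : mu `<< ga.
Hypothesis mu'ga : mu' `<< ga.
Hypothesis gafin : (ga setT < +oo)%E.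
Variables (S : T -> T) (X : set T) (w : T -> R) (c : R).
Hypothesis mS : measurable_fun setT S.
Hypothesis mu'E : forall A, measurable A -> mu' A = mu (S @^-1` A).
Hypothesis mX : measurable X.
Hypothesis muX : \forall x \ae mu, X x.
Hypothesis iw : mu.-integrable setT (EFin \o w).
Local Notation p := (density mu ga).
Local Notation p' := (density mu' ga).
Hypothesis area : (\int[ga]_(x in X) (p' (S x) * expR (- w x))%:E <= c%:E)%E.

(* Integrate log z <= z - 1 at z = p'(S x) e^(-w x) / p x. *)
Lemma entropy_comparison :
  mu.-integrable setT (EFin \o (fun x => ln (p x))) ->
  mu'.-integrable setT (EFin \o (fun x => ln (p' x))) /\
  \int[mu']_x ln (p' x) <= \int[mu]_x ln (p x) + \int[mu]_x w x + (c - 1).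
Proof.
move=> ip; have mw := integ_measurable iw.
have mp := measurable_density muga; have mp' := measurable_density mu'ga.
have mlp' : measurable_fun setT (fun x => ln (p' x)).
  by apply: measurableT_comp => //; exact: measurable_ln.
(* This is the z of the logarithmic inequality. Where p = 0 the factor [expR (- ln (p x))] is not
   1/p, but integration against mu multiplies it by p = 0. *)
pose q x := p' (S x) * expR (- w x) * expR (- ln (p x)) * \1_X x.
have mpw : measurable_fun setT (fun x => p' (S x) * expR (- w x)).
  apply: measurable_funM; first exact: measurableT_comp.
  by apply: measurableT_comp => //; exact: measurableT_comp.
have mV : measurable_fun setT (fun x => expR (- ln (p x))).
  apply: measurableT_comp => //; apply: measurableT_comp => //.
  by apply: measurableT_comp => //; exact: measurable_ln.
have mq : measurable_fun setT q.
  by apply: measurable_funM; [exact: measurable_funM|exact: measurable_indic].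
have q0 x : 0 <= q x.
  by rewrite /q !mulr_ge0 ?density_ge0 ?expR_ge0// indicE.
have qc : (\int[mu]_x (q x)%:E <= c%:E)%E.
  rewrite -(integral_density muga)//; last exact/measurable_EFinP.
  apply: le_trans area; rewrite [leRHS]integral_mkcond; apply: ge0_le_integral => //.
  - by move=> x _; rewrite mule_ge0 ?lee_fin ?density_ge0.
  - by apply: emeasurable_funM; exact/measurable_EFinP.
  - by apply/(measurable_restrictT _ mX); apply/measurable_EFinP; exact: measurable_funTS.
  - move=> x _; rewrite patchE /q indicE; case: ifPn => xX; last by rewrite mulr0 mul0e.
    rewrite mulr1 -EFinM lee_fin; have [->|px] := eqVneq (p x) 0.
      by rewrite mulr0 mulr_ge0 ?density_ge0 ?expR_ge0.
    by rewrite (expRN (ln _)) lnK ?divfK// posrE lt_neqAle eq_sym px density_ge0.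
have iq : mu.-integrable setT (EFin \o q).
  by apply: integ_ge0_fin => //; exact: le_lt_trans qc (ltry _).
have qc' : \int[mu]_x q x <= c.
  by rewrite /Rintegral -lee_fin fineK//; exact: integrable_fin_num.
have i1 : mu.-integrable setT (EFin \o (fun _ : T => 1 : R)).
  by have := finite_measure_integrable_cst mu (1 : R) measurableT.
pose g x := ln (p x) + w x + (q x - 1).
have ig : mu.-integrable setT (EFin \o g).
  by apply: integD; [exact: integD|exact: integB].
have key : \forall x \ae mu, ln (p' (S x)) <= g x.
  have p'0 := ae_image mS mu'E (density_gt0_ae mu'ga).
  have p0 := density_gt0_ae muga.
  apply: filterS3 muX p'0 p0 => x xX px' px.
  rewrite /g /q indicE mem_set// mulr1.
  have -> : p' (S x) = expR (ln (p' (S x))) by rewrite lnK.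
  by rewrite expRK -!expRD; apply: log_rearrange; exact: expR_ge1Dx.
have mN : measurable_fun setT (fun y => Num.max 0 (- ln (p' y))).
  by apply: measurable_maxr => //; exact: measurableT_comp.
have iN := (integ_image mS mu'E mN).1 (integ_lnN mu'ga gafin).
(* [key] bounds ln p' from above only; the bound from below is [iN]. *)
have ilS : mu.-integrable setT (EFin \o ((fun y => ln (p' y)) \o S)).
  apply: (@integ_ae_le _ _ _ mu _ (fun x => `|g x| + Num.max 0 (- ln (p' (S x))))) => //.
  - exact: measurableT_comp.
  - by apply: integD => //; exact: integrable_norm.
  - apply: filterS key => x; rewrite /=; move: (ln _) (g x) => a b ab.
    rewrite ler_norml; apply/andP; split.
      rewrite lerNl (le_trans (_ : _ <= Num.max 0 (- a)))// ?le_max ?lexx ?orbT//.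
      by rewrite lerDr.
    by rewrite (le_trans ab)// (le_trans (ler_norm _))// lerDl le_max lexx.
have il' : mu'.-integrable setT (EFin \o (fun x => ln (p' x))) by apply/(integ_image mS mu'E).
split => //; rewrite (Rintegral_image mS mu'E)//.
apply: (le_trans (ae_le_Rintegral ilS ig key)).
rewrite /g RintegralD//; [|exact: integD|exact: integB].
rewrite RintegralD// RintegralB// lerD2l.
have -> : \int[mu]_x (1 : R) = 1.
  rewrite /Rintegral (integral_cst mu measurableT).
  by rewrite mul1e; have h := @probability_setT _ _ _ mu; exact: (congr1 fine h).
by rewrite lerB.
Qed.

End entropy_comparison.

(** * The area inequality *)

Lemma itv_shift_err (R : realFieldType) (a b c d e r : R) :
  b <= c -> c < a -> - r <= e -> e <= r -> b - d - r <= c - d + e <= a - d + r.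
Proof. by move=> ? ? ? ?; apply/andP; split; lra. Qed.

Lemma opp_err (R : realFieldType) (a b e : R) : - e <= a - b -> - a <= e - b.
Proof. lra. Qed.

Section area.
Context {R : realType} {n : nat}.
Local Notation leb := (@lebesgue_rV R n).
Local Notation Rn := 'rV[R]_n.
Variables (F S : Rn -> Rn) (X E : set Rn).
Hypothesis mS : measurable_fun setT S.
Hypothesis mX : measurable X.
Hypothesis mE : measurable E.
Hypothesis FS : forall x, X x -> F (S x) = x.
Hypothesis XE : forall x, X x -> E (S x).

(** If x is in X and S x in the cube, then x = F (S x), and (x - F y) A^-1 differs from S x - y by
    the linearisation error times A^-1, that is by at most kap rho in each coordinate. Hence x lies
    in the affine image of a box that exceeds the cube by kap rho on every side. *)
Lemma cube_preimage_vol (A : 'M[R]_n) (kap rho : R) k z y :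
  A \in unitmx -> dcube k z y -> 0 <= kap -> 0 <= rho ->
  (forall q, dcube k z q -> `|F q - F y - (q - y) *m A| <= rho) ->
  (forall u : Rn, `|u *m invmx A| <= kap * `|u|) ->
  (leb (X `&` S @^-1` (dcube k z)) <= (`|\det A| * ((2 ^+ k)^-1 + 2 * (kap * rho)) ^+ n)%:E)%E.
Proof.
move=> uA yQ k0 r0 Fq Ak.
pose I i := `[(z 0 i)%:~R / 2 ^+ k - y 0 i - kap * rho, (z 0 i + 1)%:~R / 2 ^+ k - y 0 i + kap * rho]%classic.
pose B : set Rn := [set u | forall i, I i (u 0 i)].
have mI i : measurable (I i) by exact: measurable_itv.
have mB : measurable B by exact: (measurable_rV_box (A := I)).
have BE : leb B = (((2 ^+ k)^-1 + 2 * (kap * rho)) ^+ n)%:E.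
  rewrite (@lebesgue_rV_box _ _ I mI).
  rewrite (eq_bigr (fun=> ((2 ^+ k)^-1 + 2 * (kap * rho))%:E)).
    by rewrite prodEFin prodr_const card_ord.
  move=> i _; rewrite /I lebesgue_measure_itv/= lte_fin.
  have len : (z 0 i + 1)%:~R / 2 ^+ k - y 0 i + kap * rho - ((z 0 i)%:~R / 2 ^+ k - y 0 i - kap * rho) = (2 ^+ k)^-1 + 2 * (kap * rho).
    by rewrite intrD mulrDl mul1r; ring.
  have pos : 0 < (2 ^+ k)^-1 + 2 * (kap * rho).
    by rewrite ltr_pwDl// ?invr_gt0 ?exprn_gt0// !mulr_ge0.
  by rewrite -subr_gt0 len pos -EFinB len.
have dA : 0 < `|\det (invmx A)| by rewrite normr_gt0 -unitfE -unitmxE unitmx_inv.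
have uiA : invmx A \in unitmx by rewrite unitmx_inv.
have V := aff_vol_unitmx uiA (- (F y *m invmx A)) mB.
pose C := [set x : Rn | B (x *m invmx A + - (F y *m invmx A))].
have mC : measurable C.
  by apply: (@measurable_preimage _ _ _ _ (fun x : Rn => x *m invmx A + - (F y *m invmx A))) => //; exact: measurable_rV_lin.
have CE : leb C = (`|\det A| * ((2 ^+ k)^-1 + 2 * (kap * rho)) ^+ n)%:E.
  rewrite EFinM -BE -V muleA -EFinM -normrM -det_mulmx mulmxV// det1 normr1 mul1e//.
rewrite -CE; apply: le_measure; rewrite ?inE//.
  by apply: measurableI => //; apply: measurable_preimage => //; exact: measurable_dcube.
move=> x [Xx Qx] i.
have xE : x *m invmx A + - (F y *m invmx A) = (S x - y) + (F (S x) - F y - (S x - y) *m A) *m invmx A.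
  by rewrite FS// [in RHS]mulmxBl mulmxK// mulmxBl addrCA subrr addr0.
rewrite xE /I /= in_itv/= mxE mxE [(- y) 0 i]mxE.
have := le_trans (coord_le_norm _ i) (le_trans (Ak _) (ler_wpM2l k0 (Fq _ Qx))).
move: ((_ *m invmx A) 0 i) => e; rewrite ler_norml => /andP[e1 e2].
have := Qx; rewrite dcube_box => /(_ i); rewrite /= in_itv/= => /andP[q1 q2].
move: q1 q2 e1 e2; move: (_ / _) (_ / _) (S x 0 i) (y 0 i) (kap * rho) => a b c d r.
exact: itv_shift_err.
Qed.

Lemma lebesgue_rV_ball_le (b : Rn) (r : R) : 0 <= r ->
  leb [set x | `|x - b| <= r] = ((2 * r) ^+ n)%:E.
Proof.
move=> r0; rewrite -lebesgue_rV_le_norm//.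
exact: (lebesgue_rV_shift (- b) (measurable_norm_le r)).
Qed.

Let mXS k z : measurable (X `&` S @^-1` (dcube k z)).
Proof. by apply: measurableI => //; apply: measurable_preimage => //; exact: measurable_dcube. Qed.

Section weighted.
Variables (W : Rn -> R) (W0 : forall x, 0 <= W x) (mW : measurable_fun setT W).

Let WX x := W x * \1_X x.
Let WX0 x : 0 <= WX x. Proof. by rewrite /WX mulr_ge0// indicE. Qed.
Let mWX : measurable_fun setT WX.
Proof. by apply: measurable_funM => //; exact: measurable_indic. Qed.

(** The push-forward by S of the density W on X. An area inequality says that a multiple of Lebesgue
    measure dominates it, which can be tested on cubes. *)
Definition area_measure : {measure set Rn -> \bar R} :=
  measure_function_pushforward__canonical__measure_function_Measure
    [the {measure set Rn -> \bar R} of dens leb WX0 mWX] mS.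

Lemma area_measureE B : measurable B ->
  area_measure B = (\int[leb]_(x in X `&` S @^-1` B) (W x)%:E)%E.
Proof.
move=> mB; rewrite /area_measure /= /pushforward /dens.
rewrite integral_mkcond [RHS]integral_mkcond; apply: eq_integral => x _.
rewrite !patchE in_setI /WX indicE.
by case: (x \in S @^-1` B); case: (x \in X); rewrite /= ?mulr1 ?mulr0.
Qed.

Lemma ge0_integral_area (h : Rn -> \bar R) : measurable_fun setT h -> (forall x, 0 <= h x)%E ->
  (\int[area_measure]_y h y = \int[leb]_(x in X) (h (S x) * (W x)%:E))%E.
Proof.
move=> mh h0; rewrite ge0_integral_pushforward//= ge0_integral_dens//; last exact: measurableT_comp.
rewrite [RHS]integral_mkcond; apply: eq_integral => x _; rewrite patchE /WX indicE.
by case: ifPn => _; rewrite ?mulr1// mulr0 mule0.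
Qed.

Lemma area_le (c : R) (h : Rn -> \bar R) : 0 <= c -> dominated_on area_measure leb c E ->
  measurable_fun setT h -> (forall x, 0 <= h x)%E ->
  (\int[leb]_(x in X) (h (S x) * (W x)%:E) <= c%:E * \int[leb]_x h x)%E.
Proof.
move=> c0 dom mh h0; rewrite -ge0_integral_area//.
pose k : {nonneg R} := NngNum c0.
have -> : (c%:E * \int[leb]_x h x = \int[mscale k leb]_x h x)%E by rewrite ge0_integral_mscale.
apply: ge0_le_measure_integral => // B mB.
apply: (@le_trans _ _ (area_measure (B `&` E))).
  rewrite !area_measureE//; last exact: measurableI.
  rewrite (_ : X `&` S @^-1` B = X `&` S @^-1` (B `&` E))//.
  by apply/seteqP; split => x [Xx Bx]; [do 2 split => //; exact: XE|split => //; case: Bx].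
apply: (le_trans (dom _ (measurableI _ _ mB mE) (@subIsetr _ _ _))).
rewrite /mscale /=; apply: lee_wpmul2l; rewrite ?lee_fin//.
by apply: le_measure; rewrite ?inE//; exact: measurableI.
Qed.

End weighted.

(** The part of X sent by S into a cube of side 2^-k is the image by F of a subset of that cube, so
    it lies in a ball of radius M 2^-k. *)
Lemma area_crude (M : R) (h : Rn -> \bar R) : 0 <= M ->
  (forall q q', E q -> E q' -> `|F q - F q'| <= M * `|q - q'|) ->
  measurable_fun setT h -> (forall x, 0 <= h x)%E ->
  (\int[leb]_(x in X) (h (S x)) <= ((2 * M) ^+ n)%:E * \int[leb]_x h x)%E.
Proof.
move=> M0 FM mh h0.
have c0 : 0 <= (2 * M) ^+ n by rewrite exprn_ge0// mulr_ge0.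
have m1 : measurable_fun setT (fun _ : Rn => 1 : R) by exact: measurable_cst.
have := @area_le (fun=> 1) (fun=> ler01) m1 _ h c0 _ mh h0.
under eq_integral do rewrite mule1.
apply; apply: (@cubes_dominated _ _ _ _ 0%N) => // k z _ _.
rewrite area_measureE; last exact: measurable_dcube.
rewrite integral_cst// mul1e.
have [->|/set0P[x0 [Xx0 Qx0]]] := eqVneq (X `&` S @^-1` (dcube k z)) set0.
  by rewrite measure0 mule_ge0// lee_fin.
rewrite lebesgue_dcube -EFinM -exprMn -mulrA -(lebesgue_rV_ball_le x0); last first.
  by rewrite mulr_ge0// invr_ge0 exprn_ge0.
apply: le_measure; rewrite ?inE//.
  exact: (measurable_preimage (measurable_rV_shift (- x0)) (measurable_norm_le _)).
move=> x [Xx Qx] /=; rewrite -(FS Xx) -(FS Xx0) (le_trans (FM _ _ (XE Xx) (XE Xx0)))//.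
by rewrite ler_wpM2l//; exact: dcube_dist Qx Qx0.
Qed.

Section fine.
Variables (A : Rn -> 'M[R]_n) (g : Rn -> R) (kap c : R).
Hypothesis cF : forall i, continuous (fun y => F y 0 i : R).
Hypothesis cA : forall i j, continuous (fun y => A y i j : R).
Hypothesis cg : continuous g.
Hypothesis dF : forall y (e : R), 0 < e -> exists2 d : R, 0 < d &
  forall h, `|h| < d -> `|F (y + h) - F y - h *m A y| <= e * `|h|.
Hypothesis uA : forall y, E y -> A y \in unitmx.
Hypothesis kap0 : 0 <= kap.
Hypothesis c0 : 0 <= c.
Hypothesis Ak : forall y, E y -> forall u : Rn, `|u *m invmx (A y)| <= kap * `|u|.
Hypothesis detA : forall y, E y -> `|\det (A y)| <= c * expR (g y).

(** Makes the differentiability of F and the continuity of g uniform on pieces of E. For each step h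
    the conditions are closed in y, whence measurability, and the pieces fill E as m grows. *)
Let Em (e : R) (m : nat) : set Rn := E `&` \bigcap_(h in [set h : Rn | `|h| < 2 / m.+1%:R])
  ((\bigcap_i [set y | `|F (y + h) 0 i - F y 0 i - \sum_j h 0 j * A y j i| <= e * `|h|]) `&`
   [set y | `|g (y + h) - g y| <= e]).

Let cshift (f : Rn -> R) (h : Rn) : continuous f -> continuous (fun y : Rn => f (y + h)).
Proof.
move=> cf y; apply: (@continuous_comp _ _ _ (fun y : Rn => y + h) f); last exact: cf.
exact: continuousD (@cvg_id _ _) (@cvg_cst _ _ _ _ _).
Qed.

Let clnorm (f : Rn -> R) (r : R) : continuous f -> closed [set y | `|f y| <= r].
Proof.
move=> cf; apply: (@closed_comp _ _ (fun y => `|f y|) [set z | z <= r]) => [y _|]; last exact: closed_le.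
by apply: (@continuous_comp _ _ _ f Num.norm); [exact: cf|exact: norm_continuous].
Qed.

Let mEm e m : measurable (Em e m).
Proof.
apply: measurableI => //; apply: rV_closed_measurable.
apply: closed_bigI => h _; apply: closedI.
  apply: closed_bigI => i _; apply: clnorm.
  have C0 : Ck_on setT 0 ((fun y : Rn => F (y + h) 0 i : R^o) + (fun y => -1 * F y 0 i) +
      (fun y => -1 * \sum_j h 0 j * A y j i)).
    apply: Ck_onD; [apply: Ck_onD|].
    - by move=> y _; exact: (@cshift (fun y => F y 0 i)).
    - by apply: Ck_onZ => y _; exact: cF.
    - by apply: Ck_onZ; apply: Ck_on_sum => k; apply: Ck_onZ => y _; exact: cA.
  rewrite (_ : (fun y => _) = ((fun y : Rn => F (y + h) 0 i : R^o) + (fun y => -1 * F y 0 i) +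
      (fun y => -1 * \sum_j h 0 j * A y j i))); first exact: (Ck_on_continuous C0).
  by apply/funext => y; rewrite !fctE !mulN1r.
have C0 : Ck_on setT 0 ((fun y : Rn => g (y + h) : R^o) + (fun y => -1 * g y)).
  by apply: Ck_onD; [move=> y _; exact: cshift|apply: Ck_onZ => y _; exact: cg].
apply: clnorm; rewrite (_ : (fun y => _) = ((fun y : Rn => g (y + h) : R^o) + (fun y => -1 * g y))).
  exact: (Ck_on_continuous C0).
by apply/funext => y; rewrite !fctE mulN1r.
Qed.

Let EmE e : 0 < e -> \bigcup_m Em e m = E.
Proof.
move=> e0; apply/seteqP; split => [y [m _ []]//|y Ey].
have [d1 d10 dP] := dF y e0.
have /cvgrPdist_le/(_ _ e0)/nbhs_ballP[d2 /= d20 gP] := @cg y.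
have d0 : 0 < Num.min d1 d2 by rewrite lt_min d10.
have /archi_boundP := ltW (divr_gt0 (ltr0n R 2) d0).
set m := Num.bound _ => mP.
exists m => //; split => // h /= hm.
have hd : `|h| < Num.min d1 d2.
  apply: (lt_trans hm); rewrite ltr_pdivrMr ?ltr0n// mulrC -ltr_pdivrMr//.
  by rewrite (lt_trans mP)// ltr_nat.
have hd1 : `|h| < d1 by apply: (lt_le_trans hd); rewrite ge_min lexx.
have hd2 : `|h| < d2 by apply: (lt_le_trans hd); rewrite ge_min lexx orbT.
split.
  move=> i _ /=; apply: le_trans (dP h hd1).
  by apply: le_trans (coord_le_norm _ i); rewrite !mxE.
rewrite /= distrC; apply: gP; rewrite mx_norm_ball /ball_/=.
by rewrite opprD addrA subrr sub0r normrN.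
Qed.

Lemma area_fine (s : R) (h : Rn -> \bar R) : 0 < s ->
  measurable_fun setT h -> (forall x, 0 <= h x)%E ->
  (\int[leb]_(x in X) (h (S x) * (expR (- g (S x)))%:E) <= (c * expR s)%:E * \int[leb]_x h x)%E.
Proof.
move=> s0 mh h0.
have mg : measurable_fun setT g by exact: mx_continuous_measurable.
have mW : measurable_fun setT (fun x => expR (- g (S x))).
  by apply: measurableT_comp => //; apply: measurableT_comp => //; exact: measurableT_comp.
have W0 x : 0 <= expR (- g (S x)) by exact: expR_ge0.
apply: (@area_le _ W0 mW) => //; first by rewrite mulr_ge0 ?expR_ge0.
have den0 : 0 < 1 + 2 * kap * n%:R by rewrite ltr_pwDl// !mulr_ge0.
(* Two losses make up s: e from the oscillation of g on a cube, and 2 kap e n from the enlargement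
   of the box, since (1 + 2 kap e)^n <= exp (2 kap e n). *)
have [e e0 sE] : exists2 e, 0 < e & s = e * (1 + 2 * kap * n%:R).
  by exists (s / (1 + 2 * kap * n%:R)); rewrite ?divr_gt0// divfK// gt_eqF.
have ce0 : 0 <= c * expR s by rewrite mulr_ge0 ?expR_ge0.
rewrite -(EmE e0); apply: dominated_on_bigcup => [m|m]; first exact: mEm.
apply: (@cubes_dominated _ _ _ _ m _ ce0 (mEm e m)).
move=> k z mk [y [Qy [Ey Ym]]].
have q2 : (2 ^+ k)^-1 <= m.+1%:R^-1 :> R.
  rewrite lef_pV2 ?posrE ?ltr0n ?exprn_gt0// -natrX ler_nat.
  by rewrite (leq_trans (ltn_expl m (ltnSn 1)))// leq_exp2l.
have near q : dcube k z q -> [/\ `|q - y| <= (2 ^+ k)^-1, `|F q - F y - (q - y) *m A y| <= e * (2 ^+ k)^-1 & `|g q - g y| <= e].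
  move=> Qq; have qy := dcube_dist Qq Qy.
  have [|Y1 Y2] := Ym (q - y).
    rewrite /= (le_lt_trans qy)// (le_lt_trans q2)// ltr_pMl ?invr_gt0 ?ltr0n// ltr1n//.
  have yq : y + (q - y) = q by rewrite addrC subrK.
  move: Y1 Y2; rewrite /= => Y1 Y2; rewrite yq in Y2; split => //.
  apply: (@le_trans _ _ (e * `|q - y|)); last by rewrite ler_wpM2l// ltW.
  apply/rV_norm_leP => [|i]; first by rewrite mulr_ge0// ltW.
  by have := Y1 i I; rewrite /= yq !mxE.
rewrite area_measureE; last exact: measurable_dcube.
apply: (@le_trans _ _ (\int[leb]_(x in X `&` S @^-1` (dcube k z)) (expR (e - g y))%:E)%E).
  apply: ge0_le_integral => //.
  - by apply/measurable_EFinP; exact: measurable_funTS.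
  - move=> x [_ Qx]; rewrite lee_fin ler_expR.
    have [_ _] := near _ Qx; rewrite ler_norml => /andP[+ _].
    exact: opp_err.
rewrite integral_cst//.
have vol := cube_preimage_vol (uA Ey) Qy kap0 (mulr_ge0 (ltW e0) (_ : 0 <= (2 ^+ k)^-1)) (fun q Qq => let: And3 _ P _ := near q Qq in P) (Ak Ey).
apply: (@le_trans _ _ ((expR (e - g y))%:E * (`|\det (A y)| * ((2 ^+ k)^-1 + 2 * (kap * (e * (2 ^+ k)^-1))) ^+ n)%:E)%E).
  by apply: lee_wpmul2l; [rewrite lee_fin expR_ge0|apply: vol; rewrite invr_ge0 exprn_ge0].
rewrite lebesgue_dcube -!EFinM lee_fin.
set P2 := (2 ^+ k)^-1.
have -> : P2 + 2 * (kap * (e * P2)) = (1 + 2 * kap * e) * P2 by ring.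
rewrite exprMn !mulrA ler_wpM2r ?exprn_ge0 ?invr_ge0 ?exprn_ge0//.
have L1 : (1 + 2 * kap * e) ^+ n <= expR (2 * kap * e * n%:R).
  have k2 : 0 <= 1 + 2 * kap * e by exact: addr_ge0 ler01 (mulr_ge0 (mulr_ge0 (ler0n R 2) kap0) (ltW e0)).
  by rewrite expRM_natr lerXn2r ?nnegrE ?expR_ge0//; exact: expR_ge1Dx.
apply: (@le_trans _ _ (expR (e - g y) * (c * expR (g y)) * expR (2 * kap * e * n%:R))).
  apply: ler_pM L1; last by apply: ler_wpM2l; [exact: expR_ge0|exact: detA].
    by rewrite mulr_ge0// expR_ge0.
  exact: exprn_ge0 (addr_ge0 ler01 (mulr_ge0 (mulr_ge0 (ler0n R 2) kap0) (ltW e0))).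
rewrite -mulrA mulrCA -!mulrA ler_wpM2l// mulrCA -!expRD ler_expR.
rewrite sE.
by rewrite le_eqVlt; apply/orP; left; apply/eqP; ring.
Qed.

End fine.

End area.

(** * The velocity field of a displacement interpolation *)

Section slices.
Context {R : realType} {V : normedModType R}.

(** Differentiating a slice in direction v is differentiating f in direction (0, v). *)
Lemma Ck_on_slice (U : set (R^o * V)%type) k (f : R^o * V -> R^o) (t : R^o) :
  (forall x, U (t, x)) -> Ck_on U k f -> Ck_on setT k (fun x => f (t, x)).
Proof.
move=> Ut.
have cont g : {in U, continuous g} -> {in setT, continuous (fun x : V => g (t, x) : R^o)}.
  move=> cg x _; apply: (@continuous_comp _ _ _ (fun x : V => (t, x) : R^o * V)%type g).
    exact: (cvg_pair (@cvg_cst _ _ _ _ _) (@cvg_id _ _)).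
  by apply: cg; rewrite inE.
have E (g : R^o * V -> R^o) x v :
    (fun h : R => h^-1 *: (((fun x : V => g (t, x) : R^o) \o shift x) (h *: v) - g (t, x))) =
    (fun h : R => h^-1 *: ((g \o shift (t, x)) (h *: ((0, v) : R^o * V)) - g (t, x))).
  apply/funext => h /=; congr (_ *: (g _ - _)).
  by rewrite -[RHS]/(h *: (0 : R^o) + t, h *: v + x) scaler0 add0r.
elim: k f => [|k IH] f; first exact: cont.
move=> [cf df]; split; first exact: cont.
move=> v; have [d1 d2] := df (0, v); split.
  by move=> x _; rewrite /derivable E; exact: d1.
have -> : 'D_v (fun x : V => f (t, x)) = (fun x : V => 'D_((0, v) : R^o * V) f (t, x)).
  by apply/funext => x; rewrite /derive E.
exact: (IH _ d2).
Qed.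

End slices.

Section driven.
Context {R : realType} {n : nat}.
Local Notation Rn := 'rV[R]_n.
Local Notation leb := (@lebesgue_rV R n).
Local Notation "''e' i" := (delta_mx 0 i : 'rV[R]_n) (at level 8, i at level 2).
Local Notation "''d_' i f" := ('D_(delta_mx 0 i) f) (at level 10, i at level 2, f at level 9).

(** The potential [theta] becomes a parameter, so that all later constructions refer to the same
    one. *)
Record driven (mu : R -> probability Rn R) (T : Rn -> Rn) (theta : R -> Rn -> R^o) : Prop := Driven {
  driven_ac : forall t, 0 <= t <= 1 -> P2ac (mu t);
  driven_interp : displacement_interpolation mu T;
  driven_smooth : smooth_on [set z : R^o * Rn | 0 < z.1 < 1] (fun z => theta z.1 z.2);
  driven_velocity : forall t, 0 < t < 1 -> \forall x \ae mu 0,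
    grad (theta t) (interp T t x) = (fun s => interp T s x)^`()%classic t;
  driven_continuity : forall t (phi : Rn -> R^o), 0 < t < 1 -> test_function setT phi ->
    is_derive (t : R^o) 1 (fun s => \int[mu s]_x phi x : R^o)
      (\int[mu t]_x dot (grad phi x) (grad (theta t) x));
  driven_even : forall t, 0 <= t <= 1 -> even_measure (mu t);
  driven_poincare : forall t, 0 <= t <= 1 -> odd_poincare1 (mu t) }.

Variables (mu : R -> probability Rn R) (T : Rn -> Rn) (theta : R -> Rn -> R^o).
Hypothesis DR : driven mu T theta.

(* hess t y j i = d_j (v_t)_i, so that v (y + h) = v y + h *m hess t y + o(h). *)
Definition hess (f : Rn -> R^o) (y : Rn) : 'M[R]_n := \matrix_(j, i) 'd_j ('d_i f) y.

Local Notation v t := (grad (theta t)).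
Local Notation Tt := (interp T).

Lemma interpE t x : Tt t x = x + t *: (T x - x).
Proof. by rewrite /interp scalerBl scale1r scalerBr addrA addrAC -!addrA; congr (_ + _); rewrite addrC. Qed.

Lemma interp_shift s t x : Tt t x = Tt s x + (t - s) *: (T x - x).
Proof. by rewrite !interpE -addrA -scalerDl [s + _]addrC subrK. Qed.

Lemma derive1_interp t x : (fun s : R => Tt s x)^`()%classic t = T x - x.
Proof.
rewrite /derive1; apply: cvg_lim; first exact: norm_hausdorff.
apply: (@cvg_trans _ ((cst (T x - x) : R -> Rn) @ (0 : R)^')); last exact: cvg_cst.
apply: near_eq_cvg; near=> h; rewrite /= (interp_shift t (h + t)) [Tt t x + _]addrC addrK.
rewrite addrK scalerA mulVf ?scale1r//; near: h; exact: nbhs_dnbhs_neq.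
Unshelve. all: by end_near. Qed.

Lemma driven_smooth_slice t : 0 < t < 1 -> smooth_on setT (theta t).
Proof.
by move=> t01 k; exact: (Ck_on_slice (fun x => t01 : [set z : R^o * Rn | 0 < z.1 < 1] (t, x)) (driven_smooth DR k)).
Qed.

Lemma driven_measurable_T : measurable_fun setT T.
Proof. by have [[]] := driven_interp DR. Qed.

Lemma measurable_fun_rVD (f g : Rn -> Rn) : measurable_fun setT f -> measurable_fun setT g ->
  measurable_fun setT (fun x => f x + g x).
Proof.
move=> /measurable_fun_rVP mf /measurable_fun_rVP mg; apply/measurable_fun_rVP => i.
rewrite (_ : (fun x => _) = (fun x => f x 0 i + g x 0 i)); first exact: measurable_funD.
by apply/funext => x; rewrite mxE.
Qed.

Lemma measurable_fun_rVZ (c : R) (f : Rn -> Rn) : measurable_fun setT f ->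
  measurable_fun setT (fun x => c *: f x).
Proof.
move=> /measurable_fun_rVP mf; apply/measurable_fun_rVP => i.
rewrite (_ : (fun x => _) = (fun x => c * f x 0 i)); first exact: measurable_funM.
by apply/funext => x; rewrite mxE.
Qed.

Lemma measurable_interp t : measurable_fun setT (Tt t).
Proof.
apply: measurable_fun_rVD; apply: measurable_fun_rVZ => //; exact: driven_measurable_T.
Qed.

Lemma smooth_measurable (f : Rn -> R^o) : smooth_on setT f -> measurable_fun setT f.
Proof. by move=> sf; apply: mx_continuous_measurable; exact: Ck_on_continuous (sf 0%N). Qed.

Lemma smooth_derive (f : Rn -> R^o) w : smooth_on setT f -> smooth_on setT ('D_w f).
Proof. by move=> sf k; exact: Ck_on_derive (sf k.+1). Qed.

Lemma measurable_grad (f : Rn -> R^o) : smooth_on setT f -> measurable_fun setT (grad f).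
Proof.
move=> sf; apply/measurable_fun_rVP => i.
rewrite (_ : (fun x => _) = 'd_i f); first by apply: smooth_measurable; exact: smooth_derive.
by apply/funext => x; rewrite mxE.
Qed.

Lemma measurable_hess (f : Rn -> R^o) i j : smooth_on setT f ->
  measurable_fun setT (fun x => hess f x i j).
Proof.
move=> sf; rewrite (_ : (fun x => _) = 'd_i ('d_j f)).
  by apply: smooth_measurable; do 2 apply: smooth_derive.
by apply/funext => x; rewrite mxE.
Qed.

Lemma measurable_hess_le (f : Rn -> R^o) (L : R) : smooth_on setT f ->
  measurable [set y | forall i j, `|hess f y i j| <= L].
Proof.
move=> sf; rewrite (_ : [set y | _] = \bigcap_(i in [set: 'I_n]) \bigcap_(j in [set: 'I_n])
    ((fun y => `|hess f y i j|) @^-1` `]-oo, L])).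
  apply: fin_bigcap_measurable => // i _; apply: fin_bigcap_measurable => // j _.
  have m := measurableT_comp (@normr_measurable R setT) (measurable_hess i j sf).
  exact: (measurable_preimage m (measurable_itv _)).
apply/seteqP; split => [y h i _ j _|y h i j]; first by rewrite /preimage/= in_itv/=.
by have := h i I j I; rewrite /preimage/= in_itv.
Qed.

Lemma driven_image t A : 0 <= t <= 1 -> measurable A -> mu t A = mu 0 (Tt t @^-1` A).
Proof. by move=> t01 mA; have [_] := driven_interp DR; exact. Qed.

Lemma driven_null t N : 0 <= t <= 1 -> measurable N -> leb N = 0%E -> mu t N = 0%E.
Proof. by move=> t01 mN N0; have [_ /null_content_dominatesP] := driven_ac DR t01; exact. Qed.

End driven.

(** * Monotonicity of the gradient of a convex function *)

Section convex_gradient.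
Context {R : realType} {n : nat}.
Local Notation Rn := 'rV[R]_n.
Local Notation "''d_' i f" := ('D_(delta_mx 0 i) f) (at level 10, i at level 2, f at level 9).

Lemma dotC (x y : Rn) : dot x y = dot y x.
Proof. by apply: eq_bigr => i _; rewrite mulrC. Qed.

Lemma dotDl (x y z : Rn) : dot (x + y) z = dot x z + dot y z.
Proof. by rewrite -big_split; apply: eq_bigr => i _ /=; rewrite mxE mulrDl. Qed.

Lemma dotZl c (x y : Rn) : dot (c *: x) y = c * dot x y.
Proof. by rewrite mulr_sumr; apply: eq_bigr => i _ /=; rewrite mxE mulrA. Qed.

Lemma dotNl (x y : Rn) : dot (- x) y = - dot x y.
Proof. by rewrite -scaleN1r dotZl mulN1r. Qed.

Lemma dotBl (x y z : Rn) : dot (x - y) z = dot x z - dot y z.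
Proof. by rewrite dotDl dotNl. Qed.

Lemma dotDr (x y z : Rn) : dot z (x + y) = dot z x + dot z y.
Proof. by rewrite dotC dotDl !(dotC z). Qed.

Lemma dotZr c (x y : Rn) : dot y (c *: x) = c * dot y x.
Proof. by rewrite dotC dotZl dotC. Qed.

Lemma dotBr (x y z : Rn) : dot z (x - y) = dot z x - dot z y.
Proof. by rewrite dotC dotBl !(dotC z). Qed.

Lemma sqnormDZ (x y : Rn) c : sqnorm (x + c *: y) = sqnorm x + 2 * c * dot x y + c ^+ 2 * sqnorm y.
Proof.
rewrite /sqnorm dotDl !dotDr !dotZl !dotZr (dotC y x).
by move: (dot _ _) (dot _ _) (dot _ _) => a b e; ring.
Qed.

Lemma derive_dot_grad (f : Rn -> R^o) x w : differentiable f x -> 'D_w f x = dot (grad f x) w.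
Proof.
move=> df; rewrite deriveE// [in LHS](row_sum_delta w) linear_sum /dot.
by apply: eq_bigr => i _; rewrite linearZ/= mxE deriveE// mulrC.
Qed.

Lemma convex_function_derive_le (D : set Rn) (f : Rn -> R^o) x y : convex_function D f ->
  D x -> D y -> differentiable f x -> 'D_(y - x) f x <= f y - f x.
Proof.
move=> cf Dx Dy df; rewrite leNgt; apply/negP => lt.
have : derivable f x (y - x) by exact: diff_derivable.
move=> /cvgr_gt/(_ _ lt)[d /= d0 dP].
pose h := Num.min (d / 2) 1.
have h0 : 0 < h by rewrite lt_min divr_gt0//=.
have h1 : h <= 1 by rewrite ge_min lexx orbT.
have hd : `|h| < d by rewrite gtr0_norm// gt_min ltr_pdivrMr// ltr_pMr// ltr1n.
have := dP h; rewrite /ball_/= sub0r normrN => /(_ hd); rewrite gt_eqF// => /(_ isT).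
have := cf (Itv01 (ltW h0) h1) y x; rewrite !inE => /(_ Dy Dx).
rewrite /conv/= => cle; rewrite ltNge => /negP; apply.
rewrite -[_ *: _]/(_ * _) ler_pdivrMl// mulrBr.
rewrite (_ : h *: (y - x) + x = h *: y + (1 - h) *: x); last first.
  by rewrite scalerBl scale1r scalerBr -addrA; congr (_ + _); rewrite addrC.
apply: (le_trans (lerB cle (lexx _))); rewrite /conv/= -[X in X + _ - _]/(h * f y) -[X in _ + X - _]/((1 - h) * f x).
by rewrite le_eqVlt; apply/orP; left; apply/eqP; ring.
Qed.

(** Add the tangent inequalities at x and at y. *)
Lemma convex_grad_monotone (D : set Rn) (f : Rn -> R^o) x y : convex_function D f ->
  D x -> D y -> differentiable f x -> differentiable f y ->
  0 <= dot (x - y) (grad f x - grad f y).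
Proof.
move=> cf Dx Dy dx dy.
have := convex_function_derive_le cf Dx Dy dx; have := convex_function_derive_le cf Dy Dx dy.
rewrite !derive_dot_grad// !dotBr !dotBl ![dot (grad _ _) _]dotC.
by move: (dot _ _) (dot _ _) (dot _ _) (dot _ _) (f x) (f y) => *; lra.
Qed.

End convex_gradient.

Section driven_velocity.
Context {R : realType} {n : nat}.
Local Notation Rn := 'rV[R]_n.
Local Notation leb := (@lebesgue_rV R n).
Local Notation "''e' i" := (delta_mx 0 i : 'rV[R]_n) (at level 8, i at level 2).
Local Notation "''d_' i f" := ('D_(delta_mx 0 i) f) (at level 10, i at level 2, f at level 9).
Variables (mu : R -> probability Rn R) (T : Rn -> Rn) (theta : R -> Rn -> R^o).
Hypothesis DR : driven mu T theta.
Local Notation v t := (grad (theta t)).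
Local Notation Tt := (interp T).

Lemma itv_cc (t : R) : 0 < t < 1 -> 0 <= t <= 1.
Proof. by move=> /andP[a b]; rewrite !ltW. Qed.

Lemma itv_margin (al s : R) : 0 < al -> al <= s <= 1 - al -> 0 < s < 1.
Proof.
by move=> al0 /andP[a b]; rewrite (lt_le_trans al0 a)/= (le_lt_trans b)// ltrBlDr ltrDl.
Qed.

Lemma vel_interp t : 0 < t < 1 -> \forall x \ae mu 0, v t (Tt t x) = T x - x.
Proof.
move=> t01; apply: filterS (driven_velocity DR t01) => x ->; exact: derive1_interp.
Qed.

Lemma ae_interp t (P : Rn -> Prop) : 0 <= t <= 1 -> (\forall y \ae mu t, P y) ->
  \forall x \ae mu 0, P (Tt t x).
Proof.
move=> t01; apply: (ae_image (measurable_interp DR t)) => A mA; exact: (driven_image DR t01 mA).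
Qed.

Lemma ae_interp_null t (N : set Rn) : 0 <= t <= 1 -> measurable N -> leb N = 0%E ->
  \forall x \ae mu 0, ~ N (Tt t x).
Proof.
move=> t01 mN N0; apply: (ae_interp (P := fun y => ~ N y) t01).
exact: (ae_of_null mN (driven_null DR t01 mN N0)).
Qed.

Lemma driven_monotone : exists N, [/\ measurable N, mu 0 N = 0%E &
  forall x y, ~ N x -> ~ N y -> 0 <= dot (x - y) (T x - T y)].
Proof.
have [[_ _ [D [phi [_ cf [N [mN N0 NP]]]]]] _] := driven_interp DR.
have good x : ~ N x -> [/\ interior D x, differentiable phi x & grad phi x = T x].
  by move=> Nx; apply: contrapT => h; apply: Nx; exact: NP.
exists N; split => // x y /good[Dx dx <-] /good[Dy dy <-].
by apply: (convex_grad_monotone cf) => //; exact: interior_subset.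
Qed.

End driven_velocity.

(** Read A = |a|^2, B = |b|^2, m = <a, b>. The last hypothesis is q B <= A + (1 - 2 s) m, and |a + q
    b|^2 and |a - q b|^2 being nonnegative gives 2 q |m| <= A + q^2 B. Together q^2 B <= (1 + 2 q)
    A, and q <= 1/2. *)
Lemma monotone_pair_ineq (R : realFieldType) (q A B m s : R) : 0 < q -> q <= 1 / 2 -> 0 <= A ->
  0 <= A + 2 * q * m + q ^+ 2 * B -> 0 <= A + 2 * - q * m + (- q) ^+ 2 * B ->
  0 <= s -> s <= 1 -> q = s * (1 - s) ->
  0 <= A + (1 - s) * m - s * (m + (1 - s) * B) -> q ^+ 2 * B <= 2 * A.
Proof.
move=> q0 q1 A0 h1 h2 s0 s1 qE h.
have h3 : q * B <= A + (1 - 2 * s) * m by rewrite qE; lra.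
have m1 : 2 * q * ((1 - 2 * s) * m) <= A + q ^+ 2 * B.
  have [m0|m0] := leP 0 m.
    have : (1 - 2 * s) * m <= m by rewrite ler_piMl//; lra.
    have := ler_wpM2l (ltW q0) (_ : (1 - 2 * s) * m <= m); nra.
  have : (1 - 2 * s) * m <= - m by nra.
  nra.
have : 2 * q * (q * B) <= 2 * q * (A + (1 - 2 * s) * m) by rewrite ler_wpM2l// mulr_ge0// ltW.
nra.
Qed.

Section vector_lemmas.
Context {R : realType} {n : nat}.
Local Notation Rn := 'rV[R]_n.

Lemma mulmx_addZ_entry (A B : 'M[R]_n) (c : R) j i :
  ((1%:M + c *: A) *m B) j i = \sum_k ((j == k)%:R + c * A j k) * B k i.
Proof. by rewrite mxE; apply: eq_bigr => k _; rewrite !mxE. Qed.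

Lemma subDZ (y y' a b : Rn) (c : R) : y + c *: a - (y' + c *: b) = y - y' + c *: (a - b).
Proof. by rewrite opprD addrACA scalerBr. Qed.

(** For differences a of positions and b of velocities at time s, a - s b and a + (1 - s) b are the
    differences of positions at times 0 and 1. The constant comes from s (1 - s) >= al^2. *)
Lemma sqnorm_monotone_pair (a b : Rn) (s al : R) : 0 < al -> al <= s <= 1 - al ->
  0 <= dot (a - s *: b) (a + (1 - s) *: b) -> sqnorm b <= 2 / al ^+ 4 * sqnorm a.
Proof.
move=> al0 /andP[s1 s2].
rewrite dotBl dotZl !dotDr !dotZr -/(sqnorm a) -/(sqnorm b) (dotC b a) => h.
pose q := s * (1 - s).
have s0 : 0 < s by exact: lt_le_trans al0 s1.
have s10 : al <= 1 - s by rewrite lerBrDl -lerBrDr.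
have s100 : 0 < 1 - s by exact: lt_le_trans al0 s10.
have q0 : 0 < q by rewrite mulr_gt0.
have q1 : q <= 1 / 2.
  by rewrite /q; clear; have := sqr_ge0 (s - 1 / 2); rewrite expr2; nra.
have aq : al ^+ 2 <= q by rewrite /q expr2 ler_pM// ltW.
have := monotone_pair_ineq q0 q1 (sqnorm_ge0 a) _ _ (ltW s0) _ (erefl q) h.
rewrite -!sqnormDZ !sqnorm_ge0 => /(_ isT isT); rewrite -subr_ge0 ltW// => /(_ isT) key.
rewrite mulrAC ler_pdivlMr ?exprn_gt0// mulrC; apply: le_trans key.
rewrite ler_wpM2r ?sqnorm_ge0// -[4%N]/(2 * 2)%N exprM lerXn2r// nnegrE ?exprn_ge0// ltW//.
Qed.

Lemma measurable_eq_rV (f g : Rn -> Rn) : measurable_fun setT f -> measurable_fun setT g ->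
  measurable [set y | f y = g y].
Proof.
move=> mf mg.
have -> : [set y | f y = g y] = \bigcap_(i in [set: 'I_n]) [set y | (f y - g y) 0 i = 0].
  apply/seteqP; split => [y /= fg i _ /=|y h]; first by rewrite fg subrr mxE.
  by apply/rowP => i; have := h i I; rewrite /= !mxE => /eqP; rewrite subr_eq0 => /eqP.
apply: fin_bigcap_measurable => // i _.
have m : measurable_fun setT (fun y => (f y - g y) 0 i).
  rewrite (_ : (fun y => _) = (fun y => f y 0 i - g y 0 i)); last by apply/funext => y; rewrite !mxE.
  by apply: measurable_funB; [exact: (measurable_fun_rVP f).1|exact: (measurable_fun_rVP g).1].
by have := m measurableT _ (measurable_set1 0); rewrite setTI.
Qed.

Lemma sqnorm_delta (j : 'I_n) (h : R) : sqnorm (h *: delta_mx 0 j : Rn) = h ^+ 2.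
Proof.
rewrite /sqnorm /dot (bigD1 j)//= big1 => [|i ij]; first by rewrite addr0 !mxE !eqxx mulr1.
by rewrite !mxE eqxx (negbTE ij) mulr0 mul0r.
Qed.

End vector_lemmas.

(** * Second derivatives of the potential along the interpolation *)

Section hessian.
Context {R : realType} {n : nat}.
Local Notation Rn := 'rV[R]_n.
Local Notation leb := (@lebesgue_rV R n).
Local Notation "''e' i" := (delta_mx 0 i : 'rV[R]_n) (at level 8, i at level 2).
Local Notation "''d_' i f" := ('D_(delta_mx 0 i) f) (at level 10, i at level 2, f at level 9).
Variables (mu : R -> probability Rn R) (T : Rn -> Rn) (theta : R -> Rn -> R^o).
Hypothesis DR : driven mu T theta.
Local Notation v t := (grad (theta t)).
Local Notation Tt := (interp T).

(** A point y at time s comes from y - s v_s y and ends at y + (1 - s) v_s y. E collects the y for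
    which T really sends the first to the second, so that monotonicity of T becomes a property of
    pairs at time s. *)
Lemma driven_monotone_set s : 0 < s < 1 -> exists E, [/\ measurable E,
  \forall x \ae mu 0, E (Tt s x) & forall y y', E y -> E y' ->
    0 <= dot (y - y' - s *: (v s y - v s y')) (y - y' + (1 - s) *: (v s y - v s y'))].
Proof.
move=> s01; have [N [mN N0 mono]] := driven_monotone DR.
have mv := measurable_grad (driven_smooth_slice DR s01).
have mS : measurable_fun setT (fun y : Rn => y + - s *: v s y).
  by apply: measurable_fun_rVD => //; exact: measurable_fun_rVZ.
exists ((fun y : Rn => y + - s *: v s y) @^-1` (~` N) `&`
  [set y | T (y + - s *: v s y) = y + (1 - s) *: v s y]); split.
- apply: measurableI; first by apply: measurable_preimage => //; exact: measurableC.
  apply: measurable_eq_rV; first exact: measurableT_comp (driven_measurable_T DR) mS.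
  by apply: measurable_fun_rVD => //; exact: measurable_fun_rVZ.
- have NN : \forall x \ae mu 0, ~ N x by exact: (ae_of_null mN).
  apply: filterS2 NN (vel_interp DR s01) => x Nx vx.
  rewrite /= vx !interpE -addrA -scalerDl subrr scale0r addr0; split => //.
  by rewrite -addrA -scalerDl [s + _]addrC subrK scale1r addrC subrK.
- move=> y y' [Ny Ty] [Ny' Ty']; have := mono _ _ Ny Ny'; rewrite Ty Ty'.
  by rewrite !subDZ scaleNr.
Qed.

Lemma derive_coord_line (y : Rn) (j k : 'I_n) :
  is_derive (0 : R) 1 (fun h : R => (y + h *: 'e j) 0 k : R) (j == k)%:R.
Proof.
have := is_derive_line (f := fun z : Rn => z 0 k : R^o) (x := y) (v := 'e j) (s := 0) _.
have [d e] := is_derive_coord (y + 0 *: 'e j) ('e j) k; move=> /(_ d).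
by rewrite e mxE eqxx eq_sym.
Qed.

Lemma hess_line (f : Rn -> R^o) (y : Rn) i j : smooth_on setT f ->
  is_derive (0 : R) 1 (fun h : R => 'd_i f (y + h *: 'e j) : R) (hess f y j i).
Proof.
move=> sf; have s1 := smooth_derive ('e i) sf.
have := is_derive_line (f := 'd_i f) (x := y) (v := 'e j) (s := 0) (Ck_on_derivable (s1 1%N)).
by rewrite scale0r addr0 mxE.
Qed.

(** The velocity is Lipschitz on the set of [driven_monotone_set], with a constant depending on al
    alone, and the bound passes to derivatives at the accumulation points of that set. *)
Lemma hess_interp_bound (al : R) : 0 < al -> exists2 L : R, 0 <= L &
  forall s, al <= s <= 1 - al -> \forall x \ae mu 0, forall i j, `|hess (theta s) (Tt s x) i j| <= L.
Proof.
move=> al0; pose M := 2 / al ^+ 4; have M0 : 0 <= M by rewrite divr_ge0// exprn_ge0// ltW.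
(* M bounds squared difference quotients, and sqrt M <= 1 + M. *)
exists (1 + M); first by rewrite addr_ge0.
move=> s sal; have s01 := itv_margin al0 sal.
have [E [mE aeE mono]] := driven_monotone_set s01.
have lip y y' i : E y -> E y' -> (v s y 0 i - v s y' 0 i) ^+ 2 <= M * sqnorm (y - y').
  move=> Ey Ey'; apply: le_trans (sqnorm_monotone_pair al0 sal (mono _ _ Ey Ey')).
  by apply: le_trans (coord_le_sqnorm _ i); rewrite !mxE real_normK// num_real.
have /choice[N NP] (j : 'I_n) := ae_directional_accumulation ('e j) mE.
have NN : \forall x \ae mu 0, forall j, ~ N j (Tt s x).
  apply: (@filter_forall _ _ _ _ _ _) => j.
  by have [mN N0 _] := NP j; exact: (ae_interp_null DR (itv_cc s01)).
apply: filterS2 aeE NN => x Ex Nx i j.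
apply: (derive_le_of_accumulation (addr_ge0 ler01 M0) (hess_line (Tt s x) j i (driven_smooth_slice DR s01))).
move=> d d0; have [_ _ acc] := NP i; have [h [h0 hd Eh]] := acc _ Ex (Nx i) d d0.
exists h; split => //; rewrite scale0r addr0.
have := lip _ _ j Eh Ex; rewrite !mxE [Tt s x + _]addrC addrK sqnorm_delta => le.
rewrite -[leLHS]sqrtr_sqr -[leRHS]ger0_norm ?mulr_ge0 ?addr_ge0//.
rewrite -sqrtr_sqr ler_wsqrtr// (le_trans le)// exprMn real_normK ?num_real// ler_wpM2r ?sqr_ge0//.
by rewrite expr2; nra.
Qed.

Lemma hess_interp_chain (s t : R) : 0 < s < 1 -> 0 < t < 1 -> \forall x \ae mu 0,
  (1%:M + (t - s) *: hess (theta s) (Tt s x)) *m hess (theta t) (Tt t x) = hess (theta s) (Tt s x).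
Proof.
move=> s01 t01; set tau := t - s.
have ss := driven_smooth_slice DR s01; have st := driven_smooth_slice DR t01.
pose F y := y + tau *: v s y.
have mF : measurable_fun setT F.
  by apply: measurable_fun_rVD => //; apply: measurable_fun_rVZ; exact: measurable_grad.
(* Velocities are constant along trajectories; the equation that expresses this is differentiated
   along steps that remain in G. *)
pose G := [set y | v t (F y) = v s y].
have mG : measurable G.
  by apply: measurable_eq_rV; [apply: measurableT_comp => //|]; exact: measurable_grad.
have FT : \forall x \ae mu 0, F (Tt s x) = Tt t x.
  by apply: filterS (vel_interp DR s01) => x vx; rewrite /F vx (interp_shift T s t).
have GT : \forall x \ae mu 0, G (Tt s x).
  by apply: filterS3 FT (vel_interp DR s01) (vel_interp DR t01) => x Fx vs vt; rewrite /G /= Fx vs vt.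
have /choice[N NP] (j : 'I_n) := ae_directional_accumulation ('e j) mG.
have NN : \forall x \ae mu 0, forall j, ~ N j (Tt s x).
  apply: (@filter_forall _ _ _ _ _ _) => j.
  by have [mN N0 _] := NP j; exact: (ae_interp_null DR (itv_cc s01)).
apply: filterS3 FT GT NN => x FE Gx Nx; rewrite -FE; move: (Tt s x) Gx Nx => y Gy Ny.
apply/matrixP => j i.
have dFk k : is_derive (0 : R) 1 (fun h : R => F (y + h *: 'e j) 0 k : R)
    ((j == k)%:R + tau * hess (theta s) y j k).
  rewrite (_ : (fun h : R => _) = (fun h : R => (y + h *: 'e j) 0 k) + (fun h : R => tau *: ('d_k (theta s) (y + h *: 'e j) : R^o))); last first.
    by apply/funext => h; rewrite /F !fctE !mxE.
  apply: is_deriveD; [exact: derive_coord_line|apply: is_deriveZ; exact: hess_line].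
have d1 := C1_chain (smooth_derive ('e i) st 1%N) dFk.
have d2 := is_deriveB d1 (hess_line y i j ss).
have q0 : v t (F y) 0 i - v s y 0 i = 0 by rewrite Gy subrr.
have [_ _ acc] := NP j.
have := derive0_of_accumulating_zeros d2 _ _; rewrite !fctE scale0r addr0.
move=> h; apply/eqP; rewrite -subr_eq0 -[X in _ == X]h.
- rewrite mulmx_addZ_entry; apply/eqP; congr (_ - _); apply: eq_bigr => k _.
  by congr (_ * _); rewrite /hess mxE.
- by move: q0; rewrite !mxE.
- move=> d d0; have [e [e0 ed Ge]] := acc _ Gy (Ny j) d d0.
  by exists e; split => //; move: Ge => /rowP/(_ i); rewrite !mxE => ->; rewrite subrr.
Qed.

End hessian.

(** * Oddness of the velocity and the Poincare inequality *)

Section square_integrable.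
Context d (T : measurableType d) (R : realType) (m : {finite_measure set T -> \bar R}).
Local Notation integ f := (m.-integrable setT (EFin \o f)).
Implicit Types f g : T -> R.

Definition sqint f := measurable_fun setT f /\ integ (fun x => f x ^+ 2).

Lemma integ_cst (c : R) : integ (fun _ => c).
Proof. exact: finite_measure_integrable_cst. Qed.

Lemma integ_bounded f (L : R) : measurable_fun setT f -> (\forall x \ae m, `|f x| <= L) -> integ f.
Proof. by move=> mf; exact: integ_ae_le (integ_cst L). Qed.

Lemma sqint_le f g : measurable_fun setT f -> sqint g -> (\forall x \ae m, `|f x| <= `|g x|) -> sqint f.
Proof.
move=> mf [mg ig] fg; split => //; apply: integ_ae_le ig _.
  exact: measurable_funX.
apply: filterS fg => x fg; rewrite ger0_norm ?sqr_ge0//.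
by rewrite -[f x ^+ 2]real_normK ?num_real// -[g x ^+ 2]real_normK ?num_real// lerXn2r ?nnegrE.
Qed.

Lemma sqintD f g : sqint f -> sqint g -> sqint (fun x => f x + g x).
Proof.
move=> [mf If] [mg Ig]; have mfg : measurable_fun setT (fun x => f x + g x) by exact: measurable_funD.
split => //; apply: (@integ_ae_le _ _ _ _ _ (fun x => 2 * f x ^+ 2 + 2 * g x ^+ 2)).
- exact: measurable_funX.
- by apply: integD; exact: integZ.
- apply: filterE => x; rewrite ger0_norm ?sqr_ge0//.
  by move: (f x) (g x) => a b; have := sqr_ge0 (a - b); rewrite !expr2; nra.
Qed.

Lemma sqintZ (c : R) f : sqint f -> sqint (fun x => c * f x).
Proof.
move=> [mf If]; split; first exact: measurable_funM.
rewrite (_ : (fun x => _) = (fun x => c ^+ 2 * f x ^+ 2)); first exact: integZ.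
by apply/funext => x; rewrite exprMn.
Qed.

Lemma sqintB f g : sqint f -> sqint g -> sqint (fun x => f x - g x).
Proof.
move=> If Ig; rewrite (_ : (fun x => _) = (fun x => f x + -1 * g x)).
  by apply: sqintD => //; exact: sqintZ.
by apply/funext => x; rewrite mulN1r.
Qed.

Lemma sqint_bounded f (L : R) : measurable_fun setT f -> (\forall x \ae m, `|f x| <= L) -> sqint f.
Proof.
move=> mf fL; apply: (@sqint_le _ (fun _ => L)) => //.
  by split; [exact: measurable_cst|exact: integ_cst].
by apply: filterS fL => x /le_trans -> //; exact: ler_norm.
Qed.

Lemma integ_sqM f g : sqint f -> sqint g -> integ (fun x => f x * g x).
Proof.
move=> [mf If] [mg Ig]; apply: (@integ_ae_le _ _ _ _ _ (fun x => f x ^+ 2 + g x ^+ 2)).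
- exact: measurable_funM.
- exact: integD.
- apply: filterE => x; move: (f x) (g x) => a b; rewrite ler_norml.
  by have := sqr_ge0 (a - b); have := sqr_ge0 (a + b); rewrite !expr2 => *; apply/andP; split; nra.
Qed.

Lemma sqint_integ f : sqint f -> integ f.
Proof.
move=> sf; have s1 : sqint (fun _ => 1) by split; [exact: measurable_cst|exact: integ_cst].
have := integ_sqM sf s1; rewrite (_ : (fun x => f x * 1) = f)//.
by apply/funext => x; rewrite mulr1.
Qed.

Lemma Rintegral_dominated (f_ : nat -> T -> R) f g :
  (forall k, measurable_fun setT (f_ k)) -> measurable_fun setT f ->
  (forall x, f_ k x @[k --> \oo] --> (f x : R)) -> integ g ->
  (\forall x \ae m, forall k, `|f_ k x| <= g x) ->
  (\int[m]_x f_ k x : R) @[k --> \oo] --> (\int[m]_x f x : R).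
Proof.
move=> mf_ mf cf ig fg.
have [] := @dominated_convergence _ _ _ m setT measurableT (fun k => EFin \o f_ k) (EFin \o f) (EFin \o g).
- by move=> k; exact/measurable_EFinP.
- exact/measurable_EFinP.
- by apply: filterE => x _; apply: cvg_EFin; [exact: filterE|exact: cf].
- exact: ig.
- by apply: filterS fg => x h k _ /=; rewrite lee_fin; exact: h.
move=> If _ c; apply: (fine_cvg (f := fun k => (\int[m]_x (f_ k x)%:E)%E)).
by rewrite /Rintegral fineK//; exact: integrable_fin_num.
Qed.

Lemma Rintegral_ge0_eq0 f : measurable_fun setT f -> (forall x, 0 <= f x) -> integ f ->
  \int[m]_x f x = 0 -> \forall x \ae m, f x = 0.
Proof.
move=> mf f0 If I0.
have /ae_eq_integral_abs h : measurable_fun setT (EFin \o f) by exact/measurable_EFinP.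
have := (h m measurableT).1; rewrite /ae_eq => H1.
have : (\int[m]_x `|(EFin \o f) x| = 0)%E.
  rewrite -[LHS](@fineK _ _ (integrable_fin_num measurableT (integrable_abse If))).
  rewrite (_ : fine _ = 0)//; rewrite -I0 /Rintegral; congr fine; apply: eq_integral => x _.
  by rewrite /= ger0_norm.
by move=> /H1; apply: filterS => x /(_ I)[].
Qed.

End square_integrable.

Lemma norm_damped (R : realDomainType) (a b c e : R) : 0 <= a -> a <= 1 -> 0 <= c -> c <= 1 ->
  `|a * b * c * e| <= `|b * e|.
Proof.
move=> a0 a1 c0 c1; rewrite -[_ * c * e]mulrA mulrACA normrM ler_piMl// ger0_norm ?mulr_ge0//.
by rewrite mulr_ile1.
Qed.

Lemma cvg_seq_sum (R : realType) I (r : seq I) (f_ : I -> nat -> R) (l : I -> R) :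
  (forall i, f_ i k @[k --> \oo] --> l i) ->
  (\sum_(i <- r) f_ i k) @[k --> \oo] --> \sum_(i <- r) l i.
Proof.
move=> cf; elim: r => [|i r IH].
  by rewrite big_nil; under eq_fun do rewrite big_nil; exact: cvg_cst.
by rewrite big_cons; under eq_fun do rewrite big_cons; apply: cvgD.
Qed.

Lemma cvg_derive_cutoff (R : realType) n (x : 'rV[R]_n) i :
  'D_(delta_mx 0 i) (cutoff k) x @[k --> \oo] --> (0 : R).
Proof.
have [C C0 CP] := derive_cutoff_le (R := R) (n := n).
have cv : (C * harmonic k) @[k --> \oo] --> (0 : R).
  by rewrite -[X in _ --> X](mulr0 C); apply: cvgMl_tmp; exact: cvg_harmonic.
apply: (@squeeze_cvgr _ _ _ _ (fun k => - (C * harmonic k)) (fun k => C * harmonic k)) => //.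
  by apply: filterE => k; have := CP k x i; rewrite ler_norml.
by rewrite -oppr0; exact: cvgN.
Qed.

Section even_odd.
Context {R : realType} {n : nat}.
Local Notation Rn := 'rV[R]_n.
Local Notation "''d_' i f" := ('D_(delta_mx 0 i) f) (at level 10, i at level 2, f at level 9).
Variable m : probability Rn R.
Hypothesis em : even_measure m.

Lemma measurable_rV_opp : measurable_fun setT (fun x : Rn => - x).
Proof.
by rewrite (_ : (fun x => _) = (fun x : Rn => -1 *: x)); [exact: measurable_fun_rVZ|apply/funext => x; rewrite scaleN1r].
Qed.

Let mE A : measurable A -> m A = m ((fun x : Rn => - x) @^-1` A).
Proof. exact: em. Qed.

Lemma even_sqint (f : Rn -> R) : sqint m f -> sqint m (fun x => f (- x)).
Proof.
move=> [mf If]; split; first exact: measurableT_comp measurable_rV_opp.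
exact: (integ_image measurable_rV_opp mE (measurable_funX 2 mf)).1.
Qed.

Lemma odd_Rintegral (f : Rn -> R) : measurable_fun setT f ->
  m.-integrable setT (EFin \o f) -> (forall x, f (- x) = - f x) -> \int[m]_x f x = 0.
Proof.
move=> mf If of_; have := Rintegral_image measurable_rV_opp mE If.
under [X in _ = X]eq_Rintegral do rewrite of_.
rewrite (_ : \int[m]_x - f x = - \int[m]_x f x) => [|]; first lra.
under eq_Rintegral do rewrite -mulN1r.
by rewrite RintegralZl// mulN1r.
Qed.

Variable theta : Rn -> R^o.
Hypothesis stheta : smooth_on setT theta.
Hypothesis L2 : forall i, sqint m ('d_i theta).

(** Its gradient is the even part of the velocity, the part to be shown null. *)
Definition odd_part : Rn -> R^o := fun x => 2^-1 * (theta x - theta (- x)).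

Lemma odd_partN x : odd_part (- x) = - odd_part x.
Proof. by rewrite /odd_part opprK -mulrN opprB. Qed.

Lemma smooth_odd_part : smooth_on setT odd_part.
Proof.
move=> k; apply: Ck_onZ.
rewrite (_ : (fun x => _) = theta + (fun x => -1 * theta (- x))).
  by apply: Ck_onD => //; apply: Ck_onZ; exact: Ck_on_opp_arg.
by apply/funext => x; rewrite !fctE mulN1r.
Qed.

Lemma derive_odd_part w x : 'D_w odd_part x = 2^-1 * ('D_w theta x + 'D_w theta (- x)).
Proof.
have d1 : is_derive x w theta ('D_w theta x) by apply: DeriveDef => //; exact: Ck_on_derivable (stheta 1%N).
have d2 := derive_opp_arg (Ck_on_derivable (x := - x) (v := w) (stheta 1%N)).
have := is_deriveZ (2^-1) (is_deriveB d1 d2) => -[_ dE].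
move: dE; rewrite opprK; exact.
Qed.

(** In the limit of the cutoffs the test functions give int w <grad odd_part, grad theta> = 0 with w
    = 1 / (1 + odd_part^2). Replacing grad theta by grad odd_part changes the integrand by an odd
    function, so int w |grad odd_part|^2 = 0. *)
Lemma odd_part_gradient_eq0 :
  (forall phi : Rn -> R^o, test_function setT phi -> (forall x, phi (- x) = - phi x) ->
    \int[m]_x dot (grad phi x) (grad theta x) = 0) ->
  \forall x \ae m, forall i, 'd_i odd_part x = 0.
Proof.
move=> Hodd.
have so := smooth_odd_part.
have mo : measurable_fun setT odd_part by exact: smooth_measurable.
have mdo i : measurable_fun setT ('d_i odd_part) by apply: smooth_measurable; exact: smooth_derive.
have mdt i : measurable_fun setT ('d_i theta) by apply: smooth_measurable; exact: smooth_derive.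
pose w x : R := (1 + odd_part x ^+ 2)^-1.
have w0 x : 0 < w x by rewrite invr_gt0 ltr_pwDl// sqr_ge0.
have w1 x : w x <= 1 by rewrite invf_le1 ?ltr_pwDl ?sqr_ge0// lerDl sqr_ge0.
have mw : measurable_fun setT w.
  apply: smooth_measurable => k.
  have := Ck_on_derive (1 : R) (smooth_atan (R := R) k.+1).
  move=> /Ck_on_comp/(_ (so k)); rewrite (_ : (fun x => _) = w)//; apply/funext => x.
  by have [_ ->] := is_derive1_atan (odd_part x).
have sdo i : sqint m ('d_i odd_part).
  rewrite (_ : 'd_i odd_part = (fun x => 2^-1 * ('d_i theta x + 'd_i theta (- x)))).
    by apply: sqintZ; apply: sqintD => //; exact: even_sqint (L2 i).
  by apply/funext => x; rewrite derive_odd_part.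
pose phi k : Rn -> R^o := fun x => atan (odd_part x) * cutoff k x.
have satan : smooth_on setT (fun x => atan (odd_part x) : R^o).
  by move=> k; exact: Ck_on_comp (smooth_atan k) (so k).
have tphi k : test_function setT (phi k) by exact: smooth_test_cutoff.
have ophi k x : phi k (- x) = - phi k x by rewrite /phi odd_partN atanN cutoffN mulNr.
have dphi k x i : 'd_i (phi k) x = w x * 'd_i odd_part x * cutoff k x + atan (odd_part x) * 'd_i (cutoff k) x.
  have d1 := is_derive_comp_dir (x := x) (v := delta_mx 0 i)
    (Ck_on_derivable (x := odd_part x) (v := 1) (smooth_atan 1%N)) (Ck_on_derivable (so 1%N)).
  have d2 : is_derive x (delta_mx 0 i) (cutoff k) ('d_i (cutoff k) x).
    by apply: DeriveDef => //; exact: Ck_on_derivable (smooth_cutoff k 1%N).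
  have [_ e] := is_deriveM d1 d2; apply: (etrans e); rewrite addrC.
  have [_ ->] := is_derive1_atan (odd_part x).
  by rewrite -![_ *: _]/(_ * _); congr (_ + _); rewrite mulrC.
have [C C0 CP] := derive_cutoff_le (R := R) (n := n).
have int0 : \int[m]_x (\sum_i w x * 'd_i odd_part x * 'd_i theta x) = 0.
  have mint k : measurable_fun setT (fun x => \sum_i 'd_i (phi k) x * 'd_i theta x).
    apply: measurable_sum => i; apply: measurable_funM => //.
    by apply: smooth_measurable; apply: smooth_derive; case: (tphi k).
  (* The dominating function is independent of k: the arctangent is bounded by pi, and the
     derivatives of the cutoffs by C / (k+1) <= C. *)
  have cvgI := @Rintegral_dominated _ _ _ m (fun k x => \sum_i 'd_i (phi k) x * 'd_i theta x)
    (fun x => \sum_i w x * 'd_i odd_part x * 'd_i theta x)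
    (fun x => \sum_i (`|'d_i odd_part x * 'd_i theta x| + (pi * C) * `|'d_i theta x|)) mint.
  have zero k : \int[m]_x (\sum_i 'd_i (phi k) x * 'd_i theta x) = 0.
    rewrite -[RHS](Hodd _ (tphi k) (ophi k)); apply: eq_Rintegral => x _.
    by rewrite /dot; apply: eq_bigr => i _; rewrite !mxE.
  have cvg0 : (fun k => \int[m]_x (\sum_i 'd_i (phi k) x * 'd_i theta x)) = (fun k => 0).
    by apply/funext.
  rewrite cvg0 in cvgI; apply: (cvg_unique _ (cvgI _ _ _ _) (@cvg_cst _ _ _ _ _)) => //.
  - apply: measurable_sum => i; apply: measurable_funM => //; exact: measurable_funM.
  - move=> x; apply: cvg_seq_sum => i; apply: cvgMr_tmp.
    rewrite -[X in _ --> X]mulr1 -[X in _ --> X]addr0 -[X in _ --> _ + X](mulr0 (atan (odd_part x))).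
    rewrite (_ : (fun k => _) = (fun k => w x * 'd_i odd_part x * cutoff k x + atan (odd_part x) * 'd_i (cutoff k) x)).
      by apply: cvgD; apply: cvgMl_tmp; [exact: cvg_cutoff|exact: cvg_derive_cutoff].
    by apply/funext => k; rewrite dphi.
  - apply: integ_sum => i; apply: integD; first by apply: integrable_norm; exact: integ_sqM.
    by apply: integZ; apply: integrable_norm; exact: sqint_integ.
  - apply: filterE => x k; apply: (le_trans (ler_norm_sum _ _ _)); apply: ler_sum => i _.
    rewrite dphi mulrDl; apply: (le_trans (ler_normD _ _)); apply: lerD.
      by apply: norm_damped; rewrite ?cutoff_ge0 ?cutoff_le1// ltW.
    rewrite normrM ler_wpM2r// normrM ler_pM//.
      rewrite ler_norml; apply/andP; split; apply: ltW.
        by apply: lt_trans (atan_gtNpi2 _); rewrite ltrN2 ltr_pdivrMr// ltr_pMr ?pi_gt0// ltr1n.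
      by apply: (lt_trans (atan_ltpi2 _)); rewrite ltr_pdivrMr// ltr_pMr ?pi_gt0// ltr1n.
    by apply: (le_trans (CP k x i)); rewrite ler_pdivrMr// ler_peMr// ler1n.
(* The odd part of the velocity, orthogonal to the even field w grad odd_part. *)
pose g i x := 'd_i theta x - 'd_i odd_part x.
have godd i x : g i (- x) = - g i x.
  rewrite /g !derive_odd_part opprK; move: ('D__ theta _) ('D__ theta _) => a b; lra.
have deven i x : 'd_i odd_part (- x) = 'd_i odd_part x.
  by rewrite !derive_odd_part opprK addrC.
have weven x : w (- x) = w x by rewrite /w odd_partN sqrrN.
have mg i : measurable_fun setT (g i) by exact: measurable_funB.
have sg i : sqint m (g i) by exact: sqintB.
have swd i : sqint m (fun x => w x * 'd_i odd_part x).
  apply: (sqint_le _ (sdo i)); first exact: measurable_funM.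
  by apply: filterE => x; rewrite normrM ler_piMl// gtr0_norm.
have igo : \int[m]_x (\sum_i w x * 'd_i odd_part x * g i x) = 0.
  apply: odd_Rintegral.
  - by apply: measurable_sum => i; apply: measurable_funM => //; exact: measurable_funM.
  - by apply: integ_sum => i; exact: integ_sqM.
  - by move=> x; rewrite -sumrN; apply: eq_bigr => i _; rewrite weven deven godd mulrN.
have Isq : \int[m]_x (\sum_i w x * 'd_i odd_part x ^+ 2) = 0.
  rewrite -[RHS]subr0 -[X in X - _]int0 -[X in _ - X]igo -RintegralB//.
  - apply: eq_Rintegral => x _; rewrite -sumrB; apply: eq_bigr => i _.
    by rewrite /g; move: (w x) ('D__ _ _) ('D__ _ _) => a b c; ring.
  - by apply: integ_sum => i; exact: integ_sqM.
  - by apply: integ_sum => i; exact: integ_sqM.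
have := Rintegral_ge0_eq0 _ _ _ Isq; move=> h.
have : \forall x \ae m, \sum_i w x * 'd_i odd_part x ^+ 2 = 0.
  apply: h.
  - by apply: measurable_sum => i; apply: measurable_funM => //; exact: measurable_funX.
  - by move=> x; apply: sumr_ge0 => i _; rewrite mulr_ge0 ?sqr_ge0// ltW.
  - apply: integ_sum => i; rewrite (_ : (fun x => _) = (fun x => w x * 'd_i odd_part x * 'd_i odd_part x)).
      exact: integ_sqM.
    by apply/funext => x; rewrite expr2 mulrA.
apply: filterS => x /eqP; rewrite psumr_eq0 => [/allP zero i|i _]; last by rewrite mulr_ge0 ?sqr_ge0// ltW.
have := zero i (mem_index_enum i); rewrite /= mulf_eq0 gt_eqF// sqrf_eq0 => /eqP//.
Qed.

End even_odd.

Lemma drop_zero_term (V : zmodType) (a h z y : V) : a = h - z - y -> z = 0 -> a = h - y.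
Proof. by move=> -> ->; rewrite subr0. Qed.

Section poincare.
Context {R : realType} {n : nat}.
Local Notation Rn := 'rV[R]_n.
Local Notation leb := (@lebesgue_rV R n).
Local Notation "''d_' i f" := ('D_(delta_mx 0 i) f) (at level 10, i at level 2, f at level 9).
Variable m : probability Rn R.

Lemma derive_cutoffM (g : Rn -> R^o) k x i : smooth_on setT g ->
  'd_i (fun y => g y * cutoff k y : R^o) x = 'd_i g x * cutoff k x + g x * 'd_i (cutoff k) x.
Proof.
move=> sg.
have d1 : is_derive x (delta_mx 0 i) g ('d_i g x).
  by apply: DeriveDef => //; exact: Ck_on_derivable (sg 1%N).
have d2 : is_derive x (delta_mx 0 i) (cutoff k) ('d_i (cutoff k) x).
  by apply: DeriveDef => //; exact: Ck_on_derivable (smooth_cutoff k 1%N).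
have [_ e] := is_deriveM d1 d2; apply: (etrans e); rewrite addrC.
by rewrite -![_ *: _]/(_ * _); congr (_ + _); rewrite mulrC.
Qed.

Lemma sqr_damped (a b c e C : R) : 0 <= c -> c <= 1 -> `|e| <= C ->
  (a * c + b * e) ^+ 2 <= 2 * a ^+ 2 + 2 * C ^+ 2 * b ^+ 2.
Proof.
move=> c0 c1 eC.
have h1 : (a * c + b * e) ^+ 2 <= 2 * (a * c) ^+ 2 + 2 * (b * e) ^+ 2.
  by move: (a * c) (b * e) => u w; have := sqr_ge0 (u - w); rewrite !expr2; nra.
apply: (le_trans h1); apply: lerD.
  by rewrite ler_wpM2l// exprMn ler_piMr ?sqr_ge0// expr2 mulr_ile1.
rewrite -mulrA ler_wpM2l// exprMn mulrC ler_wpM2r ?sqr_ge0//.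
rewrite -[e ^+ 2]real_normK ?num_real// lerXn2r ?nnegrE//.
exact: le_trans (normr_ge0 _) eC.
Qed.

(* Truncate g by the cutoffs and let their support exhaust R^n. *)
Lemma odd_poincare_sqint (g : Rn -> R^o) : odd_poincare1 m -> smooth_on setT g ->
  (forall x, g (- x) = - g x) -> sqint m g -> (forall i, sqint m ('d_i g)) ->
  \int[m]_x (g x ^+ 2) <= \int[m]_x (\sum_i 'd_i g x ^+ 2).
Proof.
move=> pm sg og qg qdg; have [C C0 CP] := derive_cutoff_le (R := R) (n := n).
have mg : measurable_fun setT g by exact: smooth_measurable.
have mdg i : measurable_fun setT ('d_i g) by apply: smooth_measurable; exact: smooth_derive.
have mc k : measurable_fun setT (@cutoff R n k).
  by apply: smooth_measurable => j; exact: smooth_cutoff.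
have mdc k i : measurable_fun setT ('d_i (@cutoff R n k)).
  by apply: smooth_measurable; apply: smooth_derive => j; exact: smooth_cutoff.
pose l k x := (g x * cutoff k x) ^+ 2.
pose r k x := \sum_i ('d_i g x * cutoff k x + g x * 'd_i (cutoff k) x) ^+ 2.
have ml k : measurable_fun setT (l k) by apply: measurable_funX; exact: measurable_funM.
have mr k : measurable_fun setT (r k).
  by apply: measurable_sum => i; apply: measurable_funX; apply: measurable_funD; exact: measurable_funM.
pose gl x := g x ^+ 2.
pose gr x := \sum_i (2 * 'd_i g x ^+ 2 + 2 * C ^+ 2 * g x ^+ 2).
have igl : m.-integrable setT (EFin \o gl) by case: qg.
have igr : m.-integrable setT (EFin \o gr).
  by apply: integ_sum => i; apply: integD; apply: integZ; [case: (qdg i)|case: qg].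
have lb k x : `|l k x| <= gl x.
  rewrite ger0_norm ?sqr_ge0// /l exprMn ler_piMr ?sqr_ge0// expr2.
  by rewrite mulr_ile1 ?cutoff_ge0 ?cutoff_le1.
have rb k x : `|r k x| <= gr x.
  rewrite ger0_norm; last by apply: sumr_ge0 => i _; exact: sqr_ge0.
  apply: ler_sum => i _; apply: sqr_damped; rewrite ?cutoff_ge0 ?cutoff_le1//.
  by apply: (le_trans (CP k x i)); rewrite ler_pdivrMr// ler_peMr// ler1n.
have il k : m.-integrable setT (EFin \o l k) by apply: integ_ae_le igl _ => //; exact: filterE.
have ir k : m.-integrable setT (EFin \o r k) by apply: integ_ae_le igr _ => //; exact: filterE.
have lr k : \int[m]_x l k x <= \int[m]_x r k x.
  rewrite /Rintegral; apply: fine_le (integrable_fin_num measurableT (il k)) (integrable_fin_num measurableT (ir k)) _.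
  have o x : g (- x) * cutoff k (- x) = - (g x * cutoff k x) by rewrite og cutoffN mulNr.
  have := pm _ (smooth_test_cutoff k sg) o.
  rewrite (_ : (\int[m]_x (sqnorm (grad _ x))%:E = \int[m]_x (r k x)%:E)%E)//.
  apply: eq_integral => x _; congr EFin; apply: eq_bigr => i _.
  by rewrite mxE derive_cutoffM// expr2.
have cl : (\int[m]_x l k x) @[k --> \oo] --> (\int[m]_x gl x : R).
  apply: (Rintegral_dominated ml _ _ igl); [exact: measurable_funX| |exact: filterE].
  move=> x; rewrite /l -[X in _ --> X]mulr1 -(expr1n R 2); under eq_fun do rewrite exprMn.
  by apply: cvgMl_tmp; apply: cvgM; exact: cvg_cutoff.
have cr : (\int[m]_x r k x) @[k --> \oo] --> (\int[m]_x (\sum_i 'd_i g x ^+ 2) : R).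
  apply: (Rintegral_dominated mr _ _ igr); [|move=> x|exact: filterE].
    by apply: measurable_sum => i; exact: measurable_funX.
  apply: cvg_seq_sum => i.
  have c : ('d_i g x * cutoff k x + g x * 'd_i (cutoff k) x) @[k --> \oo] --> 'd_i g x.
    rewrite -[X in _ --> X]mulr1 -[X in _ --> X]addr0 -[X in _ --> _ + X](mulr0 (g x)).
    by apply: cvgD; apply: cvgMl_tmp; [exact: cvg_cutoff|exact: cvg_derive_cutoff].
  exact: (cvgM c c).
exact: (ler_cvg_to cl cr (filterE _ lr)).
Qed.

Hypothesis mleb : forall N, measurable N -> leb N = 0%E -> m N = 0%E.

(** The gradient vanishes on a set of full measure only, so its derivatives are computed along
    accumulating points of that set. *)
Lemma hess_ae_eq0 (f : Rn -> R^o) : smooth_on setT f ->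
  (\forall x \ae m, forall i, 'd_i f x = 0) -> \forall x \ae m, forall i j, hess f x i j = 0.
Proof.
move=> sf f0; pose G := [set x : Rn | grad f x = 0].
have mG : measurable G by apply: measurable_eq_rV => //; exact: measurable_grad.
have GT : \forall x \ae m, G x.
  by apply: filterS f0 => x h; apply/rowP => i; rewrite !mxE.
have /choice[N NP] (j : 'I_n) := ae_directional_accumulation (delta_mx 0 j) mG.
have NN : \forall x \ae m, forall j, ~ N j x.
  apply: (@filter_forall _ _ _ _ _ _) => j.
  by have [mN N0 _] := NP j; exact: (ae_of_null mN (mleb mN N0)).
apply: filterS2 GT NN => x Gx Nx i j.
apply: (derive0_of_accumulating_zeros (hess_line x j i sf)).
  by rewrite scale0r addr0; move: Gx => /rowP/(_ j); rewrite !mxE.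
move=> d d0; have [_ _ acc] := NP i; have [h [h0 hd Gh]] := acc _ Gx (Nx i) d d0.
by exists h; split => //; move: Gh => /rowP/(_ j); rewrite !mxE.
Qed.

Hypothesis em : even_measure m.
Hypothesis pm : odd_poincare1 m.
Variable theta : Rn -> R^o.
Hypothesis stheta : smooth_on setT theta.
Hypothesis L2 : forall i, sqint m ('d_i theta).
Hypothesis M2 : forall i, sqint m (fun x : Rn => x 0 i).
Hypothesis odd0 : \forall x \ae m, forall i, 'd_i (odd_part theta) x = 0.
Variable L : R.
Hypothesis hessL : \forall x \ae m, forall i j, `|hess theta x i j| <= L.

Lemma odd_poincare_gradient (c : R) :
  \int[m]_x (\sum_i ('d_i theta x - c * x 0 i) ^+ 2) <=
  \int[m]_x (\sum_i \sum_j (hess theta x j i - c * (i == j)%:R) ^+ 2).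
Proof.
have so := smooth_odd_part stheta.
have h0 := hess_ae_eq0 so odd0.
have mh i j : measurable_fun setT (fun x => hess theta x j i) by exact: measurable_hess.
have qh i j : sqint m (fun x => hess theta x j i - c * (i == j)%:R).
  apply: sqintB; first by apply: (@sqint_bounded _ _ _ _ _ L) => //; apply: filterS hessL => x; exact.
  by split; [exact: measurable_cst|exact: integ_cst].
have qg i : sqint m (fun x => 'd_i theta x - c * x 0 i) by apply: sqintB => //; exact: sqintZ.
rewrite !Rintegral_sum => [|i|i]; [|by apply: integ_sum => j; case: (qh i j)|by case: (qg i)].
apply: ler_sum => i _.
(* The component d_i theta - c x_i is odd only almost everywhere. Subtracting d_i of the odd part
   makes it odd at every point, as the Poincare inequality demands, and alters neither it nor its
   first derivatives almost everywhere. *)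
pose g : Rn -> R^o := fun x => 'd_i theta x + ((-1) * 'd_i (odd_part theta) x + (- c) * x 0 i).
have sg : smooth_on setT g.
  move=> k; rewrite (_ : g = 'd_i theta + ((fun x => (-1) * 'd_i (odd_part theta) x) + (fun x => (- c) * x 0 i))).
    apply: Ck_onD; [exact: smooth_derive|apply: Ck_onD; apply: Ck_onZ].
      exact: smooth_derive.
    exact: smooth_coord.
  by apply/funext.
have dg j x : 'd_j g x = hess theta x j i - hess (odd_part theta) x j i - c * (i == j)%:R.
  have d1 : is_derive x (delta_mx 0 j) ('d_i theta) (hess theta x j i).
    by rewrite mxE; apply: DeriveDef => //; exact: Ck_on_derivable (smooth_derive _ stheta 1%N).
  have d2 : is_derive x (delta_mx 0 j) ('d_i (odd_part theta)) (hess (odd_part theta) x j i).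
    by rewrite mxE; apply: DeriveDef => //; exact: Ck_on_derivable (smooth_derive _ so 1%N).
  have d3 := is_derive_coord x (delta_mx 0 j) i.
  have [_ e] := is_deriveD d1 (is_deriveD (is_deriveZ (-1) d2) (is_deriveZ (- c) d3)).
  have dji : (delta_mx 0 j : Rn) 0 i = (i == j)%:R by rewrite mxE eqxx.
  rewrite dji in e; apply: (etrans e); rewrite -![_ *: _]/(_ * _).
  by rewrite mulN1r mulNr addrA.
have og x : g (- x) = - g x.
  rewrite /g !derive_odd_part// opprK mxE.
  by move: ('D__ _ _) ('D__ _ _) (x 0 i) => a b e; field.
have geq : \forall x \ae m, g x = 'd_i theta x - c * x 0 i.
  by apply: filterS odd0 => x /(_ i) e; rewrite /g e mulr0 add0r mulNr.
have dgeq j : \forall x \ae m, 'd_j g x = hess theta x j i - c * (i == j)%:R.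
  by apply: filterS h0 => x /(_ j i) e; exact: drop_zero_term (dg j x) e.
have qg' : sqint m g.
  by apply: (sqint_le (smooth_measurable sg) (qg i)); apply: filterS geq => x ->.
have qdg j : sqint m ('d_j g).
  apply: (sqint_le (smooth_measurable (smooth_derive _ sg)) (qh i j)).
  by apply: filterS (dgeq j) => x ->.
have := odd_poincare_sqint pm sg og qg' qdg.
rewrite (Rintegral_ae_eq (f := fun x => g x ^+ 2) (g := fun x => ('d_i theta x - c * x 0 i) ^+ 2)).
- rewrite (Rintegral_ae_eq (f := fun x => \sum_j 'd_j g x ^+ 2)
    (g := fun x => \sum_j (hess theta x j i - c * (i == j)%:R) ^+ 2)) //.
  + by apply: integ_sum => j; case: (qdg j).
  + by apply: integ_sum => j; case: (qh i j).
  + have dgall : \forall x \ae m, forall j, 'd_j g x = hess theta x j i - c * (i == j)%:R.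
      by apply: (@filter_forall _ _ _ _ _ _) => j; exact: dgeq.
    by apply: filterS dgall => x h; apply: eq_bigr => j _; rewrite h.
- by case: qg'.
- by case: (qg i).
- by apply: filterS geq => x ->.
Qed.

End poincare.

(** * The derivatives of the entropy *)

Lemma Rintegral_cst_prob d (T : measurableType d) (R : realType) (m : probability T R) (K : R) :
  \int[m]_x K = K.
Proof.
rewrite /Rintegral (integral_cst m measurableT).
have h := @probability_setT _ _ _ m; transitivity (fine (K%:E * 1)%E); last by rewrite mule1.
by congr (fine (_ * _)%E); exact: h.
Qed.

Lemma ae_bounded_Rintegral d (T : measurableType d) (R : realType) (m : probability T R) (f : T -> R) (K : R) :
  m.-integrable setT (EFin \o f) -> (\forall x \ae m, `|f x| <= K) -> `|\int[m]_x f x| <= K.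
Proof.
move=> If fK.
have IK := Rintegral_cst_prob m K.
have iK : m.-integrable setT (EFin \o (fun=> K)) by exact: integ_cst.
rewrite ler_norml; apply/andP; split.
- rewrite -IK -mulN1r -(RintegralZl _ measurableT iK); apply: ae_le_Rintegral => //.
    exact: integZ.
  by apply: filterS fK => x; rewrite mulN1r ler_norml => /andP[].
- rewrite -[leRHS]IK; apply: ae_le_Rintegral => //.
  by apply: filterS fK => x; rewrite ler_norml => /andP[].
Qed.

Lemma ae_image_inv d1 d2 (T1 : measurableType d1) (T2 : measurableType d2) (R : realType)
    (m1 : {measure set T1 -> \bar R}) (m2 : {measure set T2 -> \bar R}) (S : T1 -> T2) (P : T2 -> Prop) :
  measurable_fun setT S -> (forall A, measurable A -> m2 A = m1 (S @^-1` A)) ->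
  measurable [set y | P y] -> (\forall x \ae m1, P (S x)) -> \forall y \ae m2, P y.
Proof.
move=> mS m2E mP h; apply: (@ae_of_null _ _ _ m2 (~` [set y | P y])).
- exact: measurableC.
- rewrite m2E; last exact: measurableC.
  apply/negligibleP; first by apply: measurable_preimage => //; exact: measurableC.
  exact: h.
- by move=> y /= /contrapT.
Qed.

Section moments.
Context {R : realType} {n : nat}.
Local Notation Rn := 'rV[R]_n.
Local Notation leb := (@lebesgue_rV R n).
Local Notation "''d_' i f" := ('D_(delta_mx 0 i) f) (at level 10, i at level 2, f at level 9).
Variables (mu : R -> probability Rn R) (T : Rn -> Rn) (theta : R -> Rn -> R^o).
Hypothesis DR : driven mu T theta.
Local Notation v t := (grad (theta t)).
Local Notation Tt := (interp T).

Lemma measurable_coord i : measurable_fun setT (fun x : Rn => x 0 i).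
Proof. by apply: mx_continuous_measurable; exact: coord_continuous. Qed.

Lemma measurable_coord_comp (f : Rn -> Rn) i : measurable_fun setT f -> measurable_fun setT (fun x => f x 0 i).
Proof. by move/measurable_fun_rVP. Qed.

Lemma sqint_of_sqnorm (f : Rn -> Rn) i : measurable_fun setT f ->
  (\int[mu 0%R]_x (sqnorm (f x))%:E < +oo)%E -> sqint (mu 0) (fun x => f x 0 i).
Proof.
move=> mf foo; split; first exact: measurable_coord_comp.
have isq : (mu 0).-integrable setT (EFin \o (fun x => sqnorm (f x))).
  apply: integ_ge0_fin => // [|x]; last exact: sqnorm_ge0.
  exact: measurableT_comp measurable_sqnorm mf.
apply: integ_ae_le isq _.
  by apply: measurable_funX; exact: measurable_coord_comp.
apply: filterE => x; rewrite ger0_norm ?sqr_ge0// -[leLHS]real_normK ?num_real//.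
exact: coord_le_sqnorm.
Qed.

Lemma sqint_id i : sqint (mu 0) (fun x : Rn => x 0 i).
Proof.
apply: (@sqint_of_sqnorm id) => //.
have z : 0 <= (0 : R) <= 1 by rewrite lexx ler01.
by have [] := driven_ac DR z.
Qed.

(** This is the second moment of [mu 1], the image of [mu 0] by T. *)
Lemma sqint_T i : sqint (mu 0) (fun x => T x 0 i).
Proof.
have mT := driven_measurable_T DR.
apply: sqint_of_sqnorm => //.
have z : 0 <= (1 : R) <= 1 by rewrite lexx ler01.
have [+ _] := driven_ac DR z.
rewrite (ge0_integral_image mT (m1 := mu 0))//.
- by move=> A mA; have [[_ + _] _] := driven_interp DR; apply.
- by apply/measurable_EFinP; exact: measurable_sqnorm.
- by move=> x; rewrite lee_fin sqnorm_ge0.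
Qed.

Lemma sqint_disp i : sqint (mu 0) (fun x => (T x - x) 0 i).
Proof.
rewrite (_ : (fun x => _) = (fun x => T x 0 i - x 0 i)); last by apply/funext => x; rewrite !mxE.
by apply: sqintB; [exact: sqint_T|exact: sqint_id].
Qed.

Lemma sqint_interp t i : sqint (mu 0) (fun x => Tt t x 0 i).
Proof.
rewrite (_ : (fun x => _) = (fun x : Rn => x 0 i + t * (T x - x) 0 i)).
  by apply: sqintD; [exact: sqint_id|apply: sqintZ; exact: sqint_disp].
by apply/funext => x; rewrite interpE !mxE.
Qed.

Section slice.
Variable t : R.
Hypothesis t01 : 0 < t < 1.

Let mE A : measurable A -> mu t A = mu 0 (Tt t @^-1` A).
Proof. exact: (driven_image DR (itv_cc t01)). Qed.
Let mT := measurable_interp DR t.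
Let st := driven_smooth_slice DR t01.

Lemma sqint_image (f : Rn -> R) : measurable_fun setT f ->
  sqint (mu 0) (fun x => f (Tt t x)) -> sqint (mu t) f.
Proof.
move=> mf [_ If]; split => //.
exact: (integ_image mT mE (measurable_funX 2 mf)).2.
Qed.

Lemma sqint_coord_slice i : sqint (mu t) (fun x : Rn => x 0 i).
Proof. apply: sqint_image; [exact: measurable_coord|exact: sqint_interp]. Qed.

Lemma derive_interp_ae : \forall x \ae mu 0, forall i, 'd_i (theta t) (Tt t x) = (T x - x) 0 i.
Proof. by apply: filterS (vel_interp DR t01) => x /rowP h i; rewrite -h mxE. Qed.

Lemma measurable_derive i : measurable_fun setT ('d_i (theta t)).
Proof. by apply: smooth_measurable; exact: smooth_derive. Qed.

Lemma sqint_vel_slice i : sqint (mu t) ('d_i (theta t)).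
Proof.
apply: sqint_image; first exact: measurable_derive.
apply: (sqint_le _ (sqint_disp i)).
  exact: measurableT_comp (measurable_derive i) mT.
by apply: filterS derive_interp_ae => x ->.
Qed.

(** By evenness the integral of phi is zero at all interior times, so its time derivative in the
    continuity equation vanishes. *)
Lemma odd_test_integral (phi : Rn -> R^o) : test_function setT phi ->
  (forall x, phi (- x) = - phi x) -> \int[mu t]_x dot (grad phi x) (v t x) = 0.
Proof.
move=> tphi ophi; have D1 := driven_continuity DR t01 tphi.
have [sphi cphi _] := tphi.
have mphi : measurable_fun setT phi by exact: smooth_measurable.
have [M phiM] : exists M, forall x, `|phi x| <= M.
  have [S0|/set0P S0] := eqVneq (closure [set x | phi x != 0]) set0.
    exists 0 => x; rewrite normr_le0; apply: contrapT => /negP px.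
    by have : set0 x by rewrite -S0; exact: subset_closure.
  have cn : {within closure [set x | phi x != 0], continuous (fun x => `|phi x| : R)}.
    apply: continuous_subspaceT => x; apply: (@continuous_comp _ _ _ phi Num.norm).
      exact: Ck_on_continuous (sphi 0%N) x.
    exact: norm_continuous.
  have [c _ cM] := EVT_max_rV S0 cphi cn.
  exists `|phi c| => x; have [->|px] := eqVneq (phi x) 0; first by rewrite normr0.
  by apply: cM; rewrite inE; exact: subset_closure.
have int0 s : 0 < s < 1 -> \int[mu s]_x phi x = 0.
  move=> s01; apply: (odd_Rintegral (driven_even DR (itv_cc s01)) mphi _ ophi).
  by apply: (@integ_bounded _ _ _ _ _ M) => //; exact: filterE.
have D0 : is_derive (t : R^o) 1 (fun s => \int[mu s]_x phi x : R^o) 0.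
  have dc : is_derive (t : R^o) 1 (cst 0 : R^o -> R^o) 0 by exact: is_derive_cst.
  apply: near_eq_is_derive dc.
  have t01' : t \in `]0, 1[ by rewrite in_itv.
  apply: filterS (near_in_itvoo t01') => s; rewrite in_itv/= => s01.
  by rewrite int0.
by case: D1 => _ <-; case: D0.
Qed.

Definition hessT x := hess (theta t) (Tt t x).

Lemma driven_poincare_interp (L c : R) : (\forall x \ae mu 0, forall i j, `|hessT x i j| <= L) ->
  \int[mu 0]_x (\sum_i ((T x - x) 0 i - c * Tt t x 0 i) ^+ 2) <=
  \int[mu 0]_x (\sum_i \sum_j (hessT x j i - c * (i == j)%:R) ^+ 2).
Proof.
move=> hL.
have mh i j : measurable_fun setT (fun y => hess (theta t) y i j) by exact: measurable_hess.
have hL' : \forall x \ae mu t, forall i j, `|hess (theta t) x i j| <= L.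
  exact: (ae_image_inv mT mE (measurable_hess_le L st) hL).
have odd0 := odd_part_gradient_eq0 (driven_even DR (itv_cc t01)) st sqint_vel_slice odd_test_integral.
have := odd_poincare_gradient (fun N => driven_null (N := N) DR (itv_cc t01))
  (driven_poincare DR (itv_cc t01)) st sqint_vel_slice sqint_coord_slice odd0 hL' c.
have q1 i : sqint (mu t) (fun x => 'd_i (theta t) x - c * x 0 i).
  by apply: sqintB; [exact: sqint_vel_slice|apply: sqintZ; exact: sqint_coord_slice].
have q2 i j : sqint (mu t) (fun x => hess (theta t) x j i - c * (i == j)%:R).
  apply: sqintB; last by split; [exact: measurable_cst|exact: integ_cst].
  by apply: (@sqint_bounded _ _ _ _ _ L) => //; apply: filterS hL' => x; exact.
have i1 : (mu t).-integrable setT (EFin \o (fun x => \sum_i ('d_i (theta t) x - c * x 0 i) ^+ 2)).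
  by apply: integ_sum => i; case: (q1 i).
have i2 : (mu t).-integrable setT (EFin \o (fun x => \sum_i \sum_j (hess (theta t) x j i - c * (i == j)%:R) ^+ 2)).
  by apply: integ_sum => i; apply: integ_sum => j; case: (q2 i j).
rewrite (Rintegral_image mT mE i1) (Rintegral_image mT mE i2).
rewrite (_ : \int[mu 0]_x (\sum_i ((T x - x) 0 i - c * Tt t x 0 i) ^+ 2) =
   \int[mu 0]_x (\sum_i ('d_i (theta t) (Tt t x) - c * Tt t x 0 i) ^+ 2))//.
apply: Rintegral_ae_eq.
- apply: integ_sum => i; have [] // : sqint (mu 0) (fun x => (T x - x) 0 i - c * Tt t x 0 i).
  by apply: sqintB; [exact: sqint_disp|apply: sqintZ; exact: sqint_interp].
- exact: ((integ_image mT mE (integ_measurable i1)).1 i1).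
- by apply: filterS derive_interp_ae => x h; apply: eq_bigr => i _; rewrite h.
Qed.

End slice.
End moments.

(** * Matrix identities and entrywise estimates *)

Section matrix_bounds.
Context {R : realType} {n : nat}.
Implicit Types A B : 'M[R]_n.

Definition fnorm2 A : R := \sum_i \sum_j A j i ^+ 2.

Lemma fnorm2_sub_scalar A (c : R) :
  \sum_i \sum_j (A j i - c * (i == j)%:R) ^+ 2 = fnorm2 A - 2 * c * \tr A + n%:R * c ^+ 2.
Proof.
rewrite (eq_bigr (fun i => \sum_j A j i ^+ 2 + (- (2 * c) * A i i + c ^+ 2))).
  rewrite big_split/= big_split/= -mulr_sumr sumr_const card_ord [n%:R * _]mulr_natl addrA.
  by rewrite -!mulNr.
move=> i _; rewrite (eq_bigr (fun j => A j i ^+ 2 + (- (2 * c) * A j i + c ^+ 2) * (i == j)%:R)).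
  rewrite big_split/=; congr (_ + _).
  rewrite (bigD1 i)//= eqxx mulr1 big1 ?addr0// => j ji.
  by rewrite eq_sym (negbTE ji) mulr0.
by move=> j _; have [->|ij] := eqVneq i j; rewrite ?mulr1 ?mulr0; ring.
Qed.

Lemma mulmx_entry_le A B (a b : R) i j : (forall i j, `|A i j| <= a) ->
  (forall i j, `|B i j| <= b) -> `|(A *m B) i j| <= n%:R * (a * b).
Proof.
move=> Aa Bb; rewrite mxE (le_trans (ler_norm_sum _ _ _))//.
rewrite (le_trans (ler_sum _ (_ : forall k, _ -> _ <= a * b)))//.
  by move=> k _; rewrite normrM ler_pM.
by rewrite sumr_const card_ord mulr_natl.
Qed.

Lemma mxtrace_le A (a : R) : (forall i j, `|A i j| <= a) -> `|\tr A| <= n%:R * a.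
Proof.
move=> Aa; rewrite (le_trans (ler_norm_sum _ _ _))//.
rewrite (le_trans (ler_sum _ (_ : forall k, _ -> _ <= a)))//.
by rewrite sumr_const card_ord mulr_natl.
Qed.

Lemma mxtrace_sqr_sym A : A^T = A -> \tr (A *m A) = fnorm2 A.
Proof.
move=> sA; apply: eq_bigr => i _; rewrite mxE; apply: eq_bigr => j _.
by rewrite -{1}sA mxE expr2.
Qed.

End matrix_bounds.

(** Substitute B = A - c A B twice; the first-order term tr (A A) is the squared Frobenius norm by
    symmetry of A. *)
Lemma mxtrace_shift (R : realType) n (A B : 'M[R]_n) (c : R) : A^T = A -> B = A - c *: (A *m B) ->
  \tr B - \tr A = -1 * (c * fnorm2 A - c ^+ 2 * \tr (A *m A *m B)).
Proof.
move=> sA e.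
have e1 : \tr B = \tr A - c * \tr (A *m B) by rewrite {1}e linearB/= linearZ.
have e2 : \tr (A *m B) = fnorm2 A - c * \tr (A *m A *m B).
  by rewrite {1}e mulmxBr linearB/= mxtrace_sqr_sym// -scalemxAr linearZ/= mulmxA.
by rewrite e1 e2; ring.
Qed.

Lemma entry_shift_le (R : realType) n (A B : 'M[R]_n) (c L : R) i j : B = A - c *: (A *m B) ->
  (forall i j, `|A i j| <= L) -> (forall i j, `|B i j| <= L) ->
  `|B i j - A i j| <= `|c| * (n%:R * (L * L)).
Proof.
move=> e AL BL; have -> : B i j - A i j = - (c * (A *m B) i j).
  by rewrite {1}e mxE addrAC subrr add0r mxE [X in - X]mxE.
rewrite normrN normrM ler_wpM2l//.
exact: mulmx_entry_le.
Qed.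

Lemma sqr_shift_le (R : realType) (a b L K : R) : `|a| <= L -> `|b| <= L -> `|a - b| <= K ->
  `|a ^+ 2 - b ^+ 2| <= K * (2 * L).
Proof.
move=> aL bL abK; rewrite subr_sqr normrM ler_pM//.
by rewrite (le_trans (ler_normD _ _))// mulr_natl mulr2n lerD.
Qed.

Lemma mulmx_resolvent (R : realType) n (A B : 'M[R]_n) (c : R) :
  (1%:M + c *: A) *m B = A -> B = A - c *: (A *m B).
Proof. by rewrite mulmxDl mul1mx -scalemxAl => h; apply/eqP; rewrite eq_sym subr_eq; apply/eqP. Qed.

Section first_second_derivative.
Context {R : realType} {n : nat}.
Local Notation Rn := 'rV[R]_n.
Local Notation leb := (@lebesgue_rV R n).
Local Notation "''d_' i f" := ('D_(delta_mx 0 i) f) (at level 10, i at level 2, f at level 9).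
Variables (mu : R -> probability Rn R) (T : Rn -> Rn) (theta : R -> Rn -> R^o).
Hypothesis DR : driven mu T theta.
Local Notation v t := (grad (theta t)).
Local Notation Tt := (interp T).
Local Notation h t x := (hess (theta t) (interp T t x)).

Definition mean_sqdisp : R := \int[mu 0]_x sqnorm (T x - x).
Definition mean_tr t : R := \int[mu 0]_x \tr (h t x).
Definition mean_dot t : R := \int[mu 0]_x dot (Tt t x) (T x - x).
Definition mean_fnorm2 t : R := \int[mu 0]_x fnorm2 (h t x).

(* The first and second derivatives of the relative entropy. *)
Definition ent1 t := mean_dot t - mean_tr t.
Definition ent2 t := mean_fnorm2 t + mean_sqdisp.

Lemma hess_sym t x : 0 < t < 1 -> (hess (theta t) x)^T = hess (theta t) x.
Proof.
move=> t01; apply/matrixP => i j; rewrite !mxE.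
exact: C2_symmetric (driven_smooth_slice DR t01 2%N).
Qed.

Lemma measurable_hessT t i j : 0 < t < 1 -> measurable_fun setT (fun x => h t x i j).
Proof.
move=> t01; apply: (measurableT_comp (measurable_hess i j (driven_smooth_slice DR t01))).
exact: measurable_interp DR t.
Qed.

Lemma sqint_hess t i j L : 0 < t < 1 -> (\forall x \ae mu 0, forall i j, `|h t x i j| <= L) ->
  sqint (mu 0) (fun x => h t x i j).
Proof.
move=> t01 hL; apply: (@sqint_bounded _ _ _ _ _ L); first exact: measurable_hessT.
by apply: filterS hL => x; exact.
Qed.

Lemma hess_bounded t : 0 < t < 1 -> exists L, \forall x \ae mu 0, forall i j, `|h t x i j| <= L.
Proof.
move=> /andP[t0 t1]; pose al := Num.min t (1 - t).
have al0 : 0 < al by rewrite lt_min t0 subr_gt0.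
have [L _ hL] := hess_interp_bound DR al0; exists L; apply: hL.
by rewrite ge_min lexx/= lerBrDl -lerBrDr ge_min lexx orbT.
Qed.

Lemma integ_tr t : 0 < t < 1 -> (mu 0).-integrable setT (EFin \o (fun x => \tr (h t x))).
Proof.
move=> t01; have [L hL] := hess_bounded t01.
by apply: integ_sum => i; apply: sqint_integ; exact: sqint_hess hL.
Qed.

Lemma integ_fnorm2 t : 0 < t < 1 -> (mu 0).-integrable setT (EFin \o (fun x => fnorm2 (h t x))).
Proof.
move=> t01; have [L hL] := hess_bounded t01.
by apply: integ_sum => i; apply: integ_sum => j; case: (sqint_hess j i t01 hL).
Qed.

Lemma integ_dot t : (mu 0).-integrable setT (EFin \o (fun x => dot (Tt t x) (T x - x))).
Proof.
by apply: integ_sum => i; apply: integ_sqM; [exact: (sqint_interp DR)|exact: (sqint_disp DR)].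
Qed.

Lemma integ_sqdisp : (mu 0).-integrable setT (EFin \o (fun x => sqnorm (T x - x))).
Proof. by apply: integ_sum => i; apply: integ_sqM; exact: (sqint_disp DR). Qed.

Lemma integ_sqinterp t : (mu 0).-integrable setT (EFin \o (fun x => sqnorm (Tt t x))).
Proof. by apply: integ_sum => i; apply: integ_sqM; exact: (sqint_interp DR). Qed.

Lemma ent2_ge t : (0 < n)%N -> 0 < t < 1 -> 2 * mean_sqdisp + n%:R^-1 * ent1 t ^+ 2 <= ent2 t.
Proof.
move=> n0 t01; have [L hL] := hess_bounded t01.
pose c := - (n%:R^-1 * ent1 t).
have := driven_poincare_interp DR t01 c hL.
rewrite (_ : \int[mu 0]_x (\sum_i \sum_j _) = mean_fnorm2 t + (- (2 * c) * mean_tr t + n%:R * c ^+ 2)); last first.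
  transitivity (\int[mu 0]_x (fnorm2 (h t x) + (- (2 * c) * \tr (h t x) + n%:R * c ^+ 2))).
    by apply: eq_Rintegral => x _; rewrite fnorm2_sub_scalar mulNr addrA.
  have i1 := integ_fnorm2 t01; have i2 := integZ (- (2 * c)) (integ_tr t01).
  have i3 := integ_cst (mu 0) (n%:R * c ^+ 2).
  rewrite RintegralD//; last exact: integD.
  rewrite RintegralD// RintegralZl//; last exact: integ_tr.
  by rewrite Rintegral_cst_prob.
rewrite (_ : \int[mu 0]_x (\sum_i _) = mean_sqdisp + (- (2 * c) * mean_dot t + c ^+ 2 * \int[mu 0]_x sqnorm (Tt t x))); last first.
  transitivity (\int[mu 0]_x (sqnorm (T x - x) + (- (2 * c) * dot (Tt t x) (T x - x) + c ^+ 2 * sqnorm (Tt t x)))).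
    apply: eq_Rintegral => x _; rewrite /sqnorm /dot !mulr_sumr -!big_split/=.
    by apply: eq_bigr => i _; move: (_ 0 i) (_ 0 i) => a b; ring.
  have i1 := integ_sqdisp; have i2 := integZ (- (2 * c)) (integ_dot t).
  have i3 := integZ (c ^+ 2) (integ_sqinterp t).
  rewrite RintegralD//; last exact: integD.
  rewrite RintegralD// RintegralZl//; last exact: integ_dot.
  by rewrite RintegralZl//; exact: integ_sqinterp.
have m2 : 0 <= \int[mu 0]_x sqnorm (Tt t x) by apply: Rintegral_ge0 => x _; exact: sqnorm_ge0.
have nn : (n%:R : R) != 0 by rewrite pnatr_eq0 -lt0n.
rewrite /ent2; move: m2; move: (\int[mu 0]_x _) => m2 m20.
have aE : n%:R * c ^+ 2 = n%:R^-1 * ent1 t ^+ 2 by rewrite /c sqrrN exprMn; field.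
have cE : 2 * c * ent1 t = - 2 * (n%:R^-1 * ent1 t ^+ 2) by rewrite /c; ring.
move: aE cE; rewrite /ent1; move: (mean_fnorm2 t) (mean_tr t) (mean_dot t) mean_sqdisp => f r d w.
have := mulr_ge0 (sqr_ge0 c) m20.
move: (n%:R^-1 * _ ^+ 2) (n%:R * _ ^+ 2) (c ^+ 2 * m2) => p q m3; move: c => c.
move=> *; nra.
Qed.

(** T x - x is the velocity of the trajectory at all times, so only the position depends on t. *)
Lemma mean_dot_shift s t : mean_dot t = mean_dot s + (t - s) * mean_sqdisp.
Proof.
rewrite /mean_dot /mean_sqdisp -(RintegralZl _ measurableT integ_sqdisp) -RintegralD//.
- by apply: eq_Rintegral => x _; rewrite (interp_shift T s t) dotDl dotZl.
- exact: integ_dot.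
- exact: integZ integ_sqdisp.
Qed.

Lemma hess_shift s t : 0 < s < 1 -> 0 < t < 1 -> \forall x \ae mu 0,
  h t x = h s x - (t - s) *: (h s x *m h t x).
Proof.
move=> s01 t01; apply: filterS (hess_interp_chain DR s01 t01) => x.
exact: mulmx_resolvent.
Qed.

Lemma ent1_expand (al : R) : 0 < al -> exists2 C : R, 0 <= C & forall s t,
  al <= s <= 1 - al -> al <= t <= 1 - al -> 
  `|ent1 t - ent1 s - (t - s) * ent2 s| <= C * (t - s) ^+ 2 /\ `|ent2 t - ent2 s| <= C * `|t - s|.
Proof.
move=> al0; have [L L0 hL] := hess_interp_bound DR al0.
(* All entries being at most L, C1 bounds the trace of H_s H_s H_t, and |tau| C2 the change of |H|^2
   over a time tau. *)
pose C1 := n%:R * (n%:R * (n%:R * (L * L) * L)) : R.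
pose C2 := n%:R * (n%:R * ((n%:R * (L * L)) * (2 * L))) : R.
have C10 : 0 <= C1 by rewrite !mulr_ge0.
have C20 : 0 <= C2 by rewrite !mulr_ge0.
exists (C1 + C2); first exact: addr_ge0.
move=> s t sal tal; have s01 := itv_margin al0 sal; have t01 := itv_margin al0 tal.
have hs := hL _ sal; have ht := hL _ tal; have sh := hess_shift s01 t01.
set tau := t - s.
have mhh i j : measurable_fun setT (fun x => (h s x *m h s x *m h t x) i j).
  rewrite (_ : (fun x => _) = (fun x => \sum_k (\sum_l h s x i l * h s x l k) * h t x k j)).
    apply: measurable_sum => k; apply: measurable_funM; last exact: measurable_hessT.
    by apply: measurable_sum => l; apply: measurable_funM; exact: measurable_hessT.
  by apply/funext => x; rewrite mxE; apply: eq_bigr => k _; rewrite mxE.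
have bd3 : \forall x \ae mu 0, `|\tr (h s x *m h s x *m h t x)| <= C1.
  apply: filterS2 hs ht => x b1 b2; apply: mxtrace_le => i j.
  by apply: mulmx_entry_le => // k l; exact: mulmx_entry_le.
split.
- have itr3 : (mu 0).-integrable setT (EFin \o (fun x => \tr (h s x *m h s x *m h t x))).
    apply: (@integ_bounded _ _ _ _ _ C1); first exact: measurable_sum.
    exact: bd3.
  have itr : (mu 0).-integrable setT (EFin \o (fun x => tau * fnorm2 (h s x) - tau ^+ 2 * \tr (h s x *m h s x *m h t x))).
    by apply: integB; apply: integZ => //; exact: integ_fnorm2.
  have trE : mean_tr t - mean_tr s = - \int[mu 0]_x (tau * fnorm2 (h s x) - tau ^+ 2 * \tr (h s x *m h s x *m h t x)).
    rewrite /mean_tr -RintegralB//; [|exact: integ_tr|exact: integ_tr].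
    rewrite -[RHS]mulN1r -(RintegralZl _ measurableT itr).
    apply: Rintegral_ae_eq; [apply: integB; exact: integ_tr|exact: integZ|].
    apply: filterS sh => x e.
    exact: mxtrace_shift (hess_sym _ s01) e.
  have -> : ent1 t - ent1 s - tau * ent2 s = - \int[mu 0]_x (tau ^+ 2 * \tr (h s x *m h s x *m h t x)).
    rewrite /ent1 (mean_dot_shift s t) -/tau.
    move: trE; rewrite RintegralB//.
    + rewrite (RintegralZl _ measurableT (integ_fnorm2 s01)) -/(mean_fnorm2 s) /ent2.
      move: (mean_tr t) (mean_tr s) (mean_fnorm2 s) (mean_dot s) mean_sqdisp (\int[mu 0]_x _) => a b f d w q e.
      by move/eqP: e; rewrite subr_eq => /eqP ->; ring.
    + exact: integZ (integ_fnorm2 s01).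
    + exact: integZ itr3.
  rewrite normrN; apply: (@le_trans _ _ (tau ^+ 2 * C1)).
    apply: ae_bounded_Rintegral; first exact: integZ.
    by apply: filterS bd3 => x b; rewrite normrM ger0_norm ?sqr_ge0// ler_wpM2l ?sqr_ge0.
  by rewrite mulrC ler_wpM2r ?sqr_ge0// lerDl.
- have -> : ent2 t - ent2 s = \int[mu 0]_x (fnorm2 (h t x) - fnorm2 (h s x)).
    transitivity (mean_fnorm2 t - mean_fnorm2 s).
      by rewrite /ent2; move: (mean_fnorm2 t) (mean_fnorm2 s) mean_sqdisp => a b c; ring.
    exact: (esym (RintegralB measurableT (integ_fnorm2 t01) (integ_fnorm2 s01))).
  apply: (@le_trans _ _ (`|tau| * C2)); last by rewrite mulrC ler_wpM2r// lerDr.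
  apply: (ae_bounded_Rintegral (integB (integ_fnorm2 t01) (integ_fnorm2 s01))).
  apply: filterS3 hs ht sh => x b1 b2 e.
  rewrite /fnorm2 -sumrB (le_trans (ler_norm_sum _ _ _))//.
  have -> : `|tau| * C2 = \sum_(i < n) \sum_(j < n) (`|tau| * (n%:R * (L * L))) * (2 * L).
    rewrite !sumr_const card_ord -[_ *+ n *+ n]mulr_natl -[(_ * _) *+ n]mulr_natl /C2.
    by move: (n%:R : R) (`|tau|) => N u; ring.
  apply: ler_sum => i _; rewrite -sumrB (le_trans (ler_norm_sum _ _ _))//.
  apply: ler_sum => j _; exact: (sqr_shift_le (b2 j i) (b1 j i) (entry_shift_le j i e b1 b2)).
Qed.

End first_second_derivative.

(** * Variation of the entropy along the flow *)

(** The explicit bound also makes sense when n = 0, where there is no minimum. *)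
Lemma finite_pos_lower (R : realFieldType) n (f : 'I_n -> R) : (forall i, 0 < f i) ->
  exists2 d, 0 < d & forall i, d <= f i.
Proof.
move=> f0; have s0 : 0 < 1 + \sum_i (f i)^-1.
  by rewrite ltr_pwDl// sumr_ge0// => i _; rewrite invr_ge0 ltW.
exists (1 + \sum_i (f i)^-1)^-1; first by rewrite invr_gt0.
move=> i; rewrite -[leRHS]invrK lef_pV2 ?posrE ?invr_gt0//.
rewrite (bigD1 i)//= addrCA lerDl addr_ge0// sumr_ge0// => j _.
by rewrite invr_ge0 ltW.
Qed.

Lemma expR_sub1_le (R : realType) (z : R) : 0 <= z -> z <= 1 / 2 -> expR z - 1 <= 2 * z.
Proof.
move=> z0 z1; have h : 1 - z <= expR (- z) by have := expR_ge1Dx (- z).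
have e0 := expR_gt0 z; have : expR z * (1 - z) <= 1.
  have := ler_wpM2l (ltW e0) h; rewrite -expRD subrr expR0//.
by move: (expR z) e0 => u u0 ?; nra.
Qed.

(** * Matrices close to the identity *)

Section near_identity.
Context {R : realType} {n : nat}.
Variables (A : 'M[R]_n) (tau L : R).
Hypothesis L0 : 0 <= L.
Hypothesis AL : forall i j, `|A i j| <= L.
Hypothesis tauL : `|tau| * (n%:R * L) <= 1 / 2.
Local Notation Rn := 'rV[R]_n.

Lemma norm_mulmx_le (u : Rn) : `|u *m A| <= n%:R * L * `|u|.
Proof.
apply/rV_norm_leP => [|i]; first by rewrite !mulr_ge0.
rewrite mxE (le_trans (ler_norm_sum _ _ _))//.
rewrite (le_trans (ler_sum _ (_ : forall k, _ -> _ <= L * `|u|)))//.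
  by move=> k _; rewrite normrM mulrC ler_pM//; exact: coord_le_norm.
by rewrite sumr_const card_ord -[leLHS]mulr_natl mulrA.
Qed.

(** The perturbation removes at most half of |u|. This quantitative injectivity yields invertibility
    and the bound 2 for the inverse. *)
Lemma norm_near_id (u : Rn) : `|u| <= 2 * `|u *m (1%:M + tau *: A)|.
Proof.
have e : u = u *m (1%:M + tau *: A) - tau *: (u *m A).
  by rewrite mulmxDr mulmx1 -scalemxAr addrK.
have h1 : `|tau *: (u *m A)| <= 1 / 2 * `|u|.
  rewrite normrZ (le_trans (ler_wpM2l (normr_ge0 _) (norm_mulmx_le u)))//.
  by rewrite mulrA ler_wpM2r.
have : `|u| <= `|u *m (1%:M + tau *: A)| + `|tau *: (u *m A)|.
  by rewrite {1}e; exact: ler_normB.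
by move: h1; move: (`|tau *: _|) (`|u|) (`|u *m _|) => a b c ? ?; lra.
Qed.

Lemma unitmx_near_id : 1%:M + tau *: A \in unitmx.
Proof.
rewrite -row_free_unit -kermx_eq0; apply/eqP/row_matrixP => i; rewrite row0.
apply/eqP; rewrite -normr_le0; have := norm_near_id (row i (kermx (1%:M + tau *: A))).
by rewrite -row_mul mulmx_ker row0 normr0 mulr0.
Qed.

Lemma invmx_near_id_le (u : Rn) : `|u *m invmx (1%:M + tau *: A)| <= 2 * `|u|.
Proof.
have := norm_near_id (u *m invmx (1%:M + tau *: A)).
by rewrite mulmxKV//; exact: unitmx_near_id.
Qed.

Hypothesis tauL1 : `|tau| * L <= 1 / 2.

(* In the Leibniz formula the identity contributes at most exp(tau tr A), and
   every other permutation moves two indices, hence is O(tau^2). *)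
Lemma det_near_id : `|\det (1%:M + tau *: A)| <=
  expR ((n`!)%:R * 2 ^+ n * L ^+ 2 * expR 1 * tau ^+ 2) * expR (tau * \tr A).
Proof.
pose B := 1%:M + tau *: A.
have BE i j : B i j = (i == j)%:R + tau * A i j by rewrite !mxE.
have tA i j : `|tau * A i j| <= `|tau| * L by rewrite normrM ler_wpM2l.
have B2 i j : `|B i j| <= 2.
  rewrite BE (le_trans (ler_normD _ _))//; have := le_trans (tA i j) tauL1.
  by case: (i == j); rewrite ?normr1 ?normr0; move: (`|tau * _|) => z ?; lra.
pose K := (n`!)%:R * 2 ^+ n * L ^+ 2 * expR 1.
have id_le : `|\prod_i B i ((1%g : {perm 'I_n}) i)| <= expR (tau * \tr A).
  rewrite normr_prod /mxtrace mulr_sumr expR_sum; apply: ler_prod => i _.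
  rewrite normr_ge0/= perm1 BE eqxx ger0_norm ?expR_ge1Dx//.
  have := le_trans (tA i i) tauL1; rewrite ler_norml => /andP[+ _].
  by move: (tau * _) => z ?; rewrite mulr1n; lra.
have other_le (s : {perm 'I_n}) : s != 1%g -> `|\prod_i B i (s i)| <= 2 ^+ n * (`|tau| * L) ^+ 2.
  move=> s1; have /existsP[i si] : [exists i, s i != i].
    apply: contraR s1; rewrite negb_exists => /forallP h; apply/eqP/permP => i.
    by rewrite perm1; have := h i; rewrite negbK => /eqP.
  pose j := s i; have sj : s j != j by rewrite /j (inj_eq perm_inj).
  (* A permutation that moves i also moves j = s i, so the factors at i and j are off-diagonal, of
     size |tau| L. A factor 2 is kept at every index, although it is only needed at the others. *)
  pose c k : R := if (k == i) || (k == j) then `|tau| * L else 1.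
  have tL0 : 0 <= `|tau| * L by rewrite mulr_ge0.
  rewrite normr_prod (@le_trans _ _ (\prod_k (2 * c k)))//.
    apply: ler_prod => k _; rewrite normr_ge0/= /c.
    case: ifP => [kij|_]; last by rewrite mulr1.
    have ks : (k == s k) = false.
      by apply/negbTE; rewrite eq_sym; case/orP: kij => /eqP ->.
    by rewrite BE ks add0r (le_trans (tA _ _))// ler_peMl// ler1n.
  rewrite big_split/= prodr_const card_ord ler_wpM2l ?exprn_ge0//.
  rewrite (bigD1 i)//= (bigD1 j)//= /c !eqxx orbT/= big1 ?mulr1 ?expr2//.
  by move=> k /andP[/negbTE -> /negbTE ->].
have detB : `|\det B| <= expR (tau * \tr A) + (n`!)%:R * (2 ^+ n * (`|tau| * L) ^+ 2).
  rewrite /determinant (bigD1 (1%g : {perm 'I_n}))//= (le_trans (ler_normD _ _))// lerD//.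
    by rewrite normrM normrX normrN1 expr1n mul1r.
  rewrite (le_trans (ler_norm_sum _ _ _))//.
  rewrite (@le_trans _ _ (\sum_(s : {perm 'I_n} | s != 1%g) 2 ^+ n * (`|tau| * L) ^+ 2))//.
    by apply: ler_sum => s s1; rewrite normrM normrX normrN1 expr1n mul1r; exact: other_le.
  rewrite (@le_trans _ _ (\sum_(s : {perm 'I_n}) 2 ^+ n * (`|tau| * L) ^+ 2))//.
    rewrite [leRHS](bigD1 (1%g : {perm 'I_n}))//= lerDr.
    by rewrite mulr_ge0 ?exprn_ge0// mulr_ge0.
  by rewrite sumr_const -[leLHS]mulr_natl -card_Sn (_ : #|{perm 'I_n}| = #|'S_n|)//; apply: eq_card => s; rewrite inE.
apply: (le_trans detB).
have trl : - (tau * \tr A) <= 1.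
  rewrite lerNl; have : `|tau * \tr A| <= 1 / 2.
    rewrite normrM (le_trans _ tauL)// ler_wpM2l//; exact: mxtrace_le.
  by rewrite ler_norml => /andP[+ _]; move: (tau * _) => z ?; lra.
have K1 : 1 + K * tau ^+ 2 <= expR (K * tau ^+ 2) by exact: expR_ge1Dx.
rewrite -/K; apply: (le_trans _ (ler_wpM2r (expR_ge0 _) K1)).
rewrite mulrDl mul1r lerD2l /K exprMn real_normK ?num_real//.
(* Since tau tr A >= -1, the additive error is absorbed into a factor of exp (tau tr A), at the
   price of the [expR 1] in the constant. *)
have e1 : 1 <= expR 1 * expR (tau * \tr A).
  by rewrite -expRD -[leLHS]expR0 ler_expR -lerBlDr sub0r.
set E1 := expR 1 in e1 *; set E := expR _ in e1 *.
have -> : (n`!)%:R * 2 ^+ n * L ^+ 2 * E1 * tau ^+ 2 * E = (n`!)%:R * (2 ^+ n * (tau ^+ 2 * L ^+ 2)) * (E1 * E).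
  by move: (n`!%:R : R) (2 ^+ n : R) => a b; ring.
apply: ler_peMr e1; apply: mulr_ge0 => //; apply: mulr_ge0; first exact: exprn_ge0.
by apply: mulr_ge0; exact: sqr_ge0.
Qed.

End near_identity.

Section gauss_area.
Context {R : realType} {n : nat}.
Local Notation Rn := 'rV[R]_n.
Local Notation leb := (@lebesgue_rV R n).
Local Notation ga := (gauss_measure n).

(** Apply the Lebesgue inequality to h = p' times the Gaussian density, whose integral is 1. The
    Gaussian densities at S x and x have quotient exp ((|x|^2 - |S x|^2) / 2). *)
Lemma gauss_area (mu' : probability Rn R) (S : Rn -> Rn) (X : set Rn) (u : Rn -> R) (c : R) :
  mu' `<< ga -> measurable_fun setT S -> measurable X -> measurable_fun setT u ->
  (forall h : Rn -> \bar R, measurable_fun setT h -> (forall x, 0 <= h x)%E ->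
    (\int[leb]_(x in X) (h (S x) * (expR (- u x))%:E) <= c%:E * \int[leb]_x h x)%E) ->
  (\int[ga]_(x in X) (density mu' ga (S x) *
     expR (- ((sqnorm (S x) - sqnorm x) / 2 + u x)))%:E <= c%:E)%E.
Proof.
move=> muga mS mX mu_ area.
have mp := measurable_density muga.
pose h (y : Rn) := ((density mu' ga y)%:E * (gauss_density n y)%:E)%E.
have mh : measurable_fun setT h.
  by apply: emeasurable_funM; apply/measurable_EFinP => //; exact: measurable_gauss_density.
have h0 y : (0 <= h y)%E by rewrite mule_ge0// lee_fin ?density_ge0// gauss_density_ge0.
have Ih : (\int[leb]_y h y = 1)%E.
  rewrite -(Rintegral_density1 muga (@probability_setT _ _ _ mu')) ge0_integral_gauss//.
    by apply/measurable_EFinP.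
  by move=> y; rewrite lee_fin density_ge0.
have := area h mh h0; rewrite Ih mule1; apply: le_trans.
pose k (x : Rn) := (density mu' ga (S x) * expR (- ((sqnorm (S x) - sqnorm x) / 2 + u x)))%:E.
have mk : measurable_fun setT k.
  apply/measurable_EFinP; apply: measurable_funM; first exact: measurableT_comp.
  apply: measurableT_comp => //; apply: measurableT_comp => //; apply: measurable_funD => //.
  apply: measurable_funM => //; apply: measurable_funB; last exact: measurable_sqnorm.
  exact: measurableT_comp measurable_sqnorm mS.
rewrite integral_mkcond [leRHS]integral_mkcond ge0_integral_gauss.
- rewrite le_eqVlt; apply/orP; left; apply/eqP; apply: eq_integral => x _.
  rewrite !patchE; case: ifPn => _; last by rewrite mul0e.
  rewrite /h -!EFinM; congr EFin; rewrite -!mulrA; congr (_ * _).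
  rewrite /gauss_density mulrCA; congr (_ * _).
  rewrite -!expRD; congr expR.
  by move: (sqnorm _) (sqnorm _) (u x) => a b e; field.
- by apply/(measurable_restrictT _ mX); exact: measurable_funTS.
- by move=> x; rewrite patchE; case: ifPn => // _; rewrite lee_fin mulr_ge0 ?density_ge0 ?expR_ge0.
Qed.

End gauss_area.

Lemma ae_preimage_eq d1 d2 (T1 : measurableType d1) (T2 : measurableType d2) (R : realType)
    (m : {measure set T1 -> \bar R}) (f g : T1 -> T2) B :
  measurable_fun setT f -> measurable_fun setT g -> measurable B ->
  (\forall x \ae m, f x = g x) -> m (f @^-1` B) = m (g @^-1` B).
Proof.
move=> mf mg mB fg.
have mfB := measurable_preimage mf mB; have mgB := measurable_preimage mg mB.
have mI A : measurable A -> m A = (\int[m]_x (\1_A x)%:E)%E.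
  by move=> mA; rewrite integral_indic// setIT.
rewrite !mI//.
apply: ae_eq_integral => //; try exact/measurable_EFinP/measurable_indic.
apply: filterS fg => x e _; rewrite !indicE; congr ((_ : bool)%:R%:E).
by apply/idP/idP; rewrite !inE /preimage/= e.
Qed.

Lemma ent_step_arith (R : realFieldType) (a b d e tau z k w : R) :
  z - 1 <= 2 * (k * tau ^+ 2) -> 0 <= tau ^+ 2 * w ->
  a + ((b - (b + 2 * tau * d + tau ^+ 2 * w)) / 2 + tau * e) + (z - 1) <=
  a - tau * (d - e) + 2 * k * tau ^+ 2.
Proof. by move=> ? ?; nra. Qed.

Section entropy_transfer.
Context {R : realType} {n : nat}.
Local Notation Rn := 'rV[R]_n.
Local Notation leb := (@lebesgue_rV R n).
Local Notation ga := (gauss_measure n).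
Variables (mu : R -> probability Rn R) (T : Rn -> Rn) (theta : R -> Rn -> R^o).
Hypothesis DR : driven mu T theta.
Local Notation v t := (grad (theta t)).
Local Notation Tt := (interp T).

Definition log_density t (x : Rn) : R := ln (density (mu t) ga x).
Definition log_integrable t := (mu t).-integrable setT (EFin \o log_density t).
Definition mean_log t : R := \int[mu t]_x log_density t x.

Lemma driven_dominated t : 0 <= t <= 1 -> mu t `<< ga.
Proof.
move=> t01; apply: null_dominates_trans (@lebesgue_dominates_gauss R n).
by have [] := driven_ac DR t01.
Qed.

Definition mean_sqnorm t : R := \int[mu 0]_x sqnorm (Tt t x).

Section transfer.
Variables (s t : R) (S : Rn -> Rn) (X : set Rn) (u : Rn -> R) (c : R).
Hypothesis s01 : 0 <= s <= 1.
Hypothesis t01 : 0 <= t <= 1.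
Hypothesis mS : measurable_fun setT S.
Hypothesis ST : \forall x \ae mu 0, S (Tt t x) = Tt s x.
Hypothesis mX : measurable X.
Hypothesis XT : \forall x \ae mu 0, X (Tt t x).
Hypothesis m_u : measurable_fun setT u.
Hypothesis iu : (mu 0).-integrable setT (EFin \o (fun x => u (Tt t x))).
Hypothesis area : forall h : Rn -> \bar R, measurable_fun setT h -> (forall x, 0 <= h x)%E ->
  (\int[leb]_(x in X) (h (S x) * (expR (- u x))%:E) <= c%:E * \int[leb]_x h x)%E.

(** Serves both the sharp estimate between close interior times and the crude one behind finiteness.
    S leads from time t to time s; u and c account for the change of volume. *)
Lemma driven_transfer : log_integrable t -> log_integrable s /\
  mean_log s <= mean_log t + ((mean_sqnorm s - mean_sqnorm t) / 2 + \int[mu 0]_x u (Tt t x)) + (c - 1).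
Proof.
move=> lt; have mT := measurable_interp DR t; have mTs := measurable_interp DR s.
have mE A : measurable A -> mu t A = mu 0 (Tt t @^-1` A) by move=> mA; exact: (driven_image DR t01 mA).
pose w x := (sqnorm (S x) - sqnorm x) / 2 + u x.
have mw : measurable_fun setT w.
  apply: measurable_funD => //; apply: measurable_funM => //.
  by apply: measurable_funB; [exact: measurableT_comp measurable_sqnorm mS|exact: measurable_sqnorm].
pose w0 x := 1 / 2 * (sqnorm (Tt s x) - sqnorm (Tt t x)) + u (Tt t x).
have isq : (mu 0).-integrable setT (EFin \o (fun x => sqnorm (Tt s x) - sqnorm (Tt t x))).
  by apply: integB; exact: (integ_sqinterp DR).
have iw0 : (mu 0).-integrable setT (EFin \o w0) by apply: integD => //; exact: integZ.
have ww0 : \forall x \ae mu 0, w (Tt t x) = w0 x.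
  by apply: filterS ST => x e; rewrite /w /w0 e mulrC div1r.
have iwT : (mu 0).-integrable setT (EFin \o (w \o Tt t)).
  by apply: (integ_ae_eq _ iw0 ww0); exact: measurableT_comp.
have iw : (mu t).-integrable setT (EFin \o w) by apply: (integ_image mT mE mw).2.
have msE A : measurable A -> mu s A = mu t (S @^-1` A).
  move=> mA; rewrite mE; last exact: measurable_preimage.
  rewrite (driven_image DR s01 mA).
  apply: (ae_preimage_eq (f := Tt s) (g := S \o Tt t)) => //; first exact: measurableT_comp.
  by apply: filterS ST => x /= ->.
have Xt : \forall x \ae mu t, X x by exact: (ae_image_inv mT mE).
have ga_area := gauss_area (driven_dominated s01) mS mX m_u area.
have [ls le] := entropy_comparison (driven_dominated t01) (driven_dominated s01) (gauss_finite n)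
   mS msE mX Xt iw ga_area lt.
split => //; apply: (le_trans le); rewrite lerD2r lerD2l.
rewrite (Rintegral_image mT mE iw) (Rintegral_ae_eq iwT iw0 ww0).
rewrite /w0 RintegralD//; last exact: integZ.
rewrite RintegralZl// RintegralB//; [|exact: (integ_sqinterp DR)|exact: (integ_sqinterp DR)].
by rewrite mulrC div1r.
Qed.

End transfer.

Lemma mean_sqnorm_shift s t : mean_sqnorm t = mean_sqnorm s + 2 * (t - s) * mean_dot mu T s + (t - s) ^+ 2 * mean_sqdisp mu T.
Proof.
rewrite /mean_sqnorm /mean_dot /mean_sqdisp.
rewrite -(RintegralZl _ measurableT (integ_dot DR s)) -(RintegralZl _ measurableT (integ_sqdisp DR)).
have i1 := integ_sqinterp DR s; have i2 := integZ (2 * (t - s)) (integ_dot DR s).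
have i3 := integZ ((t - s) ^+ 2) (integ_sqdisp DR).
rewrite -(RintegralD measurableT i1 i2) -(RintegralD measurableT (integD i1 i2) i3).
by apply: eq_Rintegral => x _; rewrite (interp_shift T s t) sqnormDZ.
Qed.

Lemma ent_step (al : R) : 0 < al -> exists2 C : R, 0 <= C & exists2 d : R, 0 < d &
  forall s t, al <= s <= 1 - al -> al <= t <= 1 - al -> `|t - s| < d -> log_integrable t ->
    log_integrable s /\ mean_log s <= mean_log t - (t - s) * ent1 mu T theta s + C * (t - s) ^+ 2.
Proof.
move=> al0; have [L L0 hL] := hess_interp_bound DR al0.
pose K : R := (n`!)%:R * 2 ^+ n * L ^+ 2 * expR 1.
have K0 : 0 <= K.
  by rewrite /K; apply: mulr_ge0; rewrite ?expR_ge0// mulr_ge0 ?sqr_ge0// mulr_ge0// exprn_ge0.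
(* K tau^2 is the error of the determinant and tau^2 that of [area_fine]; the factor 2 comes from
   exp z - 1 <= 2 z for small z. *)
exists (2 * (K + 1)); first by rewrite mulr_ge0// addr_ge0.
(* The summands are the smallness conditions needed below; |tau| q <= 1 implies them all. *)
pose q := 1 + 2 * (n%:R * L) + 2 * L + 2 * (K + 1).
have nL0 : 0 <= n%:R * L by rewrite mulr_ge0.
have q1 : 1 <= q by rewrite /q; move: (n%:R * L) nL0 => z; lra.
exists q^-1; first by rewrite invr_gt0 (lt_le_trans ltr01 q1).
move=> s t sal tal; have s01 := itv_margin al0 sal; have t01 := itv_margin al0 tal.
set tau := t - s => tauq lt.
have tq : `|tau| * q <= 1.
  by rewrite -ler_pdivlMr ?(lt_le_trans ltr01 q1)// div1r ltW.
have tnL : `|tau| * (n%:R * L) <= 1 / 2.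
  move: tq; rewrite /q; have := normr_ge0 tau; move: (`|tau|) (n%:R * L) nL0 => a z z0 a0.
  nra.
have tL : `|tau| * L <= 1 / 2.
  move: tq; rewrite /q; have := normr_ge0 tau; move: (`|tau|) (n%:R * L) nL0 => a z z0 a0.
  nra.
have tK : (K + 1) * tau ^+ 2 <= 1 / 2.
  rewrite -(real_normK (num_real tau)).
  move: tq; rewrite /q; have := normr_ge0 tau; move: (`|tau|) (n%:R * L) nL0 => a z z0 a0 h.
  have h1 : a * (2 * (K + 1)) <= 1 by nra.
  have h2 : a <= 1 by nra.
  have h3 : 0 <= a * (K + 1) by rewrite mulr_ge0// addr_ge0.
  rewrite expr2; nra.
(* [area_fine] needs a positive loss, taken below to be tau^2. *)
have [tau0|tau0] := eqVneq tau 0.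
  have ts : t = s by apply/eqP; rewrite -subr_eq0 -/tau tau0.
  by rewrite -ts; split => //; rewrite tau0 mul0r expr0n/= mulr0 subr0 addr0.
have ss := driven_smooth_slice DR s01; have st := driven_smooth_slice DR t01.
have mvs := measurable_grad ss; have mvt := measurable_grad st.
(* S leads from time t to time s with the velocity at t; F, below, returns with the velocity at s,
   and X is where the two velocities agree and the Hessian bound holds. *)
pose S (x : Rn) := x + (s - t) *: v t x.
have mS : measurable_fun setT S by apply: measurable_fun_rVD => //; exact: measurable_fun_rVZ.
have ST : \forall x \ae mu 0, S (Tt t x) = Tt s x.
  by apply: filterS (vel_interp DR t01) => x vx; rewrite /S vx (interp_shift T t s).
pose E := [set y : Rn | forall i j, `|hess (theta s) y i j| <= L].
have mE : measurable E by exact: measurable_hess_le.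
pose X := [set x : Rn | v s (S x) = v t x] `&` S @^-1` E.
have mX : measurable X.
  apply: measurableI; last exact: measurable_preimage.
  by apply: measurable_eq_rV => //; exact: measurableT_comp.
have XT : \forall x \ae mu 0, X (Tt t x).
  apply: filterS3 ST (hL _ sal) (filterI (vel_interp DR s01) (vel_interp DR t01)) => x e b [vs vt].
  by split; rewrite /= e// vs vt.
pose F (y : Rn) := y + tau *: v s y.
have FS x : X x -> F (S x) = x.
  by move=> [/= vx _]; rewrite /F vx /S -addrA -scalerDl /tau -(opprB s t) subrr scale0r addr0.
have XE x : X x -> E (S x) by case.
pose g (y : Rn) : R := tau * \tr (hess (theta s) y).
have sg : smooth_on setT (g : Rn -> R^o).
  move=> k; apply: Ck_onZ; apply: Ck_on_sum => i.
  rewrite (_ : (fun y => _) = 'D_(delta_mx 0 i) ('D_(delta_mx 0 i) (theta s))).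
    by do 2 apply: smooth_derive.
  by apply/funext => y; rewrite mxE.
have mg : measurable_fun setT g by exact: smooth_measurable.
pose u x := g (S x).
have m_u : measurable_fun setT u by exact: measurableT_comp.
have uT : \forall x \ae mu 0, u (Tt t x) = tau * \tr (hess (theta s) (Tt s x)).
  by apply: filterS ST => x e; rewrite /u /g e.
have itr := integZ tau (integ_tr DR s01).
have iu : (mu 0).-integrable setT (EFin \o (fun x => u (Tt t x))).
  by apply: (integ_ae_eq _ itr uT); apply: measurableT_comp => //; exact: measurable_interp DR t.
pose A y := 1%:M + tau *: hess (theta s) y.
pose c := expR (K * tau ^+ 2).
have c0 : 0 <= c by exact: expR_ge0.
have area h : measurable_fun setT h -> (forall x, 0 <= h x)%E ->
    (\int[leb]_(x in X) (h (S x) * (expR (- u x))%:E) <= (c * expR (tau ^+ 2))%:E * \int[leb]_x h x)%E.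
  move=> mh' h0; apply: (@area_fine R n F S X E mS mX mE FS XE A g 2 c) => //.
  - move=> i; have C0 : Ck_on setT 0 (fun y : Rn => (y 0 i : R^o)).
      exact: smooth_coord.
    have C1 : Ck_on setT 0 ((fun y : Rn => (y 0 i : R^o)) + (fun y => tau * 'D_(delta_mx 0 i) (theta s) y)).
      by apply: Ck_onD => //; apply: Ck_onZ; exact: smooth_derive.
    rewrite (_ : (fun y => _) = ((fun y : Rn => (y 0 i : R^o)) + (fun y => tau * 'D_(delta_mx 0 i) (theta s) y))).
      exact: Ck_on_continuous C1.
    by apply/funext => y; rewrite /F !fctE !mxE.
  - move=> i j; have C1 : Ck_on setT 0 (cst ((i == j)%:R) + (fun y : Rn => tau * 'D_(delta_mx 0 i) ('D_(delta_mx 0 j) (theta s)) y)).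
      by apply: Ck_onD; [exact: Ck_on_cst|apply: Ck_onZ; do 2 apply: smooth_derive].
    rewrite (_ : (fun y => _) = (cst ((i == j)%:R) + (fun y : Rn => tau * 'D_(delta_mx 0 i) ('D_(delta_mx 0 j) (theta s)) y))).
      exact: Ck_on_continuous C1.
    by apply/funext => y; rewrite /A !fctE !mxE.
  - exact: Ck_on_continuous (sg 0%N).
  - move=> y e e0.
    have ee : 0 < e / (1 + `|tau|) by rewrite divr_gt0// ltr_pwDl.
    have /choice[dd ddP] (i : 'I_n) : exists d : R, 0 < d /\ forall h, `|h| < d ->
      `|'D_(delta_mx 0 i) (theta s) (y + h) - 'D_(delta_mx 0 i) (theta s) y -
        lin_row (fun j => 'D_(delta_mx 0 j) ('D_(delta_mx 0 i) (theta s)) y) h| <= e / (1 + `|tau|) * `|h|.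
      by have [d d0 dP] := C1_expand y (smooth_derive (delta_mx 0 i) ss 1%N) ee; exists d.
    have [d d0 dP] := finite_pos_lower (fun i => (ddP i).1).
    exists d => // k kd; apply/rV_norm_leP => [|i]; first by rewrite mulr_ge0// ltW.
    have [_ h1] := ddP i; have h2 := h1 k (lt_le_trans kd (dP i)).
    have -> : (F (y + k) - F y - k *m A y) 0 i = tau * ('D_(delta_mx 0 i) (theta s) (y + k) - 'D_(delta_mx 0 i) (theta s) y -
        lin_row (fun j => 'D_(delta_mx 0 j) ('D_(delta_mx 0 i) (theta s)) y) k).
      rewrite /F /A mulmxDr mulmx1 -scalemxAr.
      rewrite !mxE; under eq_bigr do rewrite !mxE.
      by rewrite /lin_row; move: (\sum_i _) => z; ring.
    rewrite normrM (le_trans (ler_wpM2l (normr_ge0 _) h2))//.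
    rewrite mulrA ler_wpM2r// mulrCA ler_piMr ?(ltW e0)// ler_pdivrMr ?ltr_pwDl// mul1r lerDr//.
  - by move=> y Ey; apply: (unitmx_near_id L0 Ey tnL).
  - by move=> y Ey w; apply: (invmx_near_id_le L0 Ey tnL).
  - by move=> y Ey; apply: (det_near_id L0 Ey tnL tL).
  - by rewrite lt_neqAle eq_sym sqrf_eq0 tau0 sqr_ge0.
have [ls le] := driven_transfer (itv_cc s01) (itv_cc t01) mS ST mX XT m_u iu area lt.
split => //; apply: (le_trans le).
rewrite (Rintegral_ae_eq iu itr uT) (RintegralZl _ measurableT (integ_tr DR s01)) -/(mean_tr mu T theta s).
rewrite (mean_sqnorm_shift s t) -/tau.
have ex : c * expR (tau ^+ 2) - 1 <= 2 * ((K + 1) * tau ^+ 2).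
  rewrite /c -expRD -{2}[tau ^+ 2]mul1r -mulrDl; apply: expR_sub1_le => //.
  by rewrite mulr_ge0 ?sqr_ge0// addr_ge0.
have w0 : 0 <= tau ^+ 2 * mean_sqdisp mu T.
  by rewrite mulr_ge0 ?sqr_ge0//; apply: Rintegral_ge0 => x _; exact: sqnorm_ge0.
exact: ent_step_arith ex w0.
Qed.

End entropy_transfer.

(** * Finiteness of the entropy at interior times *)

Section monotone_inverse.
Context {R : realType} {n : nat}.
Local Notation Rn := 'rV[R]_n.
Local Notation leb := (@lebesgue_rV R n).

Lemma continuous_rV (F : Rn -> Rn) : (forall i, continuous (fun y => F y 0 i : R)) -> continuous F.
Proof.
move=> cF y; apply/(@cvgrPdist_le R Rn Rn (nbhs (y : Rn)) _ F (F y)) => e e0.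
have h : \forall z \near y, forall i, `|F y 0 i - F z 0 i| <= e.
  apply: (@filter_forall _ _ _ (nbhs (y : Rn)) _ _) => i.
  have /(@cvgrPdist_le R R Rn (nbhs (y : Rn)) _ (fun z => F z 0 i) (F y 0 i)) := cF i y.
  exact.
apply: filterS h => z h; apply/rV_norm_leP; first exact: ltW.
by move=> i; rewrite !mxE.
Qed.

Variables (F : Rn -> Rn) (K : nat -> set Rn).
Hypothesis cF : continuous F.
Hypothesis cK : forall k, compact (K k).
Hypothesis ndK : forall k l y, (k <= l)%N -> K k y -> K l y.
Hypothesis monF : forall k y y', K k y -> K k y' -> 0 <= dot (y - y') (F y - F y').

Let cimage k (C : set Rn) : closed C -> compact (F @` (K k `&` C)).
Proof.
move=> cC; apply: continuous_compact; last exact: compact_closedI.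
exact: continuous_subspaceT.
Qed.

Let mimage k (C : set Rn) : closed C -> measurable (F @` (K k `&` C)).
Proof.
by move=> cC; apply: rV_closed_measurable; apply: compact_closed; [exact: norm_hausdorff|exact: cimage].
Qed.

Let below i (q : R) := [set y : Rn | y 0 i <= q].
Let above i (q : R) := [set y : Rn | q <= y 0 i].

Let closed_below i q : closed (below i q).
Proof. by apply: (@closed_comp _ _ (fun y : Rn => y 0 i) [set z | z <= q]); [move=> y _; exact: coord_continuous|exact: closed_le]. Qed.

Let closed_above i q : closed (above i q).
Proof. by apply: (@closed_comp _ _ (fun y : Rn => y 0 i) [set z | q <= z]); [move=> y _; exact: coord_continuous|exact: closed_ge]. Qed.

(** Values of F attained on both sides of a gap in the i-th coordinate. With rational q and q' they
    cover every failure of injectivity. *)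
Let Nq k i (q q' : R) := F @` (K k `&` below i q) `&` F @` (K k `&` above i q').

(* By monotonicity a line parallel to the i-th axis meets Nq at most once. *)
Let Nq_null k i q q' : q < q' -> measurable (Nq k i q q') /\ leb (Nq k i q q') = 0%E.
Proof.
move=> qq'; have mN : measurable (Nq k i q q') by apply: measurableI; exact: mimage.
split => //.
have [M [_ MP]] := compact_bounded (@cimage k _ (@closed_below i q)).
pose B := Num.max 0 (M + 1).
apply: (@lebesgue_rV_disjoint_translates _ _ _ (delta_mx 0 i) B (fun k => k.+1%:R^-1)) => //.
- move=> x [xN _]; apply: le_trans (MP (M + 1) _ x xN) _; first by rewrite ltrDl.
  by rewrite le_max lexx orbT.
- by rewrite le_max lexx.
- by move=> j; rewrite ger0_norm ?invr_ge0// invf_le1// ler1n.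
(* Along the axis the inner product of [monF] is (y_i - w_i) (h - h'), negative because w_i <= q <
   q' <= y_i and h < h'. *)
have key x (h h' : R) : h < h' -> Nq k i q q' (x + h *: delta_mx 0 i) -> ~ Nq k i q q' (x + h' *: delta_mx 0 i).
  move=> hh' [_ [y [Ky yq'] Fy]] [[w [Kw wq] Fw] _].
  have := monF Ky Kw; rewrite Fy Fw opprD addrACA subrr add0r -scalerBl.
  rewrite dotZr [dot _ _](bigD1 i)//= big1 => [|j ji]; last by rewrite [X in _ * X]mxE (negbTE ji) mulr0.
  rewrite addr0 [X in _ * (_ * X)]mxE !eqxx mulr1 !mxE.
  rewrite nmulr_rge0 ?subr_lt0// subr_le0 leNgt => /negP; apply.
  exact: (le_lt_trans wq (lt_le_trans qq' yq')).
move=> j l x jl Nj Nl.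
have : j.+1%:R^-1 != l.+1%:R^-1 :> R.
  by apply: contra_neq jl => /invr_inj/eqP; rewrite eqr_nat => /eqP[].
by rewrite neq_lt => /orP[lt|lt]; [exact: (key _ _ _ lt Nj Nl)|exact: (key _ _ _ lt Nl Nj)].
Qed.

Let idx := (nat * 'I_n * (rat * rat))%type.
Let Nidx (a : idx) : set Rn := if a.2.1 < a.2.2 then Nq a.1.1 a.1.2 (ratr a.2.1) (ratr a.2.2) else set0.

Let N := \bigcup_a Nidx a.

Let Nidx_null a : measurable (Nidx a) /\ leb (Nidx a) = 0%E.
Proof.
rewrite /Nidx; case: ifP => [lt|_]; last by split; rewrite ?measure0.
by apply: Nq_null; rewrite ltr_rat.
Qed.

Let N_null : measurable N /\ leb N = 0%E.
Proof.
have mN : measurable N.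
  by apply: countable_bigcupT_measurable => [|a]; [exact: countableP|case: (Nidx_null a)].
split => //; apply/eqP; rewrite -measure_le0.
pose G k := if unpickle k is Some a then Nidx a else set0.
have NG : N = \bigcup_k G k.
  apply/seteqP; split => [x [a _ Na]|x [k _]]; first by exists (pickle a); rewrite /G // pickleK.
  by rewrite /G; case: unpickle => // a Na; exists a.
rewrite NG measure_le0; apply/eqP; apply: measure_bigcup_null => k; rewrite /G; case: unpickle => [a|].
- by case: (Nidx_null a).
- exact: measurable0.
- by case: (Nidx_null a).
- by rewrite measure0.
Qed.

Let inj_outside k l y y' : K k y -> K l y' -> F y = F y' -> ~ N (F y) -> y = y'.
Proof.
wlog : k l y y' / exists i, y 0 i < y' 0 i.
  move=> W Ky Ky' e Ny; apply/rowP => i; apply/eqP; apply: contrapT => /negP; rewrite neq_lt => /orP[lt|lt].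
    by have := W k l y y' (ex_intro _ i lt) Ky Ky' e Ny => yy; move: lt; rewrite yy ltxx.
  have Ny' : ~ N (F y') by rewrite -e.
  by have := W l k y' y (ex_intro _ i lt) Ky' Ky (esym e) Ny' => yy; move: lt; rewrite yy ltxx.
move=> [i lt] Ky Ky' e Ny; exfalso; apply: Ny.
have [q] := rat_in_itvoo lt; rewrite in_itv/= => /andP[yq qy'].
have [q'] := rat_in_itvoo qy'; rewrite in_itv/= => /andP[qq' q'y'].
exists (maxn k l, i, (q, q')) => //; rewrite /Nidx/=; rewrite ltr_rat in qq'; rewrite qq'; split.
  by exists y => //; split; [exact: ndK (leq_maxl _ _) Ky|exact: ltW].
by exists y' => //; split; [exact: ndK (leq_maxr _ _) Ky'|exact: ltW].
Qed.

Lemma monotone_inverse : exists (N Z : set Rn) (S : Rn -> Rn),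
  [/\ measurable N /\ leb N = 0%E, measurable Z, measurable_fun setT S,
      forall z, Z z -> F (S z) = z /\ exists k, K k (S z)
    & forall k y, K k y -> ~ N (F y) -> Z (F y) /\ S (F y) = y].
Proof.
pose P z y := (exists k, K k y) /\ F y = z.
pose Z := (\bigcup_k (F @` (K k `&` setT))) `\` N.
have ZP z : Z z -> exists y, P z y.
  by move=> [[k _ [y [Ky _] Fy]] _]; exists y; split => //; exists k.
pose S z := if pselect (Z z) is left zZ then sval (cid (ZP z zZ)) else 0.
have SP z : Z z -> P z (S z).
  by move=> zZ; rewrite /S; case: pselect => // h; case: (cid _).
have mZ : measurable Z.
  apply: measurableD; last by case: N_null.
  by apply: bigcup_measurable => k _; apply: mimage; exact: closedT.
have SF k y : K k y -> ~ N (F y) -> Z (F y) /\ S (F y) = y.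
  move=> Ky Ny; have zZ : Z (F y) by split => //; exists k => //; exists y.
  split => //; have [[l Kl] e] := SP _ zZ.
  by apply/esym; exact: inj_outside Ky Kl (esym e) Ny.
have mpre C : closed C -> measurable (S @^-1` C).
  (* On Z the preimage of C is a countable union of images of compact sets. Off Z the default value
     of S is 0, so ~Z is included exactly when C contains 0. *)
  move=> cC; rewrite (_ : S @^-1` C = ((\bigcup_k (F @` (K k `&` C))) `&` Z) `|` (if `[< C 0 >] then ~` Z else set0)).
    apply: measurableU; last by case: ifP => // _; exact: measurableC.
    by apply: measurableI => //; apply: bigcup_measurable => k _; exact: mimage.
  apply/seteqP; split => z /=.
    move=> CS; have [zZ|zZ] := pselect (Z z).
      have [[k Kk] e] := SP _ zZ; left; split => //.
      by exists k => //; exists (S z).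
    right; move: CS; rewrite /S; case: pselect => // _ C0.
    by case: asboolP.
  case => [[[k _ [y [Ky Cy] Fy]] zZ]|].
    have Ny : ~ N (F y) by rewrite Fy; case: zZ.
    by have [_] := SF _ _ Ky Ny; rewrite Fy => ->.
  by case: asboolP => // C0 zZ; rewrite /S; case: pselect.
exists N, Z, S; split => //; last by move=> z /SP[].
apply: (@measurability _ _ Rn Rn setT S open) => // _ [U oU <-]; rewrite setTI.
have mV := mpre (~` U) (open_closedC oU).
by rewrite -(setCK (S @^-1` U)); apply: measurableC.
Qed.

End monotone_inverse.

Section interior_entropy.
Context {R : realType} {n : nat}.
Local Notation Rn := 'rV[R]_n.
Local Notation leb := (@lebesgue_rV R n).
Variables (mu : R -> probability Rn R) (T : Rn -> Rn) (theta : R -> Rn -> R^o).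
Hypothesis DR : driven mu T theta.
Local Notation v t := (grad (theta t)).
Local Notation Tt := (interp T).

(** For p = x - x' and q = T x - T x' it turns monotonicity of T into monotonicity of the map from
    one interpolation time to another. *)
Lemma dot_convex_comb (p q : Rn) (a b : R) : 0 <= a <= 1 -> 0 <= b <= 1 -> 0 <= dot p q ->
  0 <= dot ((1 - a) *: p + a *: q) ((1 - b) *: p + b *: q).
Proof.
move=> /andP[a0 a1] /andP[b0 b1] pq.
rewrite dotDl !dotDr !dotZl !dotZr (dotC q p) -/(sqnorm p) -/(sqnorm q).
have a1' : 0 <= 1 - a by rewrite subr_ge0.
have b1' : 0 <= 1 - b by rewrite subr_ge0.
by rewrite !addr_ge0 ?mulr_ge0 ?sqnorm_ge0.
Qed.

(** Compact pieces are needed because their continuous images are closed, hence measurable. *)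
Lemma sigma_compact_full (m : probability Rn R) (E : set Rn) : measurable E -> (\forall x \ae m, E x) ->
  exists K : nat -> set Rn, [/\ forall k, compact (K k),
    forall k l y, (k <= l)%N -> K k y -> K l y, forall k, K k `<=` E
    & \forall x \ae m, exists k, K k x].
Proof.
move=> mE aeE.
have /choice[C CP] (k : nat) : exists C, [/\ compact C, C `<=` E & (m (E `\` C) <= (k.+1%:R^-1)%:E)%E].
  by apply: (compact_inner_regular m mE); rewrite invr_gt0.
pose K k := \big[setU/set0]_(j < k.+1) C j.
have KC k j : (j <= k)%N -> C j `<=` K k.
  by move=> jk x Cx; rewrite /K -bigcup_mkord; exists j => //=; rewrite ltnS.
have KP k x : K k x -> exists2 j, (j <= k)%N & C j x.
  by rewrite /K -bigcup_mkord => -[j /= jk Cx]; exists j.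
have mC k : measurable (C k).
  by apply: rV_closed_measurable; apply: compact_closed; [exact: norm_hausdorff|case: (CP k)].
exists K; split.
- move=> k; rewrite /K; elim: k.+1 => [|j IH]; first by rewrite big_ord0; exact: compact0.
  by rewrite big_ord_recr/=; apply: compactU => //; case: (CP j).
- by move=> k l y kl /KP[j jk Cy]; apply: (KC l j) => //; exact: leq_trans jk kl.
- by move=> k y /KP[j _]; case: (CP j) => _ + _; apply.
- have N0 : m (E `\` \bigcup_k C k) = 0%E.
    apply/eqP; rewrite -measure_le0; apply/lee_addgt0Pr => e e0; rewrite add0e.
    have /archi_boundP := ltW (divr_gt0 ltr01 e0); set j := Num.bound _ => jP.
    have [_ _ le] := CP j; apply: (le_trans (le_trans _ le)).
      apply: le_measure; rewrite ?inE.
      - by apply: measurableD => //; exact: bigcup_measurable.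
      - exact: measurableD.
      - by move=> x [Ex nC]; split => // Cx; apply: nC; exists j.
    rewrite lee_fin -[leRHS]invrK lef_pV2 ?posrE ?invr_gt0// -div1r ltW//.
    by rewrite (lt_le_trans jP)// ler_nat.
  have mN : measurable (E `\` \bigcup_k C k) by apply: measurableD => //; exact: bigcup_measurable.
  have := ae_of_null (P := fun x => ~ (E `\` \bigcup_k C k) x) mN N0 (fun x h => h).
  move=> h; apply: filterS2 aeE h => x Ex nx.
  apply: contrapT => nK; apply: nx; split => // -[j _ Cx]; apply: nK.
  by exists j; exact: (KC j j).
Qed.

(* The flow from time s to time t need not be invertible when t is 0 or 1; it
   is monotone and Lipschitz, hence inverted off a null set by S. *)
Lemma log_integrable_interior s t : 0 < s < 1 -> 0 <= t <= 1 ->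
  log_integrable mu t -> log_integrable mu s.
Proof.
move=> s01 t01 lt; have [E [mE aeE mono]] := driven_monotone_set DR s01.
have ss := driven_smooth_slice DR s01; have mv := measurable_grad ss.
pose tau := t - s; pose F (y : Rn) := y + tau *: v s y.
have cF : continuous F.
  apply: continuous_rV => i.
  have C1 : Ck_on setT 0 ((fun y : Rn => (y 0 i : R^o)) + (fun y => tau * 'D_(delta_mx 0 i) (theta s) y)).
    by apply: Ck_onD; [exact: smooth_coord|apply: Ck_onZ; exact: smooth_derive].
  rewrite (_ : (fun y => _) = ((fun y : Rn => (y 0 i : R^o)) + (fun y => tau * 'D_(delta_mx 0 i) (theta s) y))).
    exact: Ck_on_continuous C1.
  by apply/funext => y; rewrite /F !fctE !mxE.
have aeEs : \forall y \ae mu s, E y.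
  apply: (ae_image_inv (measurable_interp DR s) _ mE aeE) => A mA.
  exact: (driven_image DR (itv_cc s01) mA).
have [K [cK ndK KE aeK]] := sigma_compact_full mE aeEs.
have monF k y y' : K k y -> K k y' -> 0 <= dot (y - y') (F y - F y').
  move=> Ky Ky'; have := dot_convex_comb (itv_cc s01) t01 (mono _ _ (KE _ _ Ky) (KE _ _ Ky')).
  rewrite /F subDZ; move: (y - y') (v s y - v s y') => a b.
  have e r : (1 - r) *: (a - s *: b) + r *: (a + (1 - s) *: b) = a + (r - s) *: b.
    by apply/rowP => i; rewrite !mxE; ring.
  by rewrite !e subrr scale0r addr0.
have [N [Z [S [[mN N0] mZ mS ZP KP]]]] := monotone_inverse cF cK ndK monF.
have FT : \forall x \ae mu 0, F (Tt s x) = Tt t x.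
  by apply: filterS (vel_interp DR s01) => x vx; rewrite /F vx (interp_shift T s t).
have KT := ae_interp DR (itv_cc s01) aeK.
have NT := ae_interp_null DR t01 mN N0.
have ZT : \forall x \ae mu 0, Z (Tt t x) /\ S (Tt t x) = Tt s x.
  by apply: filterS3 FT KT NT => x e [k Kk]; rewrite -e => nN; exact: KP Kk nN.
have [al al0 sal] : exists2 al : R, 0 < al & al <= s <= 1 - al.
  move: s01 => /andP[a b]; exists (Num.min s (1 - s)); first by rewrite lt_min a subr_gt0.
  by rewrite ge_min lexx/= lerBrDl -lerBrDr ge_min lexx orbT.
(* On E the velocity is Lipschitz with squared Euclidean constant 2 / al^4; the factor n passes to
   the sup norm, and z <= (1 + z)^2 removes the square root. *)
pose M := 1 + `|tau| * (1 + 2 / al ^+ 4 * n%:R).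
have al4 : 0 <= 2 / al ^+ 4 by rewrite divr_ge0// exprn_ge0// ltW.
have M0 : 0 <= M by rewrite addr_ge0// mulr_ge0// addr_ge0// mulr_ge0.
have lipF q q' : E q -> E q' -> `|F q - F q'| <= M * `|q - q'|.
  move=> Eq Eq'; rewrite /F subDZ.
  have le := sqnorm_monotone_pair al0 sal (mono _ _ Eq Eq').
  rewrite mulrDl mul1r (le_trans (ler_normD _ _))// lerD2l normrZ -mulrA ler_wpM2l//.
  move: (q - q') (v s q - v s q') le => a b le.
  apply/rV_norm_leP => [|i]; first by rewrite mulr_ge0// addr_ge0// mulr_ge0.
  have sa : sqnorm a <= n%:R * `|a| ^+ 2.
    rewrite /sqnorm /dot (le_trans (ler_sum _ (_ : forall k, _ -> _ <= `|a| ^+ 2)))//.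
      by move=> k _; rewrite -expr2 -[leLHS]real_normK ?num_real// lerXn2r ?nnegrE//; exact: coord_le_norm.
    by rewrite sumr_const card_ord mulr_natl.
  have bi : `|b 0 i| ^+ 2 <= 2 / al ^+ 4 * n%:R * `|a| ^+ 2.
    apply: (le_trans (coord_le_sqnorm _ i)); apply: (le_trans le).
    by apply: le_trans (ler_wpM2l al4 sa) _; rewrite mulrA.
  rewrite -(ler_pXn2r (_ : (0 < 2)%N)) ?nnegrE//; last by rewrite mulr_ge0// addr_ge0// mulr_ge0.
  rewrite (le_trans bi)// exprMn ler_wpM2r ?sqr_ge0//.
  have := mulr_ge0 al4 (ler0n R n); move: (_ * n%:R) => z z0.
  by rewrite expr2; nra.
have area h : measurable_fun setT h -> (forall x, 0 <= h x)%E ->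
    (\int[leb]_(x in Z) (h (S x) * (expR (- (cst 0 x)))%:E) <= ((2 * M) ^+ n)%:E * \int[leb]_x h x)%E.
  move=> mh h0; under eq_integral do rewrite /= oppr0 expR0 mule1.
  apply: (@area_crude R n F S Z E) => //.
  - by move=> x /ZP[].
  - by move=> x /ZP[_ [k /KE]].
have iu : (mu 0).-integrable setT (EFin \o (fun x => cst (0 : R) (Tt t x))) by exact: integ_cst.
have [] := driven_transfer DR (itv_cc s01) t01 mS (filterS (fun x => @proj2 _ _) ZT) mZ
  (filterS (fun x => @proj1 _ _) ZT) (@measurable_cst _ _ _ _ _ _) iu area lt.
done.
Qed.

End interior_entropy.

(** * Distributional derivatives on ]0, 1[ *)

Section distributions.
Context {R : realType}.
Local Notation leb := (@lebesgue_measure R).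

Lemma is_derive_of_quadratic (f : R -> R^o) (s l C d : R) : 0 < d -> 0 <= C ->
  (forall t, `|t - s| < d -> `|f t - f s - (t - s) * l| <= C * (t - s) ^+ 2) ->
  is_derive (s : R) 1 f l.
Proof.
move=> d0 C0 q.
have lim : (fun h : R => h^-1 *: ((f \o shift s) (h *: (1 : R)) - f s)) @ (0 : R)^' --> (l : R^o).
  apply/cvgrPdist_le => e e0.
  have e1 : 0 < e / (C + 1) by rewrite divr_gt0// ltr_wpDl.
  have m0 : 0 < Num.min d (e / (C + 1)) by rewrite lt_min d0.
  exists (Num.min d (e / (C + 1))) => //= h; rewrite /ball_/= sub0r normrN lt_min => /andP[hd he] h0.
  have hs : h *: (1 : R) + s - s = h by rewrite addrK [h *: _]mulr1.
  have := q (h *: (1 : R) + s); rewrite hs => /(_ hd) le.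
  rewrite -(ler_pM2l (_ : 0 < `|h|)) ?normr_gt0// -normrM.
  have -> : h * (l - h^-1 *: (f (h *: (1 : R) + s) - f s)) = - (f (h *: (1 : R) + s) - f s - h * l).
    have aux (z : R) : h * (l - h^-1 * z) = - (z - h * l) by rewrite mulrBr mulrA mulfV// mul1r opprB.
    exact: aux.
  rewrite normrN (le_trans le)// -(real_normK (num_real h)).
  have he' : `|h| * (C + 1) <= e by rewrite -ler_pdivlMr ?ltr_wpDl// ltW.
  have := ler_wpM2l (normr_ge0 h) he'; have := sqr_ge0 `|h|.
  by rewrite expr2; move: (`|h|) => u ? ?; nra.
by apply: DeriveDef; [apply/cvg_ex; exists l|apply: cvg_lim].
Qed.

Lemma Rintegral_support (A B : set R) (g : R -> R) : measurable A -> measurable B -> A `<=` B ->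
  (forall x, ~ A x -> g x = 0) -> \int[leb]_(x in B) g x = \int[leb]_(x in A) g x.
Proof.
move=> mA mB AB g0; rewrite /Rintegral integral_mkcond [in RHS]integral_mkcond; congr fine.
apply: eq_integral => x _; rewrite !patchE.
have [/set_mem Ax|nA] := boolP (x \in A).
  by rewrite mem_set//; exact: AB.
case: ifP => // _; rewrite g0// => Ax; move: nA; rewrite mem_set//.
Qed.

Section continuous_on_unit_interval.
Variables (f : R -> R).
Hypothesis cf : forall t : R, 0 < t < 1 -> {for t, continuous f}.

Let within_cf (K : set R) : K `<=` `]0, 1[%classic -> {within K, continuous f}.
Proof.
move=> K01; apply: continuous_in_subspaceT => t; rewrite inE => /K01/=.
by rewrite in_itv/=; exact: cf.
Qed.

Lemma continuous_locally_integrable : locally_integrable `]0, 1[%classic f.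
Proof.
split; [|exact: interval_open|].
  by apply: subspace_continuous_measurable_fun => //; exact: within_cf.
move=> K K01 cK; have /integrableP[_] := continuous_compact_integrable cK (within_cf K01).
exact.
Qed.

Lemma continuous_integrable_segment (a b : R) : 0 < a -> b < 1 -> leb.-integrable `[a, b]%classic (EFin \o f).
Proof.
move=> a0 b1; apply: continuous_compact_integrable; first exact: segment_compact.
apply: within_cf => t /=; rewrite !in_itv/= => /andP[a_t t_b].
by rewrite (lt_le_trans a0)//= (le_lt_trans t_b).
Qed.

End continuous_on_unit_interval.

Section by_parts.
Variables (f g : R -> R) (eta eta' : R -> R) (a b : R).
Hypothesis a0 : 0 < a.
Hypothesis ab : a < b.
Hypothesis b1 : b < 1.
Hypothesis df : forall t : R, 0 < t < 1 -> is_derive t 1 (f : R -> R^o) (g t).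
Hypothesis cg : forall t : R, 0 < t < 1 -> {for t, continuous g}.
Hypothesis deta : forall t : R, is_derive t 1 (eta : R -> R^o) (eta' t).
Hypothesis ceta' : continuous eta'.
Hypothesis eta0 : forall t, ~ (a < t < b) -> eta t = 0.
Hypothesis eta'0 : forall t, ~ (a < t < b) -> eta' t = 0.

Let ab01 t : t \in `[a, b] -> 0 < t < 1.
Proof. by rewrite in_itv/= => /andP[a_t t_b]; rewrite (lt_le_trans a0)//= (le_lt_trans t_b). Qed.

Let a_ab : a \in `[a, b]. Proof. by rewrite in_itv/= lexx ltW. Qed.
Let b_ab : b \in `[a, b]. Proof. by rewrite in_itv/= lexx ltW. Qed.
Let oo_ab t : t \in `]a, b[ -> t \in `[a, b]. Proof. exact: subset_itv_oo_cc. Qed.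

(** Outside ]a, b[ the test function vanishes, so the integrals live on a compact interval and there
    are no boundary terms. *)
Lemma Rintegral_by_parts_01 : \int[leb]_(t in `]0, 1[) (f t * eta' t) = - \int[leb]_(t in `]0, 1[) (g t * eta t).
Proof.
have sub : `[a, b]%classic `<=` `]0, 1[%classic.
  by move=> t /= /ab01; rewrite in_itv/=.
have out t : ~ `[a, b]%classic t -> ~ (a < t < b).
  by move=> h /andP[at_ tb]; apply: h; rewrite /= in_itv/= !ltW.
rewrite (@Rintegral_support `[a, b]%classic)//; last by move=> t /out/eta'0 ->; rewrite mulr0.
rewrite (@Rintegral_support `[a, b]%classic _ (fun t => g t * eta t))//; last by move=> t /out/eta0 ->; rewrite mulr0.
rewrite (@Rintegration_by_parts R f eta g eta' a b ab).
- have -> : eta a = 0 by apply: eta0; rewrite ltxx.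
  have -> : eta b = 0 by apply: eta0; rewrite ltxx andbF.
  by rewrite !mulr0 subr0 sub0r.
- by apply: continuous_in_subspaceT => t; rewrite inE => tab; apply: cg; exact: ab01.
- split.
  + move=> t /oo_ab/ab01 t01; exact: (@ex_derive _ _ _ _ _ _ _ (df t01)).
  + by apply: cvg_at_right_filter; apply: is_derive_continuous (df (ab01 a_ab)).
  + by apply: cvg_at_left_filter; apply: is_derive_continuous (df (ab01 b_ab)).
- by move=> t /oo_ab/ab01 t01; rewrite derive1E; have [_ ->] := df t01.
- by apply: continuous_subspaceT.
- split.
  + by move=> t _; exact: (@ex_derive _ _ _ _ _ _ _ (deta t)).
  + by apply: cvg_at_right_filter; apply: is_derive_continuous (deta a).
  + by apply: cvg_at_left_filter; apply: is_derive_continuous (deta b).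
- by move=> t _; rewrite derive1E; have [_ ->] := deta t.
Qed.

End by_parts.

Lemma compact_in_01 (K : set R) : compact K -> K `<=` `]0, 1[%classic ->
  exists a b, [/\ 0 < a, a < b, b < 1 & forall t, K t -> a < t < b].
Proof.
move=> cK K01; have [->|/set0P K0] := eqVneq K set0.
  by exists (1 / 4), (1 / 2); split => //; lra.
have ci : {within K, continuous (fun t : R => t)} by apply: continuous_subspaceT => t; exact: cvg_id.
have [M MK Mmax] := compact_EVT_max K0 cK ci; have [m mK mmin] := compact_EVT_min K0 cK ci.
have /K01/= := set_mem MK; rewrite in_itv/= => /andP[M0 M1].
have /K01/= := set_mem mK; rewrite in_itv/= => /andP[m0 m1].
have mM : m <= M by exact: mmin.
exists (m / 2), ((1 + M) / 2); split.
- by rewrite divr_gt0.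
- by move: mM m0 M1; clear; lra.
- by move: M1; clear; lra.
- move=> t Kt; have := mmin t (mem_set Kt); have := Mmax t (mem_set Kt).
  by move: m0 M1; clear => ? ? ? ?; apply/andP; split; lra.
Qed.

Section test_functions.
Variable eta : R -> R.
Hypothesis teta : test_function (`]0, 1[%classic : set R^o) eta.

Lemma test_is_derive (t : R) : is_derive t 1 (eta : R -> R^o) (eta^`()%classic t).
Proof.
have [seta _ _] := teta; rewrite derive1E; apply: DeriveDef => //.
exact: (Ck_on_derivable (seta 1%N)).
Qed.

Lemma test_is_derive2 (t : R) : is_derive t 1 (eta^`()%classic : R -> R^o) (eta^`(2)%classic t).
Proof.
have [seta _ _] := teta; rewrite -[eta^`(2)%classic t]/((eta^`()%classic)^`()%classic t) derive1E.
apply: DeriveDef => //.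
rewrite (_ : eta^`()%classic = 'D_1 (eta : R^o -> R^o)); last by apply/funext => x; rewrite derive1E.
exact: (Ck_on_derivable (Ck_on_derive _ (seta 2%N))).
Qed.

Lemma test_continuous_derive2 : continuous (eta^`(2)%classic).
Proof.
have [seta _ _] := teta.
rewrite (_ : eta^`(2)%classic = 'D_1 ('D_1 (eta : R^o -> R^o))).
  exact: (Ck_on_continuous (Ck_on_derive _ (Ck_on_derive _ (seta 2%N)))).
apply/funext => x; rewrite -[LHS]/((eta^`()%classic)^`()%classic x) derive1E.
by congr ('D_1 _ x); apply/funext => y; rewrite derive1E.
Qed.

Lemma test_support : exists a b, [/\ 0 < a, a < b, b < 1 &
  forall t, ~ (a < t < b) -> [/\ eta t = 0, eta^`()%classic t = 0 & eta^`(2)%classic t = 0] ].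
Proof.
have [seta ceta seta01] := teta.
have [a [b [a0 ab b1 abP]]] := compact_in_01 ceta seta01.
exists a, b; split => // t tab.
have open0 (k : R -> R^o) : (forall s, (~` closure [set x | eta x != 0]) s -> k s = 0) ->
    forall s, (~` closure [set x | eta x != 0]) s -> k^`()%classic s = 0.
  move=> k0 s ns; rewrite derive1E -(derive_cst (0 : R^o) s 1).
  apply: near_eq_derive.
  have oC : open (~` closure [set x | eta x != 0]) by apply: closed_openC; exact: closed_closure.
  have := open_nbhs_nbhs (conj oC ns); apply: filterS => u nu.
  by rewrite k0.
have h0 s : (~` closure [set x | eta x != 0]) s -> eta s = 0.
  move=> ns; apply: contrapT => /eqP ne; apply: ns; exact: subset_closure.
have nt : (~` closure [set x | eta x != 0]) t by move=> /abP.
have h1 := open0 eta h0.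
split; [exact: h0|exact: h1|exact: (open0 _ h1)].
Qed.

End test_functions.

Lemma distr_derivative_01 (f g : R -> R) :
  (forall t : R, 0 < t < 1 -> is_derive t 1 (f : R -> R^o) (g t)) ->
  (forall t : R, 0 < t < 1 -> {for t, continuous g}) -> distr_derivative `]0, 1[ f g.
Proof.
move=> df cg; split; [|exact: continuous_locally_integrable|].
  apply: continuous_locally_integrable => t t01.
  exact: is_derive_continuous (df t t01).
move=> eta teta; have [a [b [a0 ab b1 out]]] := test_support teta.
apply: (@Rintegral_by_parts_01 f g eta _ a b) => //.
- exact: test_is_derive.
- by move=> t; exact: is_derive_continuous (test_is_derive2 teta t).
- by move=> t /out[].
- by move=> t /out[].
Qed.

Lemma distr_derivative2_ge_01 (f g k h : R -> R) :
  (forall t : R, 0 < t < 1 -> is_derive t 1 (f : R -> R^o) (g t)) ->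
  (forall t : R, 0 < t < 1 -> is_derive t 1 (g : R -> R^o) (k t)) ->
  (forall t : R, 0 < t < 1 -> {for t, continuous k}) ->
  (forall t : R, 0 < t < 1 -> {for t, continuous h}) ->
  (forall t : R, 0 < t < 1 -> h t <= k t) -> distr_derivative2_ge `]0, 1[ f h.
Proof.
move=> df dg ck ch hk.
have dc (F : R -> R) (F' : R -> R) : (forall t : R, 0 < t < 1 -> is_derive t 1 (F : R -> R^o) (F' t)) ->
    forall t : R, 0 < t < 1 -> {for t, continuous F}.
  by move=> dF t t01; exact: is_derive_continuous (dF t t01).
split; [exact: continuous_locally_integrable (dc _ _ df)|exact: continuous_locally_integrable|].
move=> eta teta eta0; have [a [b [a0 ab b1 out]]] := test_support teta.
have out0 t : ~ (a < t < b) -> eta t = 0 by move=> /out[].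
have out1 t : ~ (a < t < b) -> eta^`()%classic t = 0 by move=> /out[].
have out2 t : ~ (a < t < b) -> eta^`(2)%classic t = 0 by move=> /out[].
have ceta1 : continuous (eta^`()%classic).
  by move=> t; exact: is_derive_continuous (test_is_derive2 teta t).
have e1 := Rintegral_by_parts_01 a0 ab b1 df (dc _ _ dg) (test_is_derive2 teta)
  (test_continuous_derive2 teta) out1 out2.
have e2 := Rintegral_by_parts_01 a0 ab b1 dg ck (test_is_derive teta) ceta1 out0 out1.
rewrite e1 e2 opprK.
have sub : `[a, b]%classic `<=` `]0, 1[%classic.
  by move=> t /=; rewrite !in_itv/= => /andP[a_t t_b]; rewrite (lt_le_trans a0)//= (le_lt_trans t_b).
have out' t : ~ `[a, b]%classic t -> eta t = 0.
  move=> nt; have [] // := out t; move=> /andP[at_ tb]; apply: nt; by rewrite /= in_itv/= !ltW.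
rewrite (@Rintegral_support `[a, b]%classic)//; last by move=> t /out' ->; rewrite mulr0.
rewrite (@Rintegral_support `[a, b]%classic _ (fun t => k t * eta t))//; last by move=> t /out' ->; rewrite mulr0.
have ceta t : {for t, continuous eta}.
  exact: is_derive_continuous (test_is_derive teta t).
apply: le_Rintegral => //.
- by apply: (@continuous_integrable_segment (fun t => h t * eta t)) => // t t01; apply: continuousM; [exact: ch|exact: ceta].
- by apply: (@continuous_integrable_segment (fun t => k t * eta t)) => // t t01; apply: continuousM; [exact: ck|exact: ceta].
- by move=> t /sub /=; rewrite in_itv/= => t01; rewrite ler_wpM2r//; exact: hk.
Qed.

End distributions.

(** * The second order inequality *)

(** f0, f1 are entropies at two times and a0, a1 the expected slopes. The two one-sided bounds
    involve different slopes, but tau (a1 - a0) is itself of order tau^2. *)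
Lemma squeeze_quadratic (R : realType) (f0 f1 a0 a1 b C C' tau : R) : 0 <= C' ->
  f0 <= f1 - tau * a0 + C * tau ^+ 2 -> f1 <= f0 + tau * a1 + C * tau ^+ 2 ->
  `|a1 - a0 - tau * b| <= C' * tau ^+ 2 -> `|tau| <= 1 ->
  `|f1 - f0 - tau * a0| <= (C + C' + `|b|) * tau ^+ 2.
Proof.
move=> C'0 h1 h2 h3 t1.
have b2 : 0 <= `|b| * tau ^+ 2 by rewrite mulr_ge0 ?sqr_ge0.
have c2 : 0 <= C' * tau ^+ 2 by rewrite mulr_ge0 ?sqr_ge0.
have h4 : tau * a1 - tau * a0 <= `|b| * tau ^+ 2 + C' * tau ^+ 2.
  rewrite -mulrBr (le_trans (ler_norm _))// normrM.
  have h5 : `|a1 - a0| <= `|tau| * `|b| + C' * tau ^+ 2.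
    by rewrite -[a1 - a0](subrK (tau * b)) (le_trans (ler_normD _ _))// addrC normrM lerD2l.
  rewrite (le_trans (ler_wpM2l (normr_ge0 _) h5))//.
  rewrite mulrDr mulrA -expr2 real_normK ?num_real// mulrC lerD2l.
  exact: ler_piMl.
rewrite !mulrDl ler_norml; move: h1 h2 h4 b2 c2.
move: (tau * a0) (tau * a1) (C * _) (C' * _) (`|b| * _) => p q x y z; clear => *.
by apply/andP; split; lra.
Qed.

Lemma continuous_cst_sqr (R : realType) (f : R -> R) (a b t : R) : {for t, continuous f} ->
  {for t, continuous (fun s => a + b * f s ^+ 2)}.
Proof.
move=> cf; have := cvgD (cvg_cst a) (cvgM (cvg_cst b) (cvgM cf cf)).
exact.
Qed.

(** * Couplings carried by graphs *)

Section transport_cost.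
Context {R : realType} {n : nat}.
Local Notation Rn := 'rV[R]_n.

(** The measurability proof is an argument so that the instance below, and through it
    [distribution], can find it. *)
Let graph (S : Rn -> Rn) (mS : measurable_fun setT S) (x : Rn) : Rn * Rn := (x, S x).

Let measurable_graph S (mS : measurable_fun setT S) : measurable_fun setT (graph mS).
Proof. by apply/measurable_fun_pairP; split; [exact: measurable_id|exact: mS]. Qed.

HB.instance Definition _ S mS := isMeasurableFun.Build _ _ _ _ (@graph S mS) (measurable_graph mS).

(** The image of mu by the graph of S is a coupling, and the infimum is at most its cost. *)
Lemma W2_le (mu nu : probability Rn R) (S : Rn -> Rn) : measurable_fun setT S ->
  (forall A, measurable A -> nu A = mu (S @^-1` A)) ->
  mu.-integrable setT (EFin \o (fun x => sqnorm (S x - x))) ->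
  fine (W2 mu nu) ^+ 2 <= \int[mu]_x sqnorm (S x - x).
Proof.
move=> mS nuE iS; pose pi : probability (Rn * Rn)%type R := distribution mu (graph mS).
have cpi : coupling mu nu pi.
  move=> A mA; split; rewrite /pi /= /distribution /pushforward.
    by congr (mu _); apply/seteqP; split => [x []|x].
  by rewrite nuE//; congr (mu _); apply/seteqP; split => [x []|x].
have mdiff : measurable_fun setT (fun z : Rn * Rn => sqnorm (z.1 - z.2)).
  apply: (measurableT_comp (@measurable_sqnorm R n)); apply/measurable_fun_rVP => i.
  rewrite (_ : (fun z => _) = (fun z : Rn * Rn => z.1 0 i - z.2 0 i)); last by apply/funext => z; rewrite !mxE.
  by apply: measurable_funB; [exact: (measurable_fun_rVP _).1 measurable_fst i|exact: (measurable_fun_rVP _).1 measurable_snd i].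
have costE : (\int[pi]_z (sqnorm (z.1 - z.2))%:E = (\int[mu]_x sqnorm (S x - x))%:E)%E.
  rewrite (ge0_integral_image (measurable_graph mS) (m1 := mu))//.
  - rewrite /Rintegral fineK; last exact: integrable_fin_num.
    by apply: eq_integral => x _; rewrite /= -opprB sqnormN.
  - exact/measurable_EFinP.
  - by move=> z; rewrite lee_fin sqnorm_ge0.
rewrite /W2; set I := ereal_inf _.
have I0 : (0 <= I)%E.
  by apply: le_ereal_inf_tmp => _ [p _ <-]; apply: integral_ge0 => z _; rewrite lee_fin sqnorm_ge0.
have I1 : (I <= (\int[mu]_x sqnorm (S x - x))%:E)%E.
  by rewrite -costE; apply: ereal_inf_lbound; exists pi.
(* The infimum lies between 0 and a real number, so [fine] loses nothing and the square root can be
   squared away. *)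
move: I I0 I1 => [r| |]; rewrite ?leye_eq ?leeNy_eq//= !lee_fin => r0 r1.
by rewrite powR12_sqrt// sqr_sqrtr.
Qed.

End transport_cost.

Section second_order.
Context {R : realType} {n : nat}.
Local Notation Rn := 'rV[R]_n.
Local Notation ga := (gauss_measure n).
Variables (mu : R -> probability Rn R) (T : Rn -> Rn) (theta : R -> Rn -> R^o).
Hypothesis DR : driven mu T theta.

Lemma relative_entropyE t : 0 <= t <= 1 -> relative_entropy (mu t) ga = ent (mu t) ga.
Proof. by move=> t01; rewrite /relative_entropy; case: asboolP => // /(_ (driven_dominated DR t01)). Qed.

Lemma relative_entropy_finite t : 0 <= t <= 1 -> (relative_entropy (mu t) ga < +oo)%E ->
  log_integrable mu t.
Proof.
move=> t01; rewrite relative_entropyE//; apply: ent_integrable; first exact: (driven_dominated DR t01).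
exact: gauss_finite.
Qed.

Lemma relative_entropy_mean_log t : 0 <= t <= 1 -> log_integrable mu t ->
  relative_entropy (mu t) ga = (mean_log mu t)%:E.
Proof.
move=> t01 lt; rewrite relative_entropyE//; apply: ent_Rintegral => //.
exact: (driven_dominated DR t01).
Qed.

Lemma interior_margin (t : R) : 0 < t < 1 -> exists al d : R, [/\ 0 < al, 0 < d &
  forall s, `|s - t| < d -> al <= s <= 1 - al].
Proof.
move=> /andP[t0 t1]; pose al := Num.min t (1 - t) / 2.
have m0 : 0 < Num.min t (1 - t) by rewrite lt_min t0 subr_gt0.
exists al, al; have al0 : 0 < al by rewrite divr_gt0.
split => // s; rewrite ltr_norml => /andP[s1 s2].
have m1 : Num.min t (1 - t) <= t by rewrite ge_min lexx.
have m2 : Num.min t (1 - t) <= 1 - t by rewrite ge_min lexx orbT.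
have alE : Num.min t (1 - t) = 2 * al by rewrite /al mulrC divfK.
move: m1 m2 s1 s2; rewrite alE; move: (al) al0 => a a0 m1 m2 s1 s2.
by apply/andP; split; lra.
Qed.

Lemma is_derive_ent1 t : 0 < t < 1 ->
  is_derive (t : R) 1 (ent1 mu T theta : R -> R^o) (ent2 mu T theta t).
Proof.
move=> t01; have [al [d [al0 d0 dP]]] := interior_margin t01.
have [C C0 CP] := ent1_expand DR al0.
apply: (@is_derive_of_quadratic _ _ _ _ C d) => // s sd.
have tt : `|t - t| < d by rewrite subrr normr0.
by have [] := CP t s (dP _ tt) (dP _ sd).
Qed.

Lemma continuous_ent2 t : 0 < t < 1 -> {for t, continuous (ent2 mu T theta)}.
Proof.
move=> t01; have [al [d [al0 d0 dP]]] := interior_margin t01.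
have [C C0 CP] := ent1_expand DR al0.
have tt : `|t - t| < d by rewrite subrr normr0.
apply/cvgrPdist_le => e e0.
have m0 : 0 < Num.min d (e / (C + 1)) by rewrite lt_min d0 divr_gt0// ltr_wpDl.
exists (Num.min d (e / (C + 1))) => //= s; rewrite /ball_/= distrC lt_min => /andP[sd se].
have h : `|ent2 mu T theta t - ent2 mu T theta s| <= C * `|s - t|.
  by rewrite (distrC (ent2 mu T theta t)); exact: (CP t s (dP _ tt) (dP _ sd)).2.
apply: (le_trans h); have : `|s - t| * (C + 1) <= e by rewrite -ler_pdivlMr ?ltr_wpDl// ltW.
by have := normr_ge0 (s - t); move: (`|s - t|) => u ? ?; nra.
Qed.

Lemma is_derive_mean_log t : (forall s, 0 < s < 1 -> log_integrable mu s) -> 0 < t < 1 ->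
  is_derive (t : R) 1 (mean_log mu : R -> R^o) (ent1 mu T theta t).
Proof.
move=> lmu t01; have [al [d [al0 d0 dP]]] := interior_margin t01.
have [C C0 CP] := ent1_expand DR al0.
have [C1 C10 [d1 d10 C1P]] := ent_step DR al0.
have tt : `|t - t| < d by rewrite subrr normr0.
have m0 : 0 < Num.min d (Num.min d1 1) by rewrite !lt_min d0 d10 ltr01.
apply: (@is_derive_of_quadratic _ _ _ _ (C1 + C + `|ent2 mu T theta t|) _ m0).
  by rewrite addr_ge0// addr_ge0.
move=> s; rewrite !lt_min => /and3P[sd sd1 s1].
have tal := dP _ tt; have sal := dP _ sd.
have [_ h1] := C1P t s tal sal sd1 (lmu _ (itv_margin al0 sal)).
have sd1' : `|t - s| < d1 by rewrite (distrC t).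
have [_ h2] := C1P s t sal tal sd1' (lmu _ (itv_margin al0 tal)).
have [h3 _] := CP t s tal sal.
apply: (squeeze_quadratic C0 h1 _ h3 (ltW s1)).
by move: h2; rewrite -(opprB s t) sqrrN mulNr opprK.
Qed.

End second_order.

(** The distributional claims come from pointwise ones: on ]0, 1[ the entropy has derivative [ent1],
    which has the continuous derivative [ent2], and [ent2_ge] holds at each t. *)
Theorem theorem1p5 (R : realType) (n : nat)
    (mu : R -> probability 'rV[R]_n R) (T : 'rV[R]_n -> 'rV[R]_n)
    (n_gt0 : (0 < n)%N)
    (mu_P2ac : forall t : R, 0 <= t <= 1 -> P2ac (mu t))
    (mu_interp : displacement_interpolation mu T)
    (mu_smooth : driven_by_smooth_velocity mu T)
    (mu_even : forall t : R, 0 <= t <= 1 -> even_measure (mu t))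
    (mu_poincare : forall t : R, 0 <= t <= 1 -> odd_poincare1 (mu t))
    (mu_entropy : exists2 t : R, 0 <= t <= 1 &
       (relative_entropy (mu t) (gauss_measure n) < +oo)%E) :
  let D (t : R) := relative_entropy (mu t) (gauss_measure n) in
  (forall t : R, 0 < t < 1 -> D t \is a fin_num) /\
  exists2 D' : R -> R,
    distr_derivative `]0, 1[ (fun t => fine (D t)) D' &
    distr_derivative2_ge `]0, 1[ (fun t => fine (D t))
      (fun t => 2 * fine (W2 (mu 0) (mu 1)) ^+ 2 + n%:R^-1 * D' t ^+ 2).
Proof.
move=> D; have [theta [th1 th2 th3 _]] := mu_smooth.
have DR : driven mu T theta by split.
have [t0 t01 Dt0] := mu_entropy.
have l0 := relative_entropy_finite DR t01 Dt0.
have lmu s : 0 < s < 1 -> log_integrable mu s.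
  by move=> s01; exact: (log_integrable_interior DR s01 t01 l0).
have DE s : 0 < s < 1 -> D s = (mean_log mu s)%:E.
  by move=> s01; exact: (relative_entropy_mean_log DR (itv_cc s01) (lmu _ s01)).
split; first by move=> t /DE ->.
have dD t : 0 < t < 1 -> is_derive (t : R) 1 ((fun t => fine (D t)) : R -> R^o) (ent1 mu T theta t).
  move=> t01'; have d := is_derive_mean_log DR lmu t01'.
  (* The entropy is identified with [mean_log] at interior times only, hence the passage through a
     neighbourhood of t. *)
  apply: near_eq_is_derive d.
  have t01'' : t \in `]0, 1[ by rewrite in_itv.
  by apply: filterS (near_in_itvoo t01'') => s; rewrite in_itv/= => s01; rewrite DE.
have da t := is_derive_ent1 DR (t := t).
have ca t : 0 < t < 1 -> {for t, continuous (ent1 mu T theta)}.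
  by move=> t01'; exact: is_derive_continuous (da t t01').
exists (ent1 mu T theta); first exact: distr_derivative_01.
apply: (distr_derivative2_ge_01 dD da (continuous_ent2 DR)).
  by move=> t t01'; apply: continuous_cst_sqr; exact: ca.
move=> t t01'; apply: le_trans (ent2_ge DR n_gt0 t01').
rewrite lerD2r ler_wpM2l//; apply: W2_le.
- exact: driven_measurable_T DR.
- by move=> A mA; have [[_ + _] _] := mu_interp; apply.
- exact: integ_sqdisp DR.
Qed.
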